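(* Let $d\ge 2$ be an integer and $1<b<\frac{d+1}{d-1}$. Then the closure of the set $$\{\lambda\in\mathbb C: Z_T(\lambda,b)=0\text{ for some spherically symmetric tree }T\text{ of degree at most }d\}$$ contains $\operatorname{Arc}[\lambda_0,\lambda_2]$.
   Context: For a finite simple graph $G=(V,E)$, $Z_G(\lambda,b)=\sum_{U\subseteq V}\lambda^{|U|}b^{|\delta(U)|}$, where $\delta(U)$ is the set of edges with one endpoint in $U$ and the other in $V\setminus U$. Spherically symmetric trees of degree at most $d$: given a sequence $(k_1,k_2,\dots)\in\{1,\dots,d\}^{\mathbb N}$, let $T_0$ be a single (root) vertex and recursively let $T_n$ consist of a root vertex joined by edges to the roots of $k_n$ disjoint copies of $T_{n-1}$. The trees $T_n$ obtained in this way (for all sequences and all $n\ge 0$) are the spherically symmetric trees of degree at most $d$. $\mathbb S^1$ is the unit circle. For $\alpha,\beta\in\mathbb S^1$, $\operatorname{Arc}[\alpha,\beta]$ is the closed circular arc from $\alpha$ to $\beta$ traversed counterclockwise, with analogous notation for open and half-open arcs. For $1\le k\le d$ let $f_{k,\lambda}(z)=\lambda\left(\frac{z+b}{bz+1}\right)^k$. $\lambda_0=e^{i\theta_0}\in\mathbb S^1$ is the parameter with the smallest positive angle $\theta_0$ for which $f_{d,\lambda_0}(\lambda_0)=1$; $\lambda_1\in\mathbb S^1$ is the unique parameter with $0<\arg\lambda_1<\pi$ for which $f_{d,\lambda_1}$ has a parabolic fixed point; one has $0<\arg\lambda_0<\arg\lambda_1<\pi$. For $\lambda\in\operatorname{Arc}(\overline{\lambda_1},\lambda_1)$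 the map $f_{d,\lambda}$ has a unique attracting fixed point, which lies on $\mathbb S^1$; $I_\lambda$ denotes the connected component of (Fatou set of $f_{d,\lambda}$)$\,\cap\,\mathbb S^1$ containing it. Finally, $\lambda_2\in\operatorname{Arc}(\lambda_0,\lambda_1]$ is the parameter of maximal argument such that for every $\lambda\in\operatorname{Arc}[\lambda_0,\lambda_2)$ and every $k\in\{1,\dots,d-1\}$ the closure of $f_{1,\lambda}\circ f_{k,\lambda}(I_\lambda)$ is contained in $I_\lambda$ (such a parameter exists). *)

(* Defs.v *)
From HB Require Import structures.
From mathcomp Require Import all_boot all_order all_algebra complex.
From mathcomp Require Import all_classical all_reals all_analysis.

Set Implicit Arguments.
Unset Strict Implicit.
Unset Printing Implicit Defensive.

Import Order.TTheory GRing.Theory Num.Theory.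
Import numFieldNormedType.Exports.

Local Open Scope classical_set_scope.
Local Open Scope ring_scope.
Local Open Scope complex_scope.

(* Packing R[i] as a numClosedFieldType constant gives its carrier the norm
   topology that MathComp-Analysis puts on every numFieldType. *)
Definition Cx (R : realType) : numClosedFieldType := R[i].

Record sgraph := SGraph {
  vertex : finType;
  adj : rel vertex;
  adj_sym : symmetric adj;
  adj_irr : irreflexive adj }.

(* Each edge of delta(U) occurs exactly once, oriented from its endpoint in U
   to its endpoint outside U. *)
Definition edge_boundary (G : sgraph) (U : {set vertex G}) :
    {set vertex G * vertex G} :=
  [set e : vertex G * vertex G | [&& adj e.1 e.2, e.1 \in U & e.2 \notin U]].

Definition Zpart (R : realType) (G : sgraph) (l : Cx R) (b : R) : Cx R :=
  \sum_(U : {set vertex G}) l ^+ #|U| * (b%:C : Cx R) ^+ #|edge_boundary U|.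

Record rooted := Rooted { tree_graph : sgraph; tree_root : vertex tree_graph }.

Lemma unit_adj_sym : symmetric (fun _ _ : unit => false).
Proof. by []. Qed.

Lemma unit_adj_irr : irreflexive (fun _ : unit => fun _ : unit => false).
Proof. by []. Qed.

Definition one_vertex : rooted := @Rooted (SGraph unit_adj_sym unit_adj_irr) tt.

(* [None] is the new root and [Some (i, x)] is the vertex x of the i-th copy. *)
Definition join_adj (k : nat) (T : rooted) :
    rel (option ('I_k * vertex (tree_graph T))) :=
  fun x y => match x, y with
  | None, None => false
  | None, Some (_, v) => v == tree_root T
  | Some (_, u), None => u == tree_root T
  | Some (i, u), Some (j, v) => (i == j) && adj u v
  end.

Lemma join_adj_sym (k : nat) (T : rooted) : symmetric (@join_adj k T).
Proof. by move=> [[i u]|] [[j v]|] //=; rewrite eq_sym adj_sym. Qed.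

Lemma join_adj_irr (k : nat) (T : rooted) : irreflexive (@join_adj k T).
Proof. by move=> [[i u]|] //=; rewrite adj_irr andbF. Qed.

Definition join_copies (k : nat) (T : rooted) : rooted :=
  @Rooted (SGraph (@join_adj_sym k T) (@join_adj_irr k T)) None.

(* The value k 0 is never used: sequences are indexed from 1. *)
Fixpoint sphtree (k : nat -> nat) (n : nat) : rooted :=
  if n is n'.+1 then join_copies (k n) (sphtree k n') else one_vertex.

Definition spherically_symmetric (d : nat) (T : rooted) : Prop :=
  exists2 k : nat -> nat, (forall i, (0 < i)%N -> (1 <= k i <= d)%N) &
  exists n : nat, T = sphtree k n.

Definition lee_yang_zeros (R : realType) (d : nat) (b : R) : set (Cx R) :=
  [set l | exists2 T, spherically_symmetric d T & Zpart (tree_graph T) l b = 0].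

Definition unit_circle (R : realType) : set (Cx R) := [set z | `|z| = 1].

Definition expi (R : realType) (t : R) : Cx R := cos t +i* sin t.

(* Principal argument in ]-pi, pi] of a nonzero complex number. *)
Definition carg (R : realType) (z : Cx R) : R :=
  let a := acos (complex.Re z / complex.Re `|z|) in
  if 0 <= complex.Im z then a else - a.

(* With beta = alpha e^(it) and 0 <= t < 2 pi, the interval J t (with endpoints
   0 and t) parametrizes the counterclockwise arc from alpha to beta. *)
Definition ccw_arc (R : realType) (J : R -> interval R) (alpha beta : Cx R) :
    set (Cx R) :=
  [set z | exists s t : R, [/\ 0 <= t < 2 * pi, beta = alpha * expi t,
                              s \in J t & z = alpha * expi s]].

Definition Arc_cc (R : realType) := @ccw_arc R (fun t => `[0, t]).
Definition Arc_co (R : realType) := @ccw_arc R (fun t => `[0, t[).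
Definition Arc_oc (R : realType) := @ccw_arc R (fun t => `]0, t]).

Definition riemann_sphere (R : realType) := one_point_compactification (Cx R).

(* The convergence in the last line is convergence to g in the compact-open
   topology on U; for continuous F it is locally uniform convergence on U with
   respect to the spherical metric. *)
Definition normal_iterates (R : realType)
    (F : riemann_sphere R -> riemann_sphere R) (U : set (riemann_sphere R)) :
    Prop :=
  forall n : nat -> nat,
  exists2 phi : nat -> nat, {homo phi : i j / (i < j)%N} &
  exists2 g : riemann_sphere R -> riemann_sphere R, {within U, continuous g} &
  forall K O : set (riemann_sphere R),
    compact K -> K `<=` U -> open O -> g @` K `<=` O ->
    \forall j \near \oo, iter (n (phi j)) F @` K `<=` O.

Definition fatou_set (R : realType)
    (F : riemann_sphere R -> riemann_sphere R) : set (riemann_sphere R) :=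
  [set x | exists U : set (riemann_sphere R),
             [/\ open U, U x & normal_iterates F U]].

Definition fixed_multiplier (R : realType) (f : Cx R -> Cx R) (z mu : Cx R) :
    Prop :=
  f z = z /\ is_derive z 1 f mu.

Definition attracting_fixpoint (R : realType) (f : Cx R -> Cx R) (z : Cx R) :
    Prop :=
  exists2 mu, fixed_multiplier f z mu & `|mu| < 1.

Definition parabolic_fixpoint (R : realType) (f : Cx R -> Cx R) (z : Cx R) :
    Prop :=
  exists2 mu, fixed_multiplier f z mu &
  exists2 m : nat, (0 < m)%N & mu ^+ m = 1.

Definition fising (R : realType) (b : R) (k : nat) (l z : Cx R) : Cx R :=
  l * ((z + b%:C) / ((b%:C : Cx R) * z + 1)) ^+ k.

(* Extension of fising to the Riemann sphere, for k > 0, l != 0 and b > 1: the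
   only pole is -1/b, and infinity is sent to l / b ^ k. *)
Definition Fising (R : realType) (b : R) (k : nat) (l : Cx R)
    (x : riemann_sphere R) : riemann_sphere R :=
  match x with
  | Some z => if (b%:C : Cx R) * z + 1 == 0 then None else Some (fising b k l z)
  | None => Some (l / (b%:C : Cx R) ^+ k)
  end.

(* The attracting fixed point p is unique for the parameters considered, and
   it lies on the circle. *)
Definition Iset (R : realType) (d : nat) (b : R) (l : Cx R) : set (Cx R) :=
  [set w | exists2 p, attracting_fixpoint (fising b d l) p &
     connected_component
       ([set z | fatou_set (Fising b d l) (Some z)] `&` @unit_circle R) p w].

Definition is_lambda0 (R : realType) (d : nat) (b : R) (l0 : Cx R) : Prop :=
  exists theta0 : R,
    [/\ 0 < theta0, l0 = expi theta0, fising b d l0 l0 = 1 &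
        forall theta : R, 0 < theta ->
          fising b d (expi theta) (expi theta) = 1 -> theta0 <= theta].

Definition is_lambda1 (R : realType) (d : nat) (b : R) (l1 : Cx R) : Prop :=
  [/\ unit_circle l1, 0 < carg l1 < pi &
      exists z, parabolic_fixpoint (fising b d l1) z].

Definition invariance_up_to (R : realType) (d : nat) (b : R) (l0 l2 : Cx R) :
    Prop :=
  forall l, Arc_co l0 l2 l -> forall k : nat, (1 <= k <= d.-1)%N ->
    closure ((fising b 1 l \o fising b k l) @` Iset d b l) `<=` Iset d b l.

Definition is_lambda2 (R : realType) (d : nat) (b : R) (l0 l1 l2 : Cx R) :
    Prop :=
  [/\ Arc_oc l0 l1 l2, invariance_up_to d b l0 l2 &
      forall l, Arc_oc l0 l1 l -> invariance_up_to d b l0 l ->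
        carg l <= carg l2].

(* Main.v *)
Require Import Defs.
From HB Require Import structures.
From mathcomp Require Import all_boot all_order all_algebra complex.
From mathcomp Require Import all_classical all_reals all_analysis.
From mathcomp Require Import ring lra zify.

(* Write l = e^(i th).  On the circle f_k lifts to Phi_k x = th - k Gam x, and the
   ratio of the partition functions of T_n with occupied and with empty root is
   e^(i X_(n+1)), where X_0 = 0 and X_(n+1) is the image of X_n under Phi_(k_n); so
   l is a zero exactly when some X_n = pi mod 2 pi.  The arc I_l is (p, q), where
   {p, q} is a 2-cycle of f_d that bounds the basin of the attracting fixed point.

   Suppose that an interval of parameters contains no zero.  Then no X_n can cross
   p or q inside the interval, for otherwise iterating f_d o f_d would sweep it
   through pi.  Since f_d and the f_1 o f_k cover the complement of the arc, some
   word of letters keeps the orbit of 0 outside of the arc at one parameter, hence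
   at all of them.  Outside of the arc the system expands the Hilbert metric of the
   complement, so the orbit at a parameter al can be shadowed by pulling back its
   far end; the starting points of these shadowing chains are holomorphic in l near
   e^(i al) and uniformly bounded, and they collapse to 0 to the right of al because
   the orbit of 0 is trapped there.  By Vitali's theorem they collapse to the left as
   well, so the orbit of 0 stays outside of the arc further to the left, and
   therefore down to th0.  But at th0 one has p = 0, which forces the word to be
   d d d ..., and for th > th0 that orbit is not confined, because 0 < p. *)

Set Implicit Arguments.
Unset Strict Implicit.
Unset Printing Implicit Defensive.

Import Order.TTheory GRing.Theory Num.Theory.
Import numFieldNormedType.Exports.

Local Open Scope classical_set_scope.
Local Open Scope ring_scope.
Local Open Scope complex_scope.

(** * Calculus on the line *)

(** Absence of zeros acts only inside the small interval, where it keeps one word confined; the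
    continuation to the left of that interval rests on expansion. It has to go all the way to [th0],
    the one place where confinement determines the word. Two obstacles shape the middle of the
    proof. First, f_d exchanges the endpoints of (p, q), so the arc is not mapped strictly into
    itself and expansion outside of it is not uniform. A slightly smaller arc is used instead, which
    f_d and all f_1 o f_k map strictly inside; an orbit that avoids it cannot enter (p, q) either,
    because it would be attracted into it. Letters k < d occur only in blocks (k, 1), since
    invariance is known for f_1 o f_k and not for f_k. Second, forward orbits depend on the
    parameter with growing derivatives. Backward steps contract, so the start of a chain with
    prescribed far end is controlled on a disc of parameters whose radius does not depend on the
    length. The starts are approximated by polynomials in the parameter, built from finitely many
    Newton steps, and a weighted l^1 norm of coefficients takes the place of Cauchy estimates. *)

Section RealLemmas.
Variable R : realType.
Implicit Types x y : R.

Lemma is_derive_within (f f' : R -> R) a c :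
  (forall x, is_derive x 1 f (f' x)) -> {within `[a, c], continuous f}.
Proof.
move=> H; apply: continuous_subspaceT => x.
by apply: differentiable_continuous; apply/derivable1_diffP; apply: ex_derive.
Qed.

Lemma is_derive_within_cc (f f' : R -> R) a c :
  (forall x, a <= x <= c -> is_derive x 1 f (f' x)) ->
  {within `[a, c], continuous f}.
Proof.
move=> H; apply: derivable_within_continuous => x; rewrite in_itv /= => hx.
by have := H x hx => ?; apply: ex_derive.
Qed.

Lemma MVTd (f f' : R -> R) a c : a < c ->
  (forall x, a <= x <= c -> is_derive x 1 f (f' x)) ->
  exists2 x, a < x < c & f c - f a = f' x * (c - a).
Proof.
move=> ac H.
have [|x] := @MVT R f f' a c ac _ (@is_derive_within_cc f f' a c H).
  by move=> x; rewrite in_itv /= => /andP[? ?]; apply: H; rewrite !ltW.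
by rewrite in_itv /= => hx e; exists x.
Qed.

Lemma IVTr (f : R -> R) a c v : a <= c -> {within `[a, c], continuous f} ->
  (f a <= v <= f c) || (f c <= v <= f a) -> exists2 x, a <= x <= c & f x = v.
Proof.
move=> ac fc h; have [|x] := @IVT R f a c v ac fc.
  by case/orP: h => /andP[h1 h2]; rewrite ge_min le_max h1 h2 ?orbT.
by rewrite in_itv; exists x.
Qed.

Lemma le_derive (f f' : R -> R) a c : a <= c ->
  (forall x, a <= x <= c -> is_derive x 1 f (f' x)) ->
  (forall x, a <= x <= c -> 0 <= f' x) -> f a <= f c.
Proof.
rewrite le_eqVlt => /orP[/eqP->//|ac] H h.
have [x /andP[x1 x2] e] := @MVTd f f' a c ac H.
by rewrite -subr_ge0 e mulr_ge0 ?h ?(ltW x1) ?(ltW x2) ?subr_ge0 ?(ltW ac).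
Qed.

Lemma lt_derive (f f' : R -> R) a c : a < c ->
  (forall x, a <= x <= c -> is_derive x 1 f (f' x)) ->
  (forall x, a < x < c -> 0 < f' x) -> f a < f c.
Proof.
move=> ac H h.
have [x hx e] := @MVTd f f' a c ac H.
by rewrite -subr_gt0 e mulr_gt0 ?h ?subr_gt0.
Qed.

Lemma sinz x (z : int) : sin (x + 2 * pi * z%:~R) = sin x.
Proof.
have h y n : sin (y + 2 * pi * n%:R) = sin y.
  by rewrite mulr_natl mulr_natr (periodicn (@sinD2pi R)).
case: z => n; first exact: h.
rewrite NegzE mulrNz -[LHS](h _ n.+1); congr sin.
by rewrite mulrN -addrA addNr addr0.
Qed.

Lemma cosz x (z : int) : cos (x + 2 * pi * z%:~R) = cos x.
Proof.
rewrite -[x + _](subrK (pi / 2)) -[x in RHS](subrK (pi/2)) !cosDpihalf addrAC.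
by rewrite sinz.
Qed.

End RealLemmas.
(** * The angular map Gam *)

Section Gamma.
Variables (R : realType) (b : R).
Hypothesis hb : 1 < b.
Implicit Types x y : R.

(* [Nsq b x] = |b e^(ix) + 1|^2, and (e^(ix) + b) / (b e^(ix) + 1) = e^(- i Gam x). *)
Definition Nsq x := b ^+ 2 + 1 + 2 * b * cos x.
Definition Gam x := x - 2 * atan (sin x / (b + cos x)).
Definition dGam x := (b ^+ 2 - 1) / Nsq x.

Lemma b2_gt1 : 0 < b ^+ 2 - 1.
Proof.
have hb1 := hb.
have -> : b ^+ 2 - 1 = (b - 1) * (b + 1) by ring.
by rewrite mulr_gt0//; lra.
Qed.

Lemma bcos_gt0 x : 0 < b + cos x.
Proof. have hb1 := hb. have := cos_geN1 x; lra. Qed.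

Lemma Nsq_ge x : (b - 1) ^+ 2 <= Nsq x.
Proof.
have hb1 := hb.
rewrite /Nsq -subr_ge0.
have -> : b ^+ 2 + 1 + 2 * b * cos x - (b - 1) ^+ 2 = 2 * b * (cos x + 1) by ring.
have := cos_geN1 x; move=> h; rewrite mulr_ge0//; lra.
Qed.

Lemma Nsq_le x : Nsq x <= (b + 1) ^+ 2.
Proof.
have hb1 := hb.
rewrite /Nsq -subr_ge0.
have -> : (b + 1) ^+ 2 - (b ^+ 2 + 1 + 2 * b * cos x) = 2 * b * (1 - cos x) by ring.
have := cos_le1 x; move=> h; rewrite mulr_ge0//; lra.
Qed.

Lemma Nsq_gt0 x : 0 < Nsq x.
Proof. have hb1 := hb. by apply: lt_le_trans (Nsq_ge x); rewrite exprn_gt0// subr_gt0. Qed.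

Lemma dGam_gt0 x : 0 < dGam x.
Proof. have hb1 := hb. by rewrite divr_gt0 ?b2_gt1 ?Nsq_gt0. Qed.

Lemma is_derive_Gam x : is_derive x 1 Gam (dGam x).
Proof.
have hb1 := hb.
have h := bcos_gt0 x; have h0 : b + cos x != 0 by rewrite gt_eqF.
have d1 : is_derive x 1 (fun x => (b + cos x)^-1) (- (b + cos x) ^- 2 *: (0 + - sin x)).
  by apply: is_deriveV.
have d2 : is_derive x 1 (fun x => sin x / (b + cos x))
   (sin x *: (- (b + cos x) ^- 2 *: (0 + - sin x)) + (b + cos x)^-1 *: cos x).
  by apply: is_deriveM.
have d3 : is_derive x 1 (fun x => atan (sin x / (b + cos x)))
   ((1 + (sin x / (b + cos x)) ^+ 2)^-1 * (sin x *: (- (b + cos x) ^- 2 *: (0 + - sin x)) + (b + cos x)^-1 *: cos x)).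
  exact: (@is_derive1_comp R atan (fun x => sin x / (b + cos x))).
rewrite /Gam; apply: is_derive_eq.
rewrite /dGam /GRing.scale /=.
have c2 := cos2Dsin2 x.
have N0 := Nsq_gt0 x.
have h2 : (b + cos x) ^+ 2 + sin x ^+ 2 = Nsq x by rewrite /Nsq; lra.
have -> : 1 + (sin x / (b + cos x)) ^+ 2 = Nsq x / (b + cos x) ^+ 2.
  by rewrite -h2; field.
have N1 : Nsq x != 0 by rewrite gt_eqF.
have -> : (b ^+ 2 - 1) / Nsq x = 1 - 2 * (b * cos x + 1) / Nsq x.
  by move: N1; rewrite /Nsq => N1; field.
have -> : b * cos x + 1 = (b + cos x) * cos x + sin x ^+ 2 by lra.
by field; rewrite h0 N1.
Qed.

Lemma ltr_Gam x y : x < y -> Gam x < Gam y.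
Proof.
move=> xy; exact: (@lt_derive R Gam dGam x y xy (fun z _ => is_derive_Gam z) (fun z _ => dGam_gt0 z)).
Qed.

Lemma ler_Gam x y : x <= y -> Gam x <= Gam y.
Proof. have hb1 := hb. by rewrite le_eqVlt => /orP[/eqP->//|/ltr_Gam/ltW]. Qed.

Lemma Gam_lt x y : (Gam x < Gam y) = (x < y).
Proof. have hb1 := hb. by apply/idP/idP => [|/ltr_Gam//]; rewrite !ltNge; apply: contra; exact: ler_Gam. Qed.

Lemma Gam_le x y : (Gam x <= Gam y) = (x <= y).
Proof. have hb1 := hb. by rewrite !leNgt Gam_lt. Qed.

Lemma Gam_inj x y : Gam x = Gam y -> x = y.
Proof. have hb1 := hb. by move=> e; apply/eqP; rewrite eq_le -(Gam_le x y) -(Gam_le y x) e lexx. Qed.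

Lemma Gam0 : Gam 0 = 0.
Proof. by rewrite /Gam sin0 mul0r atan0 mulr0 subrr. Qed.

Lemma Gampi : Gam pi = pi.
Proof. by rewrite /Gam sinpi mul0r atan0 mulr0 subr0. Qed.

Lemma GamN x : Gam (- x) = - Gam x.
Proof. by rewrite /Gam sinN cosN mulNr atanN mulrN opprD. Qed.

Lemma Gamz x (z : int) : Gam (x + 2 * pi * z%:~R) = Gam x + 2 * pi * z%:~R.
Proof. by rewrite /Gam sinz cosz; ring. Qed.

Lemma dGamz x (z : int) : dGam (x + 2 * pi * z%:~R) = dGam x.
Proof. by rewrite /dGam /Nsq cosz. Qed.

Lemma cont_Gam a c : {within `[a, c], continuous Gam}.
Proof. have hb1 := hb. exact: (@is_derive_within R Gam dGam _ _ is_derive_Gam). Qed.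

Lemma continuous_Gam : continuous Gam.
Proof.
move=> x; have [D _] := is_derive_Gam x.
exact/differentiable_continuous/derivable1_diffP.
Qed.

Lemma Gam_bound x : x - pi <= Gam x <= x + pi.
Proof.
have := atan_gtNpi2 (sin x / (b + cos x)); have := atan_ltpi2 (sin x / (b + cos x)).
rewrite /Gam; lra.
Qed.

Lemma Gam_surj y : exists x, Gam x = y.
Proof.
have hb1 := hb.
have h1 := Gam_bound (y - pi); have h2 := Gam_bound (y + pi).
have [|||x _ <-] := @IVTr R Gam (y - pi) (y + pi) y; last by exists x.
- have := pi_gt0 R; lra.
- exact: cont_Gam.
- by apply/orP; left; apply/andP; split; lra.
Qed.

(** The number b e^(ix/2) + e^(-ix/2) has real part (b + 1) cos (x/2), imaginary part (b - 1) sin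
    (x/2), modulus sqrt ([Nsq b x]) and argument [Gam b x / 2]. *)
Lemma sin_Gam2 x : sin (Gam x / 2) = (b - 1) * sin (x / 2) / Num.sqrt (Nsq x) /\
                  cos (Gam x / 2) = (b + 1) * cos (x / 2) / Num.sqrt (Nsq x).
Proof.
have hb1 := hb.
set A := atan (sin x / (b + cos x)).
have -> : Gam x / 2 = x / 2 - A by rewrite /Gam -/A; field.
have h := bcos_gt0 x; have N0 := Nsq_gt0 x.
have h0 : b + cos x != 0 by rewrite gt_eqF.
have c2 := cos2Dsin2 x.
have h2 : (b + cos x) ^+ 2 + sin x ^+ 2 = Nsq x by rewrite /Nsq; lra.
have s0 : 0 < Num.sqrt (Nsq x) by rewrite sqrtr_gt0.
have s1 : Num.sqrt (Nsq x) != 0 by rewrite gt_eqF.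
have cA : cos A = (b + cos x) / Num.sqrt (Nsq x).
  rewrite cos_atan.
  have -> : 1 + (sin x / (b + cos x)) ^+ 2 = Nsq x / (b + cos x) ^+ 2.
    by rewrite -h2; field.
  by rewrite sqrtrM ?ltW// sqrtrV ?sqr_ge0// sqrtr_sqr gtr0_norm// invfM invrK mulrC.
have sA : sin A = sin x / Num.sqrt (Nsq x).
  have : tan A = sin x / (b + cos x) by rewrite /A atanK.
  rewrite /tan cA invfM invrK => /(congr1 (fun u => u * ((b + cos x) / Num.sqrt (Nsq x)))) E.
  have -> : sin x / Num.sqrt (Nsq x) = sin x / (b + cos x) * ((b + cos x) / Num.sqrt (Nsq x)) by field; rewrite h0 s1.
  by rewrite -E; field; rewrite h0 s1.
have sx : sin x = 2 * sin (x / 2) * cos (x / 2).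
  rewrite {1}(_ : x = (x / 2) *+ 2); last by rewrite -mulr_natr; field.
  by rewrite sin_mulr2n -mulr_natl; ring.
have cx : cos x = 2 * cos (x / 2) ^+ 2 - 1.
  rewrite {1}(_ : x = (x / 2) *+ 2); last by rewrite -mulr_natr; field.
  by rewrite cos_mulr2n -mulr_natl; ring.
have c3 := cos2Dsin2 (x / 2).
have s2 : sin (x / 2) ^+ 2 = 1 - cos (x / 2) ^+ 2 by lra.
rewrite sinB cosB cA sA; split; rewrite !mulrA -(mulrBl, mulrDl); congr (_ / _).
  by rewrite sx cx; ring.
have -> : sin (x / 2) * sin x = 2 * cos (x / 2) * (sin (x / 2) ^+ 2) by rewrite sx; ring.
by rewrite s2 cx; ring.
Qed.

(** Signed form of the identity |g z - g w|^2 = |g' z| |g' w| |z - w|^2 of Moebius maps, chords of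
    the circle being 2 |sin ((x - y) / 2)|. All invariance of cross-ratios used below comes from
    it. *)
Lemma sin_GamB x y : sin ((Gam x - Gam y) / 2) =
  (b ^+ 2 - 1) / (Num.sqrt (Nsq x) * Num.sqrt (Nsq y)) * sin ((x - y) / 2).
Proof.
have hb1 := hb.
have [s1 c1] := sin_Gam2 x; have [s2 c2] := sin_Gam2 y.
have sx : Num.sqrt (Nsq x) != 0 by rewrite sqrtr_eq0 -ltNge Nsq_gt0.
have sy : Num.sqrt (Nsq y) != 0 by rewrite sqrtr_eq0 -ltNge Nsq_gt0.
rewrite (mulrBl 2^-1 (Gam x)) sinB s1 c1 s2 c2 (mulrBl 2^-1 x) sinB.
by field; rewrite sx sy.
Qed.

Lemma dGamM x y : (sin ((Gam x - Gam y) / 2)) ^+ 2 = dGam x * dGam y * sin ((x - y) / 2) ^+ 2.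
Proof.
have hb1 := hb.
rewrite sin_GamB exprMn expr_div_n exprMn !sqr_sqrtr ?(ltW (Nsq_gt0 _))//.
by rewrite /dGam; field; rewrite !gt_eqF ?Nsq_gt0.
Qed.

End Gamma.

(** * Multiple angles, cotangents and the Hilbert density of an arc complement *)

Section Trig.
Variable R : realType.
Implicit Types x y u v : R.

Lemma sin_natM_le (k : nat) u : `|sin (k%:R * u)| <= k%:R * `|sin u|.
Proof.
elim: k => [|k IH]; first by rewrite !mul0r sin0 normr0.
rewrite -natr1 !mulrDl !mul1r sinD (le_trans (ler_normD _ _))//.
rewrite !normrM lerD//.
  by rewrite -[leRHS]mulr1 ler_pM ?cos_max.
by rewrite -[leRHS]mul1r ler_wpM2r ?cos_max.
Qed.

Lemma sin_natM_lt (k : nat) u : (2 <= k)%N -> sin u != 0 ->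
  `|sin (k%:R * u)| < k%:R * `|sin u|.
Proof.
case: k => [//|k]; rewrite ltnS => k0 su.
rewrite -natr1 !mulrDl !mul1r sinD (le_lt_trans (ler_normD _ _))//.
have s0 : 0 < `|sin u| by rewrite normr_gt0.
have c1 : `|cos u| < 1.
  rewrite -(@ltr_pXn2r _ 2)// ?nnegrE// expr1n real_normK ?num_real//.
  by rewrite cos2sin2 ltrBlDr ltrDl -real_normK ?num_real// exprn_gt0.
rewrite !normrM ltr_leD//.
  apply: le_lt_trans (_ : k%:R * `|sin u| * `|cos u| < _).
    by rewrite ler_wpM2r// sin_natM_le.
  by rewrite -[ltRHS]mulr1 ltr_pM2l// mulr_gt0// ltr0n.
by rewrite -[leRHS]mul1r ler_wpM2r ?cos_max.
Qed.

Lemma sin_shift_sqr v (m : int) : sin (v - m%:~R * pi) ^+ 2 = sin v ^+ 2.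
Proof.
have h u : sin u ^+ 2 = (1 - cos (2 * u)) / 2.
  have -> : 2 * u = u *+ 2 by rewrite mulr_natl.
  by rewrite cos_mulr2n cos2sin2 -mulr_natl; field.
rewrite !h; congr ((1 - _) / 2).
rewrite -(cosz _ m); congr cos; ring.
Qed.

Lemma sin_neq0 v (m : int) : m%:~R * pi < v -> v < (m%:~R + 1) * pi -> sin v != 0.
Proof.
move=> h1 h2; rewrite -sqrf_eq0 -(sin_shift_sqr v m) sqrf_eq0 gt_eqF//.
by rewrite sin_gt0_pi// subr_gt0 h1 ltrBlDr; rewrite mulrDl mul1r addrC in h2.
Qed.

Lemma sin_eq0P v : sin v = 0 -> exists j : int, v = j%:~R * pi.
Proof.
move=> s0; have p0 := pi_gt0 R.
have [h1 h2] := (floor_le_tmp (v / pi), floorD1_gt (v / pi)).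
exists (Num.floor (v / pi)); apply/eqP; rewrite eq_le leNgt; apply/andP; split.
  apply/negP => h3.
  suff : sin v != 0 by rewrite s0 eqxx.
  apply: (@sin_neq0 _ (Num.floor (v/pi))) => //.
  by rewrite -ltr_pdivrMr// -[1]/(1%:~R) -intrD.
by rewrite -ler_pdivlMr.
Qed.

Definition ct x := cos x / sin x.

Lemma ctB x y : sin x != 0 -> sin y != 0 -> ct y - ct x = sin (x - y) / (sin x * sin y).
Proof. by move=> x0 y0; rewrite /ct sinB; field; rewrite x0 y0. Qed.

Lemma is_derive_ct x : sin x != 0 -> is_derive x 1 ct (- (sin x) ^- 2).
Proof.
move=> s0; rewrite /ct.
have d1 : is_derive x 1 (fun x => (sin x)^-1) (- (sin x) ^- 2 *: cos x).
  by apply: is_deriveV.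
apply: is_derive_eq; rewrite /GRing.scale /=.
have c2 := cos2Dsin2 x.
apply: (mulfI s0); apply: (mulfI s0).
transitivity (- (cos x ^+ 2 + sin x ^+ 2)); last by rewrite c2; field.
by field.
Qed.

(* [k ct (k u) - ct u] is nonincreasing, since |sin (k u)| <= k |sin u|. *)
Lemma ct_natM (k : nat) (m : int) u v : (1 <= k)%N ->
  0 < v -> v <= u -> u < pi -> m%:~R * pi < k%:R * v -> k%:R * u < (m%:~R + 1) * pi ->
  ct v - ct u <= k%:R * (ct (k%:R * v) - ct (k%:R * u)).
Proof.
move=> k1 v0 vu u1 h1 h2.
have k0 : (0 : R) < k%:R by rewrite ltr0n.
have sne x : v <= x <= u -> sin x != 0.
  by move=> /andP[vx xu]; rewrite gt_eqF// sin_gt0_pi// (lt_le_trans v0)//= (le_lt_trans xu).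
have sne' x : v <= x <= u -> sin (k%:R * x) != 0.
  move=> /andP[vx xu]; apply: (@sin_neq0 _ m).
    by rewrite (lt_le_trans h1)// ler_wpM2l// ltW.
  by rewrite (le_lt_trans _ h2)// ler_wpM2l// ltW.
pose f x := ct x - k%:R * ct (k%:R * x).
pose f' x := - (sin x) ^- 2 - k%:R * (- (sin (k%:R * x)) ^- 2 * k%:R).
suff : f v <= f u by rewrite /f; lra.
apply: (@le_derive R f f') => // x hx.
  have d1 := is_derive_ct (sne x hx).
  have d2 : is_derive x 1 (fun x => ct (k%:R * x)) (- (sin (k%:R * x)) ^- 2 * k%:R).
    have d3 := is_derive_ct (sne' x hx).
    have d4 : is_derive x 1 (fun x => k%:R * x) k%:R.
      by apply: is_derive_eq; rewrite /GRing.scale /= mulr1.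
    exact: (@is_derive1_comp R ct (fun x => k%:R * x)).
  rewrite /f /f'; apply: is_derive_eq; rewrite /GRing.scale /=; ring.
rewrite /f'.
have s1 := sne x hx; have s2 := sne' x hx.
have -> : - (sin x) ^- 2 - k%:R * (- (sin (k%:R * x)) ^- 2 * k%:R) =
  (k%:R ^+ 2 * (sin x) ^+ 2 - (sin (k%:R * x)) ^+ 2) / ((sin x) ^+ 2 * (sin (k%:R * x)) ^+ 2).
  by field; rewrite s1 s2.
apply: divr_ge0; last by rewrite mulr_ge0 ?sqr_ge0.
rewrite subr_ge0 -exprMn.
rewrite -[_ ^+ 2]real_normK ?num_real// -[leRHS]real_normK ?num_real//.
by rewrite ler_pXn2r ?nnegrE// normrM (ger0_norm (ltW k0)) sin_natM_le.
Qed.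

(* Twice the density at x of the Hilbert metric of the complement of the arc [A, B]. *)
Definition K (A B x : R) := sin ((B - A) / 2) / (sin ((x - A) / 2) * sin ((x - B) / 2)).

Lemma K_ct A B x : sin ((x - A) / 2) != 0 -> sin ((x - B) / 2) != 0 ->
  K A B x = ct ((x - B) / 2) - ct ((x - A) / 2).
Proof. by move=> h1 h2; rewrite ctB// /K; congr (sin _ / _); field. Qed.

Lemma sin_shift (z : int) : exists2 e : R, e ^+ 2 = 1 & forall w, sin (w + z%:~R * pi) = e * sin w.
Proof.
have s0 : sin (z%:~R * pi : R) = 0.
  by apply/eqP; rewrite -sqrf_eq0 -(sin_shift_sqr _ z) subrr sin0 expr0n.
exists (cos (z%:~R * pi)); first by rewrite cos2sin2 s0 expr0n subr0.
by move=> w; rewrite sinD s0 mulr0 addr0 mulrC.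
Qed.

Lemma Kz A B x (z : int) : K A B (x + 2 * pi * z%:~R) = K A B x.
Proof.
have [e e1 h] := sin_shift z.
have E y : (x + 2 * pi * z%:~R - y) / 2 = (x - y) / 2 + z%:~R * pi by field.
rewrite /K !E !h; congr (_ / _).
by rewrite mulrACA -expr2 e1 mul1r.
Qed.

End Trig.

(** * Sign changes at zeros and iteration of monotone maps *)

Section Calculus.
Variables (R : realType).

Lemma is_derive_cvg (f : R -> R) (f' s : R) : is_derive s 1 f f' -> f @ s --> f s.
Proof.
by move=> df; apply: differentiable_continuous; apply/derivable1_diffP; apply: ex_derive.
Qed.

Lemma cvg_pos (f : R -> R) (s : R) : f @ s --> f s -> 0 < f s ->
  exists2 e, 0 < e & forall y, s - e < y < s + e -> 0 < f y.
Proof.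
move=> cf f0.
have : \forall y \near s, 0 < f y by exact: (cvgr_gt _ cf _ f0).
move=> [e /= e0 H]; exists e => // y /andP[y1 y2]; apply: H.
by rewrite /= ltr_norml; apply/andP; split; lra.
Qed.

Lemma zero_pos (f : R -> R) (f' s : R) : is_derive s 1 f f' -> f s = 0 -> 0 < f' ->
  exists2 e, 0 < e & forall y, s - e < y < s + e -> (y < s -> f y < 0) /\ (s < y -> 0 < f y).
Proof.
move=> df fs f'0.
have cv : (fun h : R => h^-1 *: ((f \o shift s) (h *: 1) - f s)) @ 0^' --> f'.
  by rewrite -(@derive_val _ _ _ _ _ _ _ df); exact: (@ex_derive _ _ _ _ _ _ _ df).
have {cv} : \forall h \near 0^', 0 < h^-1 *: ((f \o shift s) (h *: 1) - f s).
  by exact: (cvgr_gt _ cv _ f'0).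
move=> [e /= e0 H]; exists e => // y /andP[y1 y2].
have key : y != s -> 0 < (y - s)^-1 * f y.
  move=> ys; have := H (y - s); rewrite /= /GRing.scale /= mulr1 subrK fs subr0; apply.
    by rewrite sub0r normrN ltr_norml; apply/andP; split; lra.
  by rewrite subr_eq0.
split => h.
  have := key (negbT (lt_eqF h)).
  by rewrite nmulr_rgt0// invr_lt0 subr_lt0.
have := key (negbT (gt_eqF h)).
by rewrite pmulr_rgt0// invr_gt0 subr_gt0.
Qed.

(** A function that increases through each of its zeros cannot return to 0: it would reach its next
    zero from positive values. For the second iterate minus the identity, [period2_expanding]
    supplies the hypothesis on the derivative. *)
Lemma pos_after_zero (f f' : R -> R) (x1 x : R) : x1 < x ->
  (forall y, x1 <= y <= x -> is_derive y 1 f (f' y)) ->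
  (forall y, x1 <= y <= x -> f y = 0 -> 0 < f' y) -> f x1 = 0 -> 0 < f x.
Proof.
move=> x1x df zf f1; rewrite ltNge; apply/negP => fx.
have le1 : x1 <= x1 <= x by rewrite lexx ltW.
have [e e0 He] := zero_pos (df x1 le1) f1 (zf x1 le1 f1).
(* A point strictly between [x1] and [x], close enough to [x1] for [f] to be positive there. *)
pose c := Num.min (x1 + e / 2) ((x1 + x) / 2).
have [c1 c2] : x1 < c /\ c < x.
  by rewrite /c; split; rewrite ?lt_min ?gt_min; [apply/andP; split; lra|apply/orP; right; lra].
have c3 : c < x1 + e by rewrite /c gt_min; apply/orP; left; lra.
have fc : 0 < f c by apply: (He c _).2 => //; apply/andP; split; lra.
(* Its infimum [s] is the first zero after [c]. Since [f' s > 0], some point between [c] and [s] has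
   a negative value, which contradicts minimality. *)
pose S := [set y | c <= y <= x /\ f y <= 0].
have Sx : S x by rewrite /S /= lexx (ltW c2).
have hS : has_inf S by split; [exists x|exists c => y [/andP[]]].
pose s := inf S.
have sle y : S y -> s <= y by move=> Sy; apply: ge_inf => //; case: hS.
have cs : c <= s by apply: lb_le_inf => [|y [/andP[]]//]; exists x.
have sx : s <= x by exact: sle.
have sin' : x1 <= s <= x by rewrite sx andbT (le_trans (ltW c1)).
have fs : f s <= 0.
  rewrite leNgt; apply/negP => fs.
  have [e' e'0 H] := cvg_pos (is_derive_cvg (df s sin')) fs.
  have [y Sy ys] := inf_adherent e'0 hS.
  have ly := sle _ Sy.
  case: Sy => _; apply/negP; rewrite -ltNge; apply: H.
  by rewrite ys andbT; rewrite -/s; lra.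
have fs0 : f s = 0.
  apply/eqP; rewrite eq_le fs leNgt; apply/negP => fsn.
  have cs' : c < s by rewrite lt_neqAle cs andbT; apply/eqP => E; move: fs; rewrite -E leNgt fc.
  have [||z /andP[cz zs] fz] := @IVTr R f c s 0 cs.
  - apply: (@is_derive_within_cc R f f') => y /andP[y1 y2]; apply: df.
    by rewrite (le_trans (ltW c1))//= (le_trans y2).
  - by rewrite (ltW fc) (ltW fsn) orbT.
  have : s <= z by apply: sle; split; [rewrite cz (le_trans zs)|rewrite fz].
  move=> sz; have E : s = z by apply/eqP; rewrite eq_le sz zs.
  by move: fsn; rewrite E fz ltxx.
have [e' e'0 H] := zero_pos (df s sin') fs0 (zf s sin' fs0).
have cs' : c < s by rewrite lt_neqAle cs andbT; apply/eqP => E; move: fs; rewrite -E leNgt fc.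
pose y := Num.max ((c + s) / 2) (s - e' / 2).
have [y1 y2] : y < s /\ s - e' < y.
  by rewrite /y; split; rewrite ?gt_max ?lt_max; [apply/andP; split; lra|apply/orP; right; lra].
have y3 : c < y by rewrite /y lt_max; apply/orP; left; lra.
have fy : f y < 0 by apply: (H y _).1 => //; rewrite y2; lra.
suff : s <= y by rewrite leNgt y1.
by apply: sle; split; [rewrite (ltW y3) (le_trans (ltW y1))|exact: ltW].
Qed.

Lemma neg_before_zero (f f' : R -> R) (x x1 : R) : x < x1 ->
  (forall y, x <= y <= x1 -> is_derive y 1 f (f' y)) ->
  (forall y, x <= y <= x1 -> f y = 0 -> 0 < f' y) -> f x1 = 0 -> f x < 0.
Proof.
move=> xx1 df zf f1.
have N y : (- x1 <= y <= - x) = (x <= - y <= x1) by rewrite lerNl lerNr andbC [- y <= _]lerNl.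
rewrite -oppr_gt0 -[x]opprK.
apply: (@pos_after_zero (fun y => - f (- y)) (fun y => f' (- y)) (- x1)).
- by rewrite ltrN2.
- move=> y; rewrite N => hy.
  have d1 := df _ hy.
  have d2 : is_derive y 1 (fun y => f (- y)) (f' (- y) * (-1)).
    apply: (@is_derive1_comp R f (fun y => - y)).
  by apply: is_derive_eq; rewrite mulrN1 opprK.
- by move=> y; rewrite N => hy /eqP; rewrite oppr_eq0 => /eqP; exact: zf.
- by rewrite opprK f1 oppr0.
Qed.

(* The infimum of the orbit cannot lie above [L], where [f] moves points down. *)
Lemma iter_lt (f : R -> R) (L M x : R) : {homo f : u v / u <= v} -> continuous f ->
  (forall y, L < y <= x -> f y < y) -> L < M -> exists n, iter n f x < M.
Proof.
move=> mf cf hf LM.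
apply: contrapT => H.
have {}H n : M <= iter n f x by rewrite leNgt; apply/negP => h; apply: H; exists n.
have dec n : iter n f x <= x.
  elim: n => //= n IH; apply: ltW; apply: lt_le_trans (IH).
  by apply: hf; rewrite IH (lt_le_trans LM).
pose S := [set y | exists n, y = iter n f x].
have hS : has_inf S.
  by split; [exists x, 0%N|exists M => _ [n ->]].
pose l := inf S.
have lle n : l <= iter n f x by apply: ge_inf; [case: hS|exists n].
have Ml : M <= l by apply: lb_le_inf => [|_ [n ->]//]; exists x, 0%N.
have fl : f l < l by apply: hf; rewrite (lt_le_trans LM Ml) (lle 0%N).
have [e e0 He] : exists2 e, 0 < e & forall y, l - e < y < l + e -> 0 < l - f y.
  apply: (@cvg_pos (fun y => l - f y)); last by rewrite subr_gt0.
  by apply: cvgB; [exact: cvg_cst|exact: cf].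
have [_ [n ->] hn] := inf_adherent e0 hS.
have := lle n.+1; rewrite leNgt => /negP; apply.
rewrite /= -subr_gt0; apply: He.
rewrite hn andbT (lt_le_trans _ (lle n))//; lra.
Qed.

Lemma iter_gt (f : R -> R) (L M x : R) : {homo f : u v / u <= v} -> continuous f ->
  (forall y, x <= y < L -> y < f y) -> M < L -> exists n, M < iter n f x.
Proof.
move=> mf cf hf LM.
pose g y := - f (- y).
have gn n : iter n g (- x) = - iter n f x.
  by elim: n => //= n ->; rewrite /g opprK.
have [||y||n] := @iter_lt g (- L) (- M) (- x).
- by move=> u v uv; rewrite lerN2 mf// lerN2.
- move=> y; apply: cvgN; apply: (@continuous_comp _ _ _ (fun y => - y) f).
    exact: opp_continuous.
  exact: cf.
- move=> /andP[y1 y2]; rewrite /g ltrNl; apply: hf.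
  by rewrite lerNr y2 ltrNl.
- by rewrite ltrN2.
by rewrite gn ltrN2 => h; exists n.
Qed.

End Calculus.

(** * Fixed points and the 2-cycle of the lift *)

Section Dynamics.
Variables (R : realType) (b : R).
Implicit Types x y u v th p q a r : R.

Definition Phi (k : nat) th x := th - k%:R * Gam b x.

Lemma PhiB (k : nat) th x y : Phi k th x - Phi k th y = k%:R * (Gam b y - Gam b x).
Proof. by rewrite /Phi; ring. Qed.

Lemma Phiz (k : nat) th x (z : int) :
  Phi k th (x + 2 * pi * z%:~R) = Phi k th x + 2 * pi * (- z * k)%:~R.
Proof. by rewrite /Phi Gamz mulNr mulrNz rmorphM /=; ring. Qed.

Hypothesis hb : 1 < b.

Lemma is_derive_Phi (k : nat) th x : is_derive x 1 (Phi k th) (- (k%:R * dGam b x)).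
Proof.
have d1 := is_derive_Gam hb x.
by rewrite /Phi; apply: is_derive_eq; rewrite /GRing.scale /=; ring.
Qed.

Lemma Phi_le (k : nat) th x y : (1 <= k)%N -> (Phi k th x <= Phi k th y) = (y <= x).
Proof.
move=> k1; rewrite -subr_ge0 PhiB pmulr_rge0 ?ltr0n// subr_ge0.
by rewrite Gam_le.
Qed.

Lemma Phi_lt (k : nat) th x y : (1 <= k)%N -> (Phi k th x < Phi k th y) = (y < x).
Proof. by move=> k1; rewrite !ltNge Phi_le. Qed.

Lemma continuous_Phi (k : nat) th : continuous (Phi k th).
Proof. by move=> x; exact: (is_derive_cvg (is_derive_Phi k th x)). Qed.

Lemma sin_Gam x : sin (Gam b x) = dGam b x * sin x.
Proof.
have [s1 c1] := sin_Gam2 hb x.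
have H (w : R) : sin w = 2 * sin (w / 2) * cos (w / 2).
  rewrite {1}(_ : w = (w / 2) *+ 2); last by rewrite -mulr_natr; field.
  by rewrite sin_mulr2n -mulr_natl; ring.
have N0 := Nsq_gt0 hb x.
rewrite H s1 c1 (H x) /dGam -[in RHS](sqr_sqrtr (ltW N0)); field.
by rewrite sqrtr_eq0 -ltNge.
Qed.

Lemma dGam_inc x y : 0 <= x -> x <= y -> y <= pi -> dGam b x <= dGam b y.
Proof.
move=> x0 xy yp; have hb1 := hb.
rewrite /dGam ler_wpM2l ?(ltW (b2_gt1 hb))// lef_pV2 ?posrE ?Nsq_gt0//.
rewrite /Nsq lerD2l ler_wpM2l//; first lra.
move: xy; rewrite le_eqVlt => /orP[/eqP->//|xy].
by apply: ltW; rewrite ltr_cos ?in_itv /= ?x0 ?yp ?(le_trans x0 (ltW xy)) ?(le_trans (ltW xy))//.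
Qed.

Lemma Gam_gt0 x : (0 < Gam b x) = (0 < x).
Proof. by rewrite -[X in X < Gam b _](Gam0 b) Gam_lt. Qed.

Lemma Gam_ge0 x : (0 <= Gam b x) = (0 <= x).
Proof. by rewrite -[X in X <= Gam b _](Gam0 b) Gam_le. Qed.

Lemma Gam_ltpi x : (Gam b x < pi) = (x < pi).
Proof. by rewrite -[X in Gam b _ < X](Gampi b) Gam_lt. Qed.

Variable d : nat.
Hypothesis hd : (2 <= d)%N.

Lemma d1 : (1 <= d)%N. Proof. exact: ltnW. Qed.

(* Cross-ratio invariance of the Moebius map gives
   d^2 Gam'(p) Gam'(q) = (d sin u / sin (d u))^2 with u = (Gam q - Gam p)/2. *)
Lemma period2_expanding th p q : p != q -> Phi d th p = q -> Phi d th q = p ->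
  1 < d%:R ^+ 2 * dGam b p * dGam b q.
Proof.
move=> pq e1 e2.
pose u := (Gam b q - Gam b p) / 2.
have E : (q - p) / 2 = d%:R * u.
  have -> : q - p = d%:R * (Gam b q - Gam b p) by rewrite -(PhiB d th) e1 e2.
  by rewrite /u; field.
have M := dGamM hb q p; rewrite E -/u in M.
have d0 : (0 : R) < d%:R by rewrite ltr0n ltnW.
(* If u = j pi, then q = p + 2 pi j, so (q - p)/2 = d u reads d u = u; as d > 1 this forces u = 0
   and p = q. *)
have su : sin u != 0.
  apply/eqP => s0.
  have [j uj] := sin_eq0P s0.
  have e3 : Gam b q = Gam b (p + 2 * pi * j%:~R).
    by rewrite Gamz; move: uj; rewrite /u; lra.
  have e4 := Gam_inj hb e3.
  have : d%:R * u = u by rewrite -E e4 uj; field.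
  move=> /eqP; rewrite -subr_eq0 -[X in _ - X]mul1r -mulrBl mulf_eq0 => /orP[|/eqP u0].
    by rewrite subr_eq0 pnatr_eq1 => /eqP d1; move: hd; rewrite d1.
  by move/eqP: pq; apply; move: E; rewrite u0 mulr0; lra.
have L : sin (d%:R * u) ^+ 2 < d%:R ^+ 2 * sin u ^+ 2.
  have L := sin_natM_lt hd su.
  rewrite -[X in X < _]real_normK ?num_real// -[sin u ^+ 2]real_normK ?num_real// -exprMn.
  by rewrite ltr_pXn2r// ?nnegrE ?mulr_ge0 ?ler0n.
move: L; rewrite M.
set s2 := sin _ ^+ 2.
have s20 : 0 < s2.
  rewrite lt_neqAle sqr_ge0 andbT eq_sym; apply/eqP => e.
  by move: M; rewrite -/s2 e mulr0 => /eqP; rewrite sqrf_eq0; apply/negP.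
rewrite -[X in X < _]mul1r mulrA ltr_pM2r// => H.
by rewrite (lt_le_trans H)// (mulrC (dGam b q)) mulrA.
Qed.

(** In terms of cotangents this is d cot (d w) < cot w. The difference of the two sides vanishes at
    0 and has derivative (d^2 - 1) sin x sin (d x). *)
Lemma sin_ct_lt (w : R) : 0 < w -> d%:R * w < pi ->
  d%:R * sin w * cos (d%:R * w) < sin (d%:R * w) * cos w.
Proof.
move=> w0 wp.
have d0 : (0 : R) < d%:R by rewrite ltr0n ltnW.
have d2 : (1 : R) < d%:R by rewrite ltr1n.
pose f x := sin (d%:R * x) * cos x - d%:R * sin x * cos (d%:R * x).
rewrite -subr_gt0.
have -> : 0 = f 0 by rewrite /f !mulr0 sin0 !mul0r mulr0 mul0r subrr.
apply: (@lt_derive R f (fun x => (d%:R ^+ 2 - 1) * (sin x * sin (d%:R * x)))) => // x hx.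
  have d4 : is_derive x 1 (fun x => d%:R * x) d%:R.
    by apply: is_derive_eq; rewrite /GRing.scale /= mulr1.
  have d5 : is_derive x 1 (fun x => sin (d%:R * x)) (cos (d%:R * x) * d%:R).
    exact: (@is_derive1_comp R sin (fun x => d%:R * x)).
  have d6 : is_derive x 1 (fun x => cos (d%:R * x)) (- sin (d%:R * x) * d%:R).
    exact: (@is_derive1_comp R cos (fun x => d%:R * x)).
  by rewrite /f; apply: is_derive_eq; rewrite /GRing.scale /=; ring.
move/andP: hx => [x0 xw].
have dx : d%:R * x < pi by rewrite (lt_trans _ wp)// ltr_pM2l.
have xd : x < d%:R * x by rewrite -[X in X < _]mul1r ltr_pM2r.
rewrite mulr_gt0//; last by rewrite mulr_gt0// sin_gt0_pi ?x0 ?(lt_trans xd)// mulr_gt0.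
by rewrite subr_gt0 expr_gt1 ?(ltW d0).
Qed.

(** With u = (a - p)/2 = d u' and v = (q - a)/2 = d v', three applications of [sin_GamB] give dGam a
    = (cot u + cot v) / (cot u' + cot v'), and d cot (d w) < cot w finishes. Surrounding the fixed
    point by a 2-cycle thus already makes it attracting. *)
Lemma fixed_attracting th p a q : p < a -> a < q -> q - p < 2 * pi ->
  Phi d th a = a -> Phi d th p = q -> Phi d th q = p -> d%:R * dGam b a < 1.
Proof.
move=> pa aq qp ea ep eq.
have d0 : (0 : R) < d%:R by rewrite ltr0n ltnW.
have dn0 : d%:R != 0 :> R by rewrite gt_eqF.
pose u := (a - p) / 2; pose v := (q - a) / 2.
pose u' := u / d%:R; pose v' := v / d%:R.
have Eu : u = d%:R * u' by rewrite /u'; field.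
have Ev : v = d%:R * v' by rewrite /v'; field.
have G1 : (Gam b q - Gam b a) / 2 = u'.
  apply: (mulfI dn0); rewrite -Eu /u.
  have -> : a - p = d%:R * (Gam b q - Gam b a) by rewrite -(PhiB d th) ea eq.
  by field.
have G2 : (Gam b a - Gam b p) / 2 = v'.
  apply: (mulfI dn0); rewrite -Ev /v.
  have -> : q - a = d%:R * (Gam b a - Gam b p) by rewrite -(PhiB d th) ea ep.
  by field.
have G3 : (Gam b q - Gam b p) / 2 = u' + v' by rewrite -G1 -G2; field.
have S1 := sin_GamB hb q a; have S2 := sin_GamB hb a p; have S3 := sin_GamB hb q p.
rewrite G1 -/v in S1; rewrite G2 -/u in S2; rewrite G3 in S3.
have E3 : (q - p) / 2 = u + v by rewrite /u /v; field.
rewrite E3 in S3.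
have u0 : 0 < u by rewrite /u; lra.
have v0 : 0 < v by rewrite /v; lra.
have uvp : u + v < pi by rewrite -E3; lra.
have u'0 : 0 < u' by rewrite divr_gt0.
have v'0 : 0 < v' by rewrite divr_gt0.
have su : 0 < sin u by rewrite sin_gt0_pi// u0; lra.
have sv : 0 < sin v by rewrite sin_gt0_pi// v0; lra.
have suv : 0 < sin (u + v) by rewrite sin_gt0_pi//; apply/andP; split; lra.
have u'u : u' <= u by rewrite Eu -[X in X <= _]mul1r ler_pM2r// ler1n ltnW.
have v'v : v' <= v by rewrite Ev -[X in X <= _]mul1r ler_pM2r// ler1n ltnW.
have su' : 0 < sin u' by rewrite sin_gt0_pi// u'0; lra.
have sv' : 0 < sin v' by rewrite sin_gt0_pi// v'0; lra.
have Na := Nsq_gt0 hb a; have Np := Nsq_gt0 hb p; have Nq := Nsq_gt0 hb q.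
have sa : Num.sqrt (Nsq b a) != 0 by rewrite sqrtr_eq0 -ltNge.
have sp : Num.sqrt (Nsq b p) != 0 by rewrite sqrtr_eq0 -ltNge.
have sq : Num.sqrt (Nsq b q) != 0 by rewrite sqrtr_eq0 -ltNge.
have key : dGam b a * (sin (u' + v') * (sin u * sin v)) = sin (u + v) * (sin u' * sin v').
  rewrite S1 S2 S3 /dGam -[in LHS](sqr_sqrtr (ltW Na)); field.
  by rewrite sa sp sq.
have h1 := @sin_ct_lt u' u'0; rewrite -Eu in h1; have {}h1 := h1 ltac:(lra).
have h2 := @sin_ct_lt v' v'0; rewrite -Ev in h2; have {}h2 := h2 ltac:(lra).
have pos : 0 < sin (u' + v') * (sin u * sin v).
  have -> : sin (u' + v') = dGam b a * 0 + sin (u' + v') by ring.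
  have : 0 < dGam b a * (sin (u' + v') * (sin u * sin v)) by rewrite key !mulr_gt0.
  by rewrite pmulr_rgt0 ?dGam_gt0// mulr0 add0r.
rewrite -(ltr_pM2r pos) mul1r -mulrA key !sinD.
have h3 : d%:R * sin u' * cos u * (sin v * sin v') < sin u * cos u' * (sin v * sin v').
  by rewrite ltr_pM2r// mulr_gt0.
have h4 : d%:R * sin v' * cos v * (sin u * sin u') < sin v * cos v' * (sin u * sin u').
  by rewrite ltr_pM2r// mulr_gt0.
lra.
Qed.

Lemma fixpoint_uniq th a x : Phi d th a = a -> Phi d th x = x -> x = a.
Proof.
move=> ea ex; have [xa|xa|//] := ltgtP x a.
  by have := xa; rewrite -(Phi_lt th _ _ d1) ea ex => /lt_trans/(_ xa); rewrite ltxx.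
by have := xa; rewrite -(Phi_lt th _ _ d1) ea ex => /lt_trans/(_ xa); rewrite ltxx.
Qed.

(* [a] is the attracting fixed point and the arc (p, q) its basin on the circle. *)
Definition dyn th p a q : Prop :=
  [/\ 0 <= p, p < a, a < q, q <= th & th < pi] /\
  [/\ Phi d th a = a, Phi d th p = q & Phi d th q = p] /\
  [/\ forall x, x < p -> Phi d th (Phi d th x) < x,
      forall x, p < x < a -> x < Phi d th (Phi d th x),
      forall x, a < x < q -> Phi d th (Phi d th x) < x &
      forall x, q < x -> x < Phi d th (Phi d th x)].

Lemma fixpoint_exists th : 0 < th -> exists2 a, 0 < a < th & Phi d th a = a.
Proof.
move=> th0; have d0 : (0 : R) < d%:R by rewrite ltr0n ltnW.
have g0 : 0 < Gam b th by rewrite Gam_gt0.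
have [|||a /andP[a0 a1] ea] := @IVTr R (fun x => x - Phi d th x) 0 th 0.
- exact: ltW.
- apply: (@is_derive_within R _ (fun x => 1 - - (d%:R * dGam b x))) => x.
  have dd := is_derive_Phi d th x.
  by apply: is_derive_eq.
- rewrite /Phi Gam0 mulr0 subr0 sub0r; apply/orP; left; apply/andP; split; first lra.
  have := mulr_gt0 d0 g0; lra.
exists a; last by apply/eqP; rewrite eq_sym -subr_eq0; apply/eqP.
apply/andP; split; rewrite lt_neqAle ?a0 ?a1 andbT; apply/eqP => E; move: ea.
  by rewrite -E /Phi Gam0; lra.
rewrite E /Phi; have := mulr_gt0 d0 g0; lra.
Qed.

(** As [Phi d th 0 = th], the condition [Phi d th th <= 0] says that the second iterate does not
    move 0 to the right, while points just to the left of the attracting [a] move right. So a point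
    [p] of period 2 lies in [0, a). Every zero of [psi] other than [a] is crossed upwards, which
    gives the four signs in [dyn]. *)
Lemma dyn_exists th a : 0 < th -> th < pi -> Phi d th th <= 0 -> 0 < a ->
  Phi d th a = a -> d%:R * dGam b a < 1 -> exists p q, dyn th p a q.
Proof.
move=> th0 thp Ft a0 ea att.
pose psi x := Phi d th (Phi d th x) - x.
pose psi' x := d%:R ^+ 2 * dGam b x * dGam b (Phi d th x) - 1.
have dpsi x : is_derive x 1 psi (psi' x).
  have h1 := is_derive_Phi d th x.
  have h2 : is_derive x 1 (fun x => Phi d th (Phi d th x)) (- (d%:R * dGam b (Phi d th x)) * - (d%:R * dGam b x)).
    have h3 := is_derive_Phi d th (Phi d th x).
    exact: (@is_derive1_comp R (Phi d th) (Phi d th)).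
  by rewrite /psi /psi'; apply: is_derive_eq; ring.
have zpsi x : x != a -> psi x = 0 -> 0 < psi' x.
  move=> xa /eqP; rewrite /psi subr_eq0 => /eqP e.
  rewrite /psi' subr_gt0; apply: (period2_expanding (th := th)) => //.
  by apply/eqP => e'; move/eqP: xa; apply; apply: (fixpoint_uniq (th := th)) => //; rewrite -e'.
have ltx u v : u < v -> Phi d th v < Phi d th u by rewrite Phi_lt// d1.
have [e e0 He] : exists2 e, 0 < e & forall y, a - e < y < a + e -> (y < a -> - psi y < 0) /\ (a < y -> 0 < - psi y).
  apply: (@zero_pos R (fun x => - psi x) (- psi' a)).
  - by rewrite /psi ea ea subrr oppr0.
  - rewrite /psi' ea oppr_gt0 subr_lt0.
    have -> : d%:R ^+ 2 * dGam b a * dGam b a = (d%:R * dGam b a) ^+ 2 by ring.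
    by rewrite expr_lt1// mulr_ge0 ?ler0n// ltW// dGam_gt0.
(* A point of (0, a) so close to [a] that [psi] is positive there. *)
pose y := Num.max (a / 2) (a - e / 2).
have [y1 y2] : y < a /\ a - e < y.
  by rewrite /y; split; rewrite ?gt_max ?lt_max; [apply/andP; split; lra|apply/orP; right; lra].
have y3 : 0 < y by rewrite /y lt_max; apply/orP; left; lra.
have py : 0 < psi y.
  by rewrite -oppr_lt0; apply: (He y _).1 => //; rewrite y2; lra.
have p0' : psi 0 <= 0 by rewrite /psi {2}/Phi Gam0 mulr0 !subr0.
have [||p /andP[p0 py'] ep] := @IVTr R psi 0 y 0 (ltW y3).
- exact: is_derive_within dpsi.
- by rewrite p0' (ltW py).
have pa : p < a by exact: le_lt_trans y1.
have eq : Phi d th (Phi d th p) = p by apply/eqP; rewrite -subr_eq0; apply/eqP.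
have aq : a < Phi d th p by rewrite -{1}ea ltx.
have zq : psi (Phi d th p) = 0 by rewrite /psi !eq subrr.
exists p, (Phi d th p); split; first split => //.
  by rewrite (le_trans (_ : _ <= Phi d th 0)) ?Phi_le ?d1// /Phi Gam0 mulr0 subr0.
split=> //; split => x.
- move=> xp; rewrite -subr_lt0; apply: (@neg_before_zero R psi psi' x p) => // z /andP[z1 z2] z0.
  by apply: zpsi => //; rewrite lt_eqF// (le_lt_trans z2).
- move=> /andP[x1 x2]; rewrite -subr_gt0; apply: (@pos_after_zero R psi psi' p x) => // z /andP[z1 z2] z0.
  by apply: zpsi => //; rewrite lt_eqF// (le_lt_trans z2).
- move=> /andP[x1 x2]; rewrite -subr_lt0; apply: (@neg_before_zero R psi psi' x (Phi d th p)) => // z /andP[z1 z2] z0.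
  by apply: zpsi => //; rewrite gt_eqF// (lt_le_trans x1).
- move=> xp; rewrite -subr_gt0; apply: (@pos_after_zero R psi psi' (Phi d th p) x) => // z /andP[z1 z2] z0.
  by apply: zpsi => //; rewrite gt_eqF// (lt_le_trans aq).
Qed.

(** The angle r + d Gam r is that of the parabolic parameter, see [lambda1_angle]. With g = Gam r
    one has d sin g = sin r. If r + d g >= pi, put m = min (d g) (pi/2): then sin m < d sin (m/d) <=
    d sin g = sin r, whereas pi - r <= d g gives sin r <= sin m. *)
Lemma tau_lt_pi r : 0 < r -> r < pi -> d%:R * dGam b r = 1 -> r + d%:R * Gam b r < pi.
Proof.
move=> r0 rp er.
have d0 : (0 : R) < d%:R by rewrite ltr0n ltnW.
have d2 : (2 : R) <= d%:R by rewrite ler_nat.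
have dn0 : d%:R != 0 :> R by rewrite gt_eqF.
have pi0 := pi_gt0 R.
set g := Gam b r.
have es : d%:R * sin g = sin r by rewrite /g sin_Gam mulrA er mul1r.
have g0 : 0 < g by rewrite Gam_gt0.
have gr : d%:R * g <= r.
  have [x /andP[x0 xr] e] := MVTd r0 (fun x _ => is_derive_Gam hb x).
  rewrite Gam0 !subr0 -/g in e; rewrite e mulrA -[leRHS]mul1r ler_pM2r// -[leRHS]er ler_pM2l//.
  by rewrite dGam_inc ?ltW.
rewrite ltNge; apply/negP => H.
pose m := Num.min (d%:R * g) (pi / 2).
have m0 : 0 < m by rewrite lt_min mulr_gt0//=; lra.
have mp : m <= pi / 2 by rewrite ge_min lexx orbT.
have md : 0 < m / d%:R by rewrite divr_gt0.
have mg : m / d%:R <= g by rewrite ler_pdivrMr// mulrC /m ge_min lexx.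
have gp : g <= pi / 2.
  have : 2 * g <= d%:R * g by rewrite ler_pM2r.
  lra.
have sinc x y : 0 <= x -> x <= y -> y <= pi / 2 -> sin x <= sin y.
  move=> hx; rewrite le_eqVlt => /orP[/eqP->//|xy] hy.
  by apply: ltW; rewrite ltr_sin// in_itv /=; apply/andP; split; lra.
have h1 : sin (m / d%:R) <= sin g by apply: sinc => //; exact: ltW.
have sm : 0 < sin (m / d%:R) by rewrite sin_gt0_pi// md; lra.
have := @sin_natM_lt R d (m / d%:R) hd; rewrite gt_eqF// => /(_ isT).
have -> : d%:R * (m / d%:R) = m by field.
have sm' : 0 < sin m by rewrite sin_gt0_pi// m0; lra.
rewrite !gtr0_norm// => h2.
have h3 : sin m < sin r.
  by rewrite -es (lt_le_trans h2)// ler_pM2l.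
have h4 : sin r <= sin m.
  have sr : sin r = sin (pi - r) by rewrite sinB sinpi cospi; ring.
  have [hr|hr] := leP (pi / 2) r.
    rewrite sr; apply: sinc => //; first lra.
    rewrite /m le_min; apply/andP; split; lra.
  have -> : m = pi / 2 by apply/eqP; rewrite eq_le mp /m le_min lexx andbT; lra.
  by rewrite sin_pihalf sin_le1.
by move: h3; rewrite ltNge h4.
Qed.

End Dynamics.

Lemma int_eq0 (j : int) : j < 1 -> -1 < j -> j = 0.
Proof. lia. Qed.

(** * Words and orbits avoiding the invariant arc *)

Section Orbits.
Variables (R : realType) (b : R) (d : nat).
Hypotheses (hb : 1 < b) (hd : (2 <= d)%N).
Implicit Types x y u v th p q a r : R.

Local Notation Phi := (Phi b).
Local Notation dyn := (dyn b d).
Local Notation F2 th := (fun x => Phi d th (Phi d th x)).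

Lemma F2_le th : {homo F2 th : u v / u <= v}.
Proof. by move=> u v uv; rewrite !(Phi_le hb) ?(d1 hd). Qed.

Lemma continuous_F2 th : continuous (F2 th).
Proof.
move=> x; apply: (@continuous_comp _ _ _ (Phi d th) (Phi d th)); exact: continuous_Phi.
Qed.

Lemma esc_down th p a q x M : dyn th p a q -> x < p -> exists n, iter n (F2 th) x < M.
Proof.
move=> [_ [_ [H _ _ _]]] xp.
apply: (@iter_lt R (F2 th) (M - 1)).
- exact: F2_le.
- exact: continuous_F2.
- by move=> y /andP[_ yx]; apply: H; exact: le_lt_trans xp.
- by rewrite ltrBlDr ltrDl.
Qed.

Lemma esc_up th p a q x M : dyn th p a q -> q < x -> exists n, M < iter n (F2 th) x.
Proof.
move=> [_ [_ [_ _ _ H]]] xp.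
apply: (@iter_gt R (F2 th) (M + 1)).
- exact: F2_le.
- exact: continuous_F2.
- by move=> y /andP[yx _]; apply: H; exact: lt_le_trans xp _.
- by rewrite ltrDl.
Qed.

Lemma dyn_fix2 th p a q : dyn th p a q ->
  [/\ F2 th p = p, F2 th q = q & F2 th a = a].
Proof. by move=> [_ [[ea ep eq] _]]; rewrite ep eq ep ea ea. Qed.

Lemma iter_fix (f : R -> R) x n : f x = x -> iter n f x = x.
Proof. by move=> fx; elim: n => //= n ->. Qed.

Lemma iter_le (f : R -> R) n : {homo f : u v / u <= v} -> {homo iter n f : u v / u <= v}.
Proof. by move=> mf; elim: n => //= n IH u v uv; apply: mf; exact: IH. Qed.

Lemma att th p a q x e : dyn th p a q -> p < x < q -> 0 < e ->
  exists n, forall m, (n <= m)%N -> a - e < iter m (F2 th) x < a + e.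
Proof.
move=> D /andP[px xq] e0; have [fp fq fa] := dyn_fix2 D.
case: D => [[p0 pa aq qt tp] [_ [_ H1 H2 _]]].
have up y : p < y <= a -> y <= F2 th y <= a.
  move=> /andP[y1]; rewrite le_eqVlt => /orP[/eqP->|y2]; first by rewrite fa lexx.
  by rewrite ltW ?H1 ?y1//= -[X in _ <= X]fa F2_le// ltW.
have dn y : a <= y < q -> a <= F2 th y <= y.
  move=> /andP[]; rewrite le_eqVlt => /orP[/eqP<-|y1 y2]; first by rewrite fa lexx.
  by rewrite [X in _ && X]ltW ?H2 ?y1// andbT -[X in X <= _]fa F2_le// ltW.
have [xa|ax] := leP x a.
  have [|n hn] := @iter_gt R (F2 th) a (a - e) x (@F2_le th) (@continuous_F2 th) _ ltac:(lra).
    by move=> y /andP[y1 y2]; apply: H1; rewrite (lt_le_trans px).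
  have inv m : p < iter m (F2 th) x <= a.
    elim: m => [|m IH]; first by rewrite px.
    have /andP[i1 i2] := up _ IH; rewrite iterS i2 andbT.
    by move/andP: IH => [h _]; exact: lt_le_trans i1.
  exists n => m nm; have /andP[_ h] := inv m; rewrite (le_lt_trans h) ?andbT; last lra.
  rewrite -(subnK nm); elim: (m - n)%N => // k IH.
  by rewrite addSn iterS (lt_le_trans IH)//; case/andP: (up _ (inv (k + n)%N)).
have [|n hn] := @iter_lt R (F2 th) a (a + e) x (@F2_le th) (@continuous_F2 th) _ ltac:(lra).
  by move=> y /andP[y1 y2]; apply: H2; rewrite y1 (le_lt_trans y2).
have inv m : a <= iter m (F2 th) x < q.
  elim: m => [|m IH]; first by rewrite (ltW ax).
  have /andP[i1 i2] := dn _ IH; rewrite iterS i1.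
  by move/andP: IH => [_]; exact: le_lt_trans i2.
exists n => m nm; have /andP[h _] := inv m; rewrite (lt_le_trans _ h) /=; last lra.
rewrite -(subnK nm); elim: (m - n)%N => // k IH.
by rewrite addSn iterS (le_lt_trans _ IH)//; case/andP: (dn _ (inv (k + n)%N)).
Qed.

(** Step 1 always lands at [th], because [Gam b 0 = 0]; this is the angle of the single vertex.
    Hence index n + 1 belongs to the tree T_n. *)
Fixpoint X (e : nat -> nat) th n : R :=
  if n is m.+1 then Phi (e m) th (X e th m) else 0.

Definition letters (e : nat -> nat) := forall i, (1 <= e i <= d)%N.

Lemma continuous_PhiX (k : nat) (g : R -> R) : continuous g ->
  continuous (fun th => Phi k th (g th)).
Proof.
move=> cg th; apply: cvgB; first exact: cvg_id.
apply: cvgM; first exact: cvg_cst.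
apply: (@continuous_comp _ _ _ g (Gam b)); first exact: cg.
exact: continuous_Gam.
Qed.

Lemma continuous_X e n : continuous (fun th => X e th n).
Proof.
elim: n => [|n IH] /=; first by move=> th; exact: cvg_cst.
exact: continuous_PhiX.
Qed.

Lemma eq_X e e' th n : (forall i, (i < n)%N -> e i = e' i) -> X e th n = X e' th n.
Proof.
elim: n => //= n IH H; rewrite H// IH// => i hi; apply: H; exact: ltnW.
Qed.

(** Continuing a word by letters [d] keeps it admissible, so the iterates of f_d o f_d on an orbit
    point are again orbit points, to which the absence of zeros applies. *)
Definition pad (e : nat -> nat) n i := if (i < n)%N then e i else d.

Lemma X_pad e th n N : X (pad e n) th (n + N.*2) = iter N (F2 th) (X e th n).
Proof.
elim: N => [|N IH].
  by rewrite addn0; apply: eq_X => i hi; rewrite /pad hi.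
rewrite doubleS !addnS /= IH /pad.
by rewrite ltnNge leqW ?leq_addr// ltnNge leq_addr.
Qed.

Lemma pad_letters e n : letters e -> letters (pad e n).
Proof. by move=> he i; rewrite /pad; case: ifP => // _; rewrite leqnn (d1 hd). Qed.

Lemma iter_F2z th x (z : int) N : exists z' : int,
  iter N (F2 th) (x + 2 * pi * z%:~R) = iter N (F2 th) x + 2 * pi * z'%:~R.
Proof.
elim: N => [|N [z' IH]]; first by exists z.
by exists (- (- z' * d) * d); rewrite !iterS IH !Phiz.
Qed.

Section ZeroFree.
Variables c1 c2 : R.
Hypothesis zf : forall e, letters e -> forall n th, c1 < th < c2 ->
  forall z : int, X e th n != pi + 2 * pi * z%:~R.

(** The iterate is, modulo 2 pi, the angle of a padded word and depends continuously on the
    parameter; passing from one side of pi to the other would produce a zero. *)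
Lemma no_cross e n (i : int) N th1 th2 : letters e -> c1 < th1 < c2 -> c1 < th2 < c2 ->
  iter N (F2 th1) (X e th1 n - 2 * pi * i%:~R) < pi ->
  pi < iter N (F2 th2) (X e th2 n - 2 * pi * i%:~R) -> False.
Proof.
move=> he h1 h2 l1 l2.
pose G th := iter N (F2 th) (X e th n - 2 * pi * i%:~R).
have cG : continuous G.
  rewrite /G; elim: (N) => [|k IH] /=.
    by move=> th; apply: cvgB; [exact: continuous_X|exact: cvg_cst].
  by apply: continuous_PhiX; apply: continuous_PhiX.
have [th hth Gth] : exists2 th, c1 < th < c2 & G th = pi.
  have [h12|h12] := leP th1 th2.
    have [||th /andP[t1 t2] e1] := @IVTr R G th1 th2 pi h12.
    - exact: continuous_subspaceT.
    - by rewrite /G (ltW l1) (ltW l2).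
    exists th => //; move/andP: h1 => [h11 _]; move/andP: h2 => [_ h22].
    by rewrite (lt_le_trans h11)//= (le_lt_trans t2).
  have [||th /andP[t1 t2] e1] := @IVTr R G th2 th1 pi (ltW h12).
  - exact: continuous_subspaceT.
  - by rewrite /G (ltW l1) (ltW l2) orbT.
  exists th => //; move/andP: h2 => [h11 _]; move/andP: h1 => [_ h22].
  by rewrite (lt_le_trans h11)//= (le_lt_trans t2).
have [z' ez] := iter_F2z th (X e th n) (- i) N.
have : iter N (F2 th) (X e th n) = pi + 2 * pi * (- z')%:~R.
  by move: Gth; rewrite /G (_ : X e th n - _ = X e th n + 2 * pi * (- i)%:~R) ?ez; rewrite mulrNz; lra.
rewrite -X_pad => /eqP; apply/negP; apply: zf => //; exact: pad_letters.
Qed.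

Lemma no_cross_down e n (i : int) N th1 th2 : letters e -> c1 < th1 < c2 -> c1 < th2 < c2 ->
  iter N (F2 th1) (X e th1 n - 2 * pi * i%:~R) < - pi ->
  - pi < iter N (F2 th2) (X e th2 n - 2 * pi * i%:~R) -> False.
Proof.
move=> he h1 h2 l1 l2.
pose G th := iter N (F2 th) (X e th n - 2 * pi * i%:~R).
have cG : continuous G.
  rewrite /G; elim: (N) => [|k IH] /=.
    by move=> th; apply: cvgB; [exact: continuous_X|exact: cvg_cst].
  by apply: continuous_PhiX; apply: continuous_PhiX.
have [th hth Gth] : exists2 th, c1 < th < c2 & G th = - pi.
  have [h12|h12] := leP th1 th2.
    have [||th /andP[t1 t2] e1] := @IVTr R G th1 th2 (- pi) h12.
    - exact: continuous_subspaceT.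
    - by rewrite /G (ltW l1) (ltW l2).
    exists th => //; move/andP: h1 => [h11 _]; move/andP: h2 => [_ h22].
    by rewrite (lt_le_trans h11)//= (le_lt_trans t2).
  have [||th /andP[t1 t2] e1] := @IVTr R G th2 th1 (- pi) (ltW h12).
  - exact: continuous_subspaceT.
  - by rewrite /G (ltW l1) (ltW l2) orbT.
  exists th => //; move/andP: h2 => [h11 _]; move/andP: h1 => [_ h22].
  by rewrite (lt_le_trans h11)//= (le_lt_trans t2).
have [z' ez] := iter_F2z th (X e th n) (- i) N.
have : iter N (F2 th) (X e th n) = pi + 2 * pi * (- z' - 1)%:~R.
  by move: Gth; rewrite /G (_ : X e th n - _ = X e th n + 2 * pi * (- i)%:~R) ?ez; rewrite ?intrD ?mulrNz; lra.
rewrite -X_pad => /eqP; apply/negP; apply: zf => //; exact: pad_letters.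
Qed.

(** At [th1] the iterates of f_d o f_d drift from below [p1] past -pi; at [th2] they would stay
    above the fixed point [p2 >= 0]. The same number of iterates would then lie on both sides of
    -pi. *)
Lemma no_cross_p e n (i : int) th1 th2 p1 a1 q1 p2 a2 q2 : letters e ->
  c1 < th1 < c2 -> c1 < th2 < c2 -> dyn th1 p1 a1 q1 -> dyn th2 p2 a2 q2 ->
  X e th1 n < p1 + 2 * pi * i%:~R -> X e th2 n < p2 + 2 * pi * i%:~R.
Proof.
move=> he h1 h2 D1 D2 l1; rewrite ltNge; apply/negP => l2.
have [N hN] : exists N, iter N (F2 th1) (X e th1 n - 2 * pi * i%:~R) < - pi.
  by apply: esc_down D1 _; lra.
apply: (no_cross_down he h1 h2 hN).
have [f2 _ _] := dyn_fix2 D2.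
apply: lt_le_trans (_ : p2 <= _).
  case: D2 => [[p0 _ _ _ _] _]; have := pi_gt0 R; lra.
rewrite -{1}(iter_fix (f := F2 th2) N f2); apply: iter_le; [exact: F2_le|lra].
Qed.

Lemma no_cross_q e n (i : int) th1 th2 p1 a1 q1 p2 a2 q2 : letters e ->
  c1 < th1 < c2 -> c1 < th2 < c2 -> dyn th1 p1 a1 q1 -> dyn th2 p2 a2 q2 ->
  q1 + 2 * pi * i%:~R < X e th1 n -> q2 + 2 * pi * i%:~R < X e th2 n.
Proof.
move=> he h1 h2 D1 D2 l1; rewrite ltNge; apply/negP => l2.
have [N hN] : exists N, pi < iter N (F2 th1) (X e th1 n - 2 * pi * i%:~R).
  by apply: esc_up D1 _; lra.
apply: (no_cross he h2 h1 _ hN).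
have [_ f2 _] := dyn_fix2 D2.
apply: le_lt_trans (_ : _ <= q2) _.
  rewrite -[leRHS](iter_fix (f := F2 th2) N f2); apply: iter_le; [exact: F2_le|lra].
case: D2 => [[_ _ _ h h'] _]; lra.
Qed.

End ZeroFree.

Definition outside p q x := forall z : int, ~~ (p + 2 * pi * z%:~R <= x <= q + 2 * pi * z%:~R).

Lemma outside_gap p q x : p <= q -> outside p q x ->
  exists m : int, q + 2 * pi * m%:~R < x < p + 2 * pi * (m + 1)%:~R.
Proof.
move=> pq ox; have pi0 : 0 < 2 * pi :> R by rewrite mulr_gt0// pi_gt0.
pose m := Num.floor ((x - p) / (2 * pi)).
have h1 : p + 2 * pi * m%:~R <= x.
  by rewrite addrC -lerBrDr mulrC -ler_pdivlMr// floor_le_tmp.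
have h2 : x < p + 2 * pi * (m + 1)%:~R.
  by rewrite addrC -ltrBlDr mulrC -ltr_pdivrMr// floorD1_gt.
exists m; rewrite h2 andbT ltNge; apply/negP => h3.
by have := ox m; rewrite h1 h3.
Qed.

(* If all of [f_d(x)] and [f_1 f_k(x)] were in the arc [p, q], the points
   [th - k s] with [s = Gam x] would all lie in (0, pi) mod 2 pi, hence (as
   |s| <= pi) truly in (0, pi), and then [x] itself would be in [p, q]. *)
Lemma coverage th p a q x : dyn th p a q -> 0 < p -> outside p q x ->
  outside p q (Phi d th x) \/
  exists2 k, (1 <= k < d)%N & outside p q (Phi 1 th (Phi k th x)).
Proof.
move=> D p0 ox; apply: contrapT => H.
have pi0 := pi_gt0 R.
have pi2 : 0 < 2 * pi :> R by lra.
case: (D) => [[_ pa aq qt tp] [[ea ep eq] _]].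
have nout y : ~ outside p q y -> exists z : int, p <= y + 2 * pi * z%:~R <= q.
  move=> /existsNP[z /negP]; rewrite negbK => /andP[y1 y2]; exists (- z).
  rewrite mulrNz; apply/andP; split; lra.
have Hd : exists z : int, p <= Phi d th x + 2 * pi * z%:~R <= q.
  by apply: nout => h; apply: H; left.
have gqt : Gam b q = (th - p) / d%:R by rewrite -eq /Phi; field; rewrite pnatr_eq0 -lt0n (d1 hd).
have gpt : Gam b p = (th - q) / d%:R by rewrite -ep /Phi; field; rewrite pnatr_eq0 -lt0n (d1 hd).
have gp0 : 0 < Gam b p by rewrite Gam_gt0.
have d0 : (0 : R) < d%:R by rewrite ltr0n (d1 hd).
have qt' : q < th by move: gp0; rewrite gpt pmulr_lgt0 ?invr_gt0// subr_gt0.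
(* If f_1(w) lies in the arc, then Gam w lies in [th - q, th - p] modulo 2 pi. This interval is
   contained in (0, pi), and [Gam] preserves (0, pi). *)
have Hk k : (1 <= k < d)%N -> exists z : int, 0 < Phi k th x + 2 * pi * z%:~R < pi.
  move=> hk; have [z /andP[z1 z2]] : exists z : int, p <= Phi 1 th (Phi k th x) + 2 * pi * z%:~R <= q.
    by apply: nout => h; apply: H; right; exists k.
  exists (- z); rewrite -(Gam_gt0 hb) -(Gam_ltpi hb) Gamz mulrNz.
  move: z1 z2; rewrite {1 3}/Phi mul1r => z1 z2; apply/andP; split; lra.
have [z hs] : exists z : int, - pi < Gam b x + 2 * pi * z%:~R <= pi.
  exists (- (Num.ceil ((Gam b x - pi) / (2 * pi)))).
  set c := Num.ceil _.
  have h1 : (Gam b x - pi) / (2 * pi) <= c%:~R by exact: ceil_ge.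
  have h2 : c%:~R - 1 < (Gam b x - pi) / (2 * pi) by have := ceilB1_lt ((Gam b x - pi) / (2 * pi)); rewrite -/c intrB.
  rewrite ler_pdivrMr// in h1; rewrite ltr_pdivlMr// in h2.
  rewrite mulrNz; apply/andP; split; lra.
set s := Gam b x + _ in hs.
have es k : Phi k th x = th - k%:R * s + 2 * pi * (z * k)%:~R.
  by rewrite /Phi /s intrM /=; ring.
(* Consecutive points th - k s differ by at most pi, so two of them that lie in (0, pi) modulo 2 pi
   lie in the same lift of that interval. *)
have ind k : (k < d)%N -> 0 < th - k%:R * s < pi.
  elim: k => [_|k IH kd]; first by rewrite mul0r subr0 tp andbT; lra.
  have /andP[i1 i2] := IH (ltnW kd).
  have [z' ] := Hk k.+1 kd; rewrite es -addrA -mulrDr -intrD.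
  set j := (X in X%:~R) => /andP[j1 j2].
  suff j0 : j = 0 by move: j1 j2; rewrite j0 mulr0z mulr0 addr0 => -> ->.
  move: hs => /andP[s1 s2].
  have e1 : th - k.+1%:R * s = th - k%:R * s - s by rewrite -natr1; ring.
  rewrite e1 in j1 j2.
  have l1 : 2 * pi * j%:~R < 2 * pi * 1 :> R by lra.
  have l2 : 2 * pi * (-1) < 2 * pi * j%:~R :> R by lra.
  rewrite ltr_pM2l// -[1]/(1%:~R) ltr_int in l1.
  rewrite ltr_pM2l// -[-1]/((-1)%:~R) ltr_int in l2.
  exact: int_eq0.
have dd : (d.-1 < d)%N by rewrite ltn_predL (d1 hd).
have /andP[i1 i2] := ind d.-1 dd.
have ed : d%:R = d.-1%:R + 1 :> R by rewrite natr1 prednK// (d1 hd).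
have [z' ] := Hd; rewrite es -addrA -mulrDr -intrD.
set j := (X in X%:~R) => /andP[j1 j2].
have e1 : th - d%:R * s = th - d.-1%:R * s - s by rewrite ed; ring.
have j0 : j = 0.
  move: hs => /andP[s1 s2].
  rewrite e1 in j1 j2.
  have l1 : 2 * pi * j%:~R < 2 * pi * 1 :> R by lra.
  have l2 : 2 * pi * (-1) < 2 * pi * j%:~R :> R by lra.
  rewrite ltr_pM2l// -[1]/(1%:~R) ltr_int in l1.
  rewrite ltr_pM2l// -[-1]/((-1)%:~R) ltr_int in l2.
  exact: int_eq0.
rewrite j0 mulr0z mulr0 addr0 in j1 j2.
have := ox (- z); apply/negP; rewrite negbK.
have S1 : Gam b p <= s by rewrite gpt ler_pdivrMr//; lra.
have S2 : s <= Gam b q by rewrite gqt ler_pdivlMr//; lra.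
have sx : s = Gam b (x + 2 * pi * z%:~R) by rewrite Gamz.
rewrite sx Gam_le// in S1; rewrite sx Gam_le// in S2.
rewrite mulrNz; apply/andP; split; lra.
Qed.

(* The word e is a concatenation of blocks d and (k, 1) with k < d; [s n] is true
   when n lies strictly inside a block. *)
Definition transitions (e : nat -> nat) (s : nat -> bool) :=
  forall n, if s n then e n = 1%N /\ s n.+1 = false
            else (e n = d /\ s n.+1 = false) \/ ((e n < d)%N /\ s n.+1 = true).

Lemma word_exists th p a q : dyn th p a q -> 0 < p ->
  exists e s, [/\ letters e, transitions e s, s 0%N = false &
    forall n, s n = false -> outside p q (X e th n)].
Proof.
move=> D p0.
have [f hf] : exists f : R -> nat, forall x, outside p q x ->
    (f x = d /\ outside p q (Phi d th x)) \/
    ((1 <= f x < d)%N /\ outside p q (Phi 1 th (Phi (f x) th x))).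
  suff /boolp.choice[f hf] : forall x, exists k : nat, outside p q x ->
      (k = d /\ outside p q (Phi d th x)) \/
      ((1 <= k < d)%N /\ outside p q (Phi 1 th (Phi k th x))) by exists f.
  move=> x.
  have [ox|ox] := pselect (outside p q x); last by exists 0%N.
  have [h|[k hk h]] := coverage D p0 ox; first by exists d => _; left.
  by exists k => _; right.
(* The word is produced by an automaton whose state is the current angle and a flag. The flag is
   raised inside a block (k, 1), where the next letter must be 1. *)
pose kap (st : R * bool) := if st.2 then 1%N else f st.1.
pose nxt (st : R * bool) := (Phi (kap st) th st.1, ~~ st.2 && (f st.1 != d)).
pose st n := iter n nxt (0, false).
pose e n := kap (st n); pose s n := (st n).2.
have eX n : (st n).1 = X e th n by elim: n => //= n ->.
have sS m : s m.+1 = ~~ s m && (f (X e th m) != d) by rewrite -eX.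
have inv n : if s n then (1 <= e n)%N && (e n <= d)%N && ~~ s n.+1 /\ outside p q (Phi 1 th (X e th n))
   else outside p q (X e th n).
  (* The starting point 0 is outside of the arc because 0 < p and q < pi. *)
  elim: n => [|n IH].
    rewrite /s /= => z; apply/negP => /andP[z1 z2].
    have pi0 := pi_gt0 R.
    case: D => [[_ pa aq qt tp] _].
    have l1 : 2 * pi * z%:~R < 2 * pi * 0 :> R by lra.
    have l2 : 2 * pi * (-1) < 2 * pi * z%:~R :> R by lra.
    rewrite ltr_pM2l ?mulr_gt0// -[0]/(0%:~R) ltr_int in l1.
    rewrite ltr_pM2l ?mulr_gt0// -[-1]/((-1)%:~R) ltr_int in l2.
    by move: l1 l2; clear; lia.
  case sn : (s n) IH => IH.
    have -> : s n.+1 = false by rewrite sS sn.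
    have en : e n = 1%N by rewrite /e /kap -/(s n) sn.
    by rewrite /= en; case: IH.
  have en : e n = f (X e th n) by rewrite /e /kap -/(s n) sn eX.
  have sn1 : s n.+1 = (e n != d) by rewrite sS sn en.
  have [[fd o]|[fk o]] := hf _ IH; rewrite sn1 en.
    by rewrite fd eqxx /= en fd.
  rewrite neq_ltn (andP fk).2 /=.
  have e1 : e n.+1 = 1%N by rewrite /e /kap -/(s n.+1) sn1 en neq_ltn (andP fk).2.
  have s2 : s n.+2 = false by rewrite sS sn1 en neq_ltn (andP fk).2.
  by rewrite e1 s2 (d1 hd) en.
have en n : if s n then e n = 1%N else e n = f (X e th n).
  by rewrite /e /kap -/(s n) eX; case: (s n).
exists e, s; split => //.
- move=> i; have := inv i; have := en i; case: (s i) => [-> _|-> o]; first by rewrite (d1 hd).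
  have [[-> _]|[/andP[h1 h2] _]] := hf _ o; first by rewrite leqnn (d1 hd).
  by rewrite h1 ltnW.
- move=> n; have := inv n; have := en n; rewrite (sS n); case: (s n).
    by move=> -> _; split.
  move=> E o.
  rewrite E /=; have [[-> _]|[/andP[h1 h2] _]] := hf _ o; first by left; rewrite eqxx.
  by right; rewrite neq_ltn h2.
- by move=> n sn; have := inv n; rewrite sn.
Qed.

End Orbits.

(** * Expansion outside of a trapping arc *)

Section Expansion.
Variables (R : realType) (b : R) (d : nat).
Hypotheses (hb : 1 < b) (hd : (2 <= d)%N).
Implicit Types x y u v th p q a r A B : R.
Local Notation Phi := (Phi b).

Definition gap A B (m : int) x := B + 2 * pi * m%:~R < x < A + 2 * pi * (m + 1)%:~R.

Lemma sin_min l r u : 0 < l -> l <= u -> u <= r -> r < pi -> Num.min (sin l) (sin r) <= sin u.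
Proof.
move=> l0 lu ur rp; have pi0 := pi_gt0 R.
have sinc x y : 0 <= x -> x <= y -> y <= pi / 2 -> sin x <= sin y.
  move=> hx; rewrite le_eqVlt => /orP[/eqP->//|xy] hy.
  by apply: ltW; rewrite ltr_sin// in_itv /=; apply/andP; split; lra.
have spi x : sin x = sin (pi - x) by rewrite sinB sinpi cospi; ring.
rewrite ge_min; apply/orP.
have [h|h] := leP u (pi / 2); first by left; apply: sinc => //; exact: ltW.
by right; rewrite (spi r) (spi u); apply: sinc; lra.
Qed.

Lemma K_gt0 A B x : A < B -> B < A + 2 * pi -> B < x < A + 2 * pi -> 0 < K A B x.
Proof.
move=> AB BA /andP[x1 x2]; rewrite divr_gt0//.
  by rewrite sin_gt0_pi//; apply/andP; split; lra.
by rewrite mulr_gt0// sin_gt0_pi//; apply/andP; split; lra.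
Qed.

Lemma K_ge A B x : A < B -> B < A + 2 * pi -> B < x < A + 2 * pi -> sin ((B - A) / 2) <= K A B x.
Proof.
move=> AB BA /andP[x1 x2]; rewrite /K.
have s0 : 0 < sin ((B - A) / 2) by rewrite sin_gt0_pi//; apply/andP; split; lra.
have s1 : 0 < sin ((x - A) / 2) by rewrite sin_gt0_pi//; apply/andP; split; lra.
have s2 : 0 < sin ((x - B) / 2) by rewrite sin_gt0_pi//; apply/andP; split; lra.
by rewrite ler_pdivlMr ?mulr_gt0// -[leRHS]mulr1 ler_pM2l.
Qed.

Lemma K_le A B x1 x2 : A < B -> B < x1 -> x1 <= x2 -> x2 < A + 2 * pi ->
  exists2 C, 0 < C & forall x, x1 <= x <= x2 -> K A B x <= C.
Proof.
move=> AB Bx x12 xA.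
pose sA := Num.min (sin ((x1 - A) / 2)) (sin ((x2 - A) / 2)).
pose sB := Num.min (sin ((x1 - B) / 2)) (sin ((x2 - B) / 2)).
have sA0 : 0 < sA by rewrite /sA lt_min !sin_gt0_pi//; apply/andP; split; lra.
have sB0 : 0 < sB by rewrite /sB lt_min !sin_gt0_pi//; apply/andP; split; lra.
exists (sA * sB)^-1; first by rewrite invr_gt0 mulr_gt0.
move=> x /andP[h1 h2]; rewrite /K.
have s1 : sA <= sin ((x - A) / 2) by apply: sin_min; lra.
have s2 : sB <= sin ((x - B) / 2) by apply: sin_min; lra.
have s10 := lt_le_trans sA0 s1; have s20 := lt_le_trans sB0 s2.
rewrite ler_pdivrMr ?mulr_gt0//.
rewrite (le_trans (sin_le1 _))// mulrC ler_pdivlMr ?mulr_gt0// mul1r ler_pM// ltW//.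
Qed.

(** By [K_ct] the density is a difference of cotangents, hence additive over adjacent arcs. The
    piece from [B1] to [B] contributes at least e = sin ((B - B1)/2), and the density of [A1, B1] is
    at most C off [A, B]; so c = e / C works for all arcs inside [A1, B1] at once. *)
Lemma K_sub A A1 B1 B : A < A1 -> A1 <= B1 -> B1 < B -> B < A + 2 * pi ->
  exists2 c, 0 < c & forall A' B' x, A1 <= A' -> A' <= B' -> B' <= B1 -> B < x < A + 2 * pi ->
    (1 + c) * K A' B' x <= K A B x.
Proof.
move=> AA AB BB BA.
have [C C0 HC] : exists2 C, 0 < C & forall x, B <= x <= A + 2 * pi -> K A1 B1 x <= C.
  move: AB; rewrite le_eqVlt => /orP[/eqP AB|AB]; last by apply: K_le; lra.
  (* A one-point arc has density 0. *)
  exists 1 => // x _; rewrite /K AB subrr mul0r sin0 mul0r ler01 //.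
pose e := sin ((B - B1) / 2).
have e0 : 0 < e by rewrite /e sin_gt0_pi//; apply/andP; split; lra.
exists (e / C); first exact: divr_gt0.
move=> A' B' x h1 h2 h3 /andP[x1 x2].
have sne y : A <= y <= B -> 0 < sin ((x - y) / 2).
  by move=> /andP[y1 y2]; rewrite sin_gt0_pi//; apply/andP; split; lra.
have ne y : A <= y <= B -> sin ((x - y) / 2) != 0.
  by move=> hy; rewrite gt_eqF// sne.
have ctm y z : A <= y -> y <= z -> z <= B -> sin ((z - y) / 2) <= ct ((x - z) / 2) - ct ((x - y) / 2)
    /\ 0 <= ct ((x - z) / 2) - ct ((x - y) / 2).
  move=> Ay yz zB.
  have s1 : 0 < sin ((x - y) / 2) by apply: sne; lra.
  have s2 : 0 < sin ((x - z) / 2) by apply: sne; lra.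
  have s3 : 0 <= sin ((z - y) / 2) by rewrite sin_ge0_pi//; apply/andP; split; lra.
  rewrite ctB ?gt_eqF//.
  have -> : (x - y) / 2 - (x - z) / 2 = (z - y) / 2 by field.
  split; last by rewrite divr_ge0// mulr_ge0// ltW.
  by rewrite ler_pdivlMr ?mulr_gt0// -[leRHS]mulr1 ler_wpM2l// mulr_ile1 ?sin_le1 ?ltW.
rewrite !K_ct ?ne//; try (apply/andP; split; lra).
have k1 : K A1 B1 x <= C by apply: HC; lra.
rewrite K_ct ?ne// in k1; try (apply/andP; split; lra).
have [_ c1] := ctm A1 A' ltac:(lra) ltac:(lra) ltac:(lra).
have [_ c2] := ctm B' B1 ltac:(lra) ltac:(lra) ltac:(lra).
have [c3 _] := ctm B1 B ltac:(lra) ltac:(lra) ltac:(lra).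
have [_ c4] := ctm A A1 ltac:(lra) ltac:(lra) ltac:(lra).
rewrite -/e in c3.
set t := ct ((x - B') / 2) - ct ((x - A') / 2).
have tC : t <= C by rewrite /t; lra.
have h : e / C * t <= e by rewrite mulrAC ler_pdivrMr// ler_pM2l.
rewrite mulrDl mul1r; rewrite /t in h *; lra.
Qed.

(** The Moebius factor of f_k preserves the density and the k-th power increases it by [ct_natM].
    The image arc runs from [Phi k th B] to [Phi k th A] since the lift reverses orientation, and
    the condition on [z] places the image of [x] off that arc. *)
Lemma expK0 (k : nat) th A B x (z : int) : (1 <= k)%N -> A < B -> B < x < A + 2 * pi ->
  Phi k th A + 2 * pi * z%:~R < Phi k th x < Phi k th B + 2 * pi * (z + 1)%:~R ->
  K A B x <= k%:R * dGam b x * K (Phi k th B) (Phi k th A) (Phi k th x).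
Proof.
move=> k1 AB /andP[x1 x2] /andP[z1 z2].
have k0 : (0 : R) < k%:R by rewrite ltr0n.
pose u := (Gam b x - Gam b A) / 2; pose v := (Gam b x - Gam b B) / 2.
have gAB : Gam b A < Gam b B by apply: ltr_Gam.
have v0 : 0 < v by rewrite /v; have := ltr_Gam hb x1; lra.
have vu : v <= u by rewrite /u /v; lra.
have up : u < pi.
  have := ltr_Gam hb x2; rewrite -[2 * pi]mulr1 -[1]/(1%:~R) Gamz /u => h.
  by move: h; rewrite -[1%:~R]/1 mulr1; lra.
have eA : (Phi k th x - Phi k th A) / 2 = - (k%:R * u) by rewrite PhiB /u; field.
have eB : (Phi k th x - Phi k th B) / 2 = - (k%:R * v) by rewrite PhiB /v; field.
have kv : (- (z + 1))%:~R * pi < k%:R * v by rewrite mulrNz; lra.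
have ku : k%:R * u < ((- (z + 1))%:~R + 1) * pi by rewrite mulrNz intrD; lra.
have := ct_natM k1 v0 vu up kv ku.
have su : 0 < sin u by rewrite sin_gt0_pi// up andbT; lra.
have sv : 0 < sin v by rewrite sin_gt0_pi// v0; lra.
have ku' : k%:R * v <= k%:R * u by rewrite ler_pM2l.
have sku : sin (k%:R * u) != 0 by apply: (sin_neq0 _ ku); exact: lt_le_trans ku'.
have skv : sin (k%:R * v) != 0 by apply: (sin_neq0 kv); exact: le_lt_trans ku.
rewrite ctB ?gt_eqF// ctB// => h.
have -> : K (Phi k th B) (Phi k th A) (Phi k th x) =
    sin (k%:R * u - k%:R * v) / (sin (k%:R * u) * sin (k%:R * v)).
  rewrite /K eA eB !sinN mulrNN [sin (k%:R * v) * _]mulrC; congr (sin _ / _).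
  by rewrite PhiB /u /v; field.
have -> : K A B x = dGam b x * (sin (u - v) / (sin u * sin v)).
  have -> : u - v = (Gam b B - Gam b A) / 2 by rewrite /u /v; field.
  rewrite /K /u /v !sin_GamB// /dGam.
  have Nx := Nsq_gt0 hb x; have NA := Nsq_gt0 hb A; have NB := Nsq_gt0 hb B.
  have nx : Num.sqrt (Nsq b x) != 0 by rewrite sqrtr_eq0 -ltNge.
  have nA : Num.sqrt (Nsq b A) != 0 by rewrite sqrtr_eq0 -ltNge.
  have nB : Num.sqrt (Nsq b B) != 0 by rewrite sqrtr_eq0 -ltNge.
  have b2 : b ^+ 2 - 1 != 0 by rewrite gt_eqF// b2_gt1.
  have s1 : sin ((x - A) / 2) != 0.
    move: su; rewrite /u sin_GamB// => h0; apply/eqP => e0.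
    by move: h0; rewrite e0 mulr0 ltxx.
  have s2 : sin ((x - B) / 2) != 0.
    move: sv; rewrite /v sin_GamB// => h0; apply/eqP => e0.
    by move: h0; rewrite e0 mulr0 ltxx.
  have eN : Num.sqrt (Nsq b x) ^+ 2 = Nsq b x by rewrite sqr_sqrtr ?ltW.
  move: eN nx; set r := Num.sqrt (Nsq b x) => <- nx; field.
  by rewrite nx nA nB b2 s1 s2.
have E w : k%:R * dGam b x * w = dGam b x * (k%:R * w) by ring.
by rewrite E ler_pM2l ?dGam_gt0.
Qed.

Lemma expK (k : nat) th A B x (m z : int) : (1 <= k)%N -> A < B -> gap A B m x ->
  Phi k th A + 2 * pi * z%:~R < Phi k th x < Phi k th B + 2 * pi * (z + 1)%:~R ->
  K A B x <= k%:R * dGam b x * K (Phi k th B) (Phi k th A) (Phi k th x).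
Proof.
move=> k1 AB /andP[x1 x2] /andP[z1 z2].
have e : x = x + 2 * pi * (- m)%:~R + 2 * pi * m%:~R by rewrite mulrNz; ring.
have eP : Phi k th (x + 2 * pi * (- m)%:~R) = Phi k th x + 2 * pi * (m * k)%:~R.
  by rewrite Phiz opprK.
have := @expK0 k th A B (x + 2 * pi * (- m)%:~R) (z + m * k) k1 AB.
rewrite Kz dGamz eP Kz; apply.
  by rewrite mulrNz; rewrite intrD in x2; apply/andP; split; lra.
by rewrite !intrD in z2 *; apply/andP; split; lra.
Qed.

(** [A, B] is mapped into the smaller arc [A1, B1] by f_d and by every f_1 o f_k. [Phi d] is
    decreasing and [Phi 1 o Phi k] increasing, whence the exchanged roles of [A] and [B] in the
    first two inequalities. *)
Definition trap th A B A1 B1 : Prop :=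
  [/\ A < A1, A1 <= B1, B1 < B & B < A + 2 * pi] /\
  [/\ A1 <= Phi d th B, Phi d th A <= B1 &
      forall k, (1 <= k < d)%N -> A1 <= Phi 1 th (Phi k th A) /\ Phi 1 th (Phi k th B) <= B1].

Lemma gapz A B (m : int) x : gap A B m x -> B < x + 2 * pi * (- m)%:~R < A + 2 * pi.
Proof. by rewrite /gap intrD mulrNz => /andP[? ?]; apply/andP; split; lra. Qed.

(** [expK] compares the density of [A, B] with that of the image arc; the image arc lies in
    [A1, B1], so [K_sub] returns to the density of [A, B] and yields the factor 1 + c. *)
Lemma expand_d th A B A1 B1 c : trap th A B A1 B1 ->
  (forall A' B' x, A1 <= A' -> A' <= B' -> B' <= B1 -> B < x < A + 2 * pi ->
    (1 + c) * K A' B' x <= K A B x) -> 0 < c ->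
  forall x (m z : int), gap A B m x -> gap A B z (Phi d th x) ->
  (1 + c) * K A B x <= d%:R * dGam b x * K A B (Phi d th x).
Proof.
move=> [[h1 h2 h3 h4] [h5 h6 h7]] Hc c0 x m z gx gy.
have AB : A < B by lra.
have dd := d1 hd.
have H1 : K A B x <= d%:R * dGam b x * K (Phi d th B) (Phi d th A) (Phi d th x).
  apply: (expK (m := m) (z := z)) => //.
  by move: gy => /andP[g1 g2]; apply/andP; split; lra.
have H2 : (1 + c) * K (Phi d th B) (Phi d th A) (Phi d th x) <= K A B (Phi d th x).
  have := Hc (Phi d th B) (Phi d th A) (Phi d th x + 2 * pi * (- z)%:~R) h5.
  rewrite !Kz; apply => //; last exact: gapz.
  by apply: ltW; rewrite Phi_lt.
have d0 : 0 < d%:R * dGam b x by rewrite mulr_gt0 ?dGam_gt0// ltr0n.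
have c1 : 0 < 1 + c by lra.
apply: le_trans (_ : (1 + c) * (d%:R * dGam b x * K (Phi d th B) (Phi d th A) (Phi d th x)) <= _).
  by rewrite ler_pM2l.
by rewrite mulrCA ler_pM2l.
Qed.

Lemma expand_k th A B A1 B1 c : trap th A B A1 B1 ->
  (forall A' B' x, A1 <= A' -> A' <= B' -> B' <= B1 -> B < x < A + 2 * pi ->
    (1 + c) * K A' B' x <= K A B x) -> 0 < c ->
  forall x (m z : int) k, (1 <= k < d)%N -> gap A B m x -> gap A B z (Phi 1 th (Phi k th x)) ->
  (1 + c) * K A B x <= k%:R * dGam b x * dGam b (Phi k th x) * K A B (Phi 1 th (Phi k th x)).
Proof.
move=> [[h1 h2 h3 h4] [h5 h6 h7]] Hc c0 x m z k hk gx gy.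
have AB : A < B by lra.
have /andP[k1 kd] := hk.
have [h8 h9] := h7 k hk.
set y := Phi k th x in gy *; set w := Phi 1 th y in gy *.
have g2 : Phi 1 th (Phi k th B) + 2 * pi * z%:~R < w < Phi 1 th (Phi k th A) + 2 * pi * (z + 1)%:~R.
  by move: gy => /andP[g1 g2]; apply/andP; split; lra.
(* The arc of f_k need not lie in [A, B], so nothing is known of [y] beforehand; it avoids the image
   of [A, B] under f_k because its own image [w] avoids that under f_1 o f_k. *)
have g3 : Phi k th A + 2 * pi * (- (z + 1))%:~R < y < Phi k th B + 2 * pi * (- (z + 1) + 1)%:~R.
  have E v (j : int) : Phi 1 th v + 2 * pi * j%:~R = Phi 1 th (v + 2 * pi * (- j)%:~R).
    by rewrite Phiz mulr1 opprK.
  move: g2; rewrite /w !E !Phi_lt// => /andP[l1 l2].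
  by rewrite l2 /= opprD subrK l1.
have H1 : K A B x <= k%:R * dGam b x * K (Phi k th B) (Phi k th A) y.
  by apply: (expK (m := m) (z := (- (z + 1)))).
have H3 : K (Phi k th B) (Phi k th A) y <= dGam b y * K (Phi 1 th (Phi k th A)) (Phi 1 th (Phi k th B)) w.
  have := @expK 1 th (Phi k th B) (Phi k th A) y (- (z + 1)) z isT.
  by rewrite mul1r; apply => //; rewrite Phi_lt.
have H2 : (1 + c) * K (Phi 1 th (Phi k th A)) (Phi 1 th (Phi k th B)) w <= K A B w.
  have := Hc (Phi 1 th (Phi k th A)) (Phi 1 th (Phi k th B)) (w + 2 * pi * (- z)%:~R) h8.
  rewrite !Kz; apply => //; last exact: gapz.
  by apply: ltW; rewrite !Phi_lt.
have d0 : 0 < k%:R * dGam b x by rewrite mulr_gt0 ?dGam_gt0// ltr0n.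
have d0' := dGam_gt0 hb y.
have c1 : 0 < 1 + c by lra.
apply: le_trans (_ : (1 + c) * (k%:R * dGam b x * (dGam b y * K (Phi 1 th (Phi k th A)) (Phi 1 th (Phi k th B)) w)) <= _).
  by rewrite ler_pM2l// (le_trans H1)// ler_pM2l.
by rewrite mulrCA -(mulrA (_ * dGam b x)) ler_pM2l// mulrCA ler_pM2l.
Qed.

(** A length coordinate of the Hilbert metric on the m-th lift of the complement of [A, B]: a
    primitive of [K A B / 2], in the form of the logarithm of a cross-ratio. *)
Definition hil A B (m : int) x :=
  ln (sin ((x - 2 * pi * m%:~R - B) / 2)) - ln (sin ((A + 2 * pi - (x - 2 * pi * m%:~R)) / 2)).

Lemma is_derive_hil A B (m : int) x : A < B -> gap A B m x -> is_derive x 1 (hil A B m) (K A B x / 2).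
Proof.
move=> AB g; have := gapz g; rewrite mulrNz mulrN => /andP[g1 g2].
set y := x - 2 * pi * m%:~R in g1 g2.
have s1 : 0 < sin ((y - B) / 2) by rewrite sin_gt0_pi//; apply/andP; split; lra.
have s2 : 0 < sin ((A + 2 * pi - y) / 2) by rewrite sin_gt0_pi//; apply/andP; split; lra.
have d1 : is_derive x 1 (fun x => (x - 2 * pi * m%:~R - B) / 2) 2^-1.
  by apply: is_derive_eq; rewrite /GRing.scale /=; ring.
have d2 : is_derive x 1 (fun x => (A + 2 * pi - (x - 2 * pi * m%:~R)) / 2) (- 2^-1).
  by apply: is_derive_eq; rewrite /GRing.scale /=; ring.
have d3 : is_derive x 1 (fun x => sin ((x - 2 * pi * m%:~R - B) / 2)) (cos ((y - B) / 2) * 2^-1).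
  exact: (@is_derive1_comp R sin (fun x => (x - 2 * pi * m%:~R - B) / 2)).
have d4 : is_derive x 1 (fun x => sin ((A + 2 * pi - (x - 2 * pi * m%:~R)) / 2)) (cos ((A + 2 * pi - y) / 2) * (- 2^-1)).
  exact: (@is_derive1_comp R sin (fun x => (A + 2 * pi - (x - 2 * pi * m%:~R)) / 2)).
have l1 := is_derive1_ln s1; have l2 := is_derive1_ln s2.
have d5 : is_derive x 1 (fun x => ln (sin ((x - 2 * pi * m%:~R - B) / 2))) ((sin ((y - B) / 2))^-1 * (cos ((y - B) / 2) * 2^-1)).
  exact: (@is_derive1_comp R (@ln R) (fun x => sin ((x - 2 * pi * m%:~R - B) / 2))).
have d6 : is_derive x 1 (fun x => ln (sin ((A + 2 * pi - (x - 2 * pi * m%:~R)) / 2))) ((sin ((A + 2 * pi - y) / 2))^-1 * (cos ((A + 2 * pi - y) / 2) * (- 2^-1))).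
  exact: (@is_derive1_comp R (@ln R) (fun x => sin ((A + 2 * pi - (x - 2 * pi * m%:~R)) / 2))).
rewrite /hil; apply: is_derive_eq.
have -> : K A B x = K A B y.
  by rewrite (_ : x = y + 2 * pi * m%:~R) ?Kz// /y subrK.
have s3 : 0 < sin ((y - A) / 2) by rewrite sin_gt0_pi//; apply/andP; split; lra.
rewrite K_ct ?gt_eqF// /ct.
have -> : (A + 2 * pi - y) / 2 = pi - (y - A) / 2 by field.
have -> : sin (pi - (y - A) / 2) = sin ((y - A) / 2) by rewrite sinB sinpi cospi; ring.
have -> : cos (pi - (y - A) / 2) = - cos ((y - A) / 2) by rewrite cosB sinpi cospi; ring.
by field; rewrite !gt_eqF.
Qed.

Lemma hil_lip A B (m : int) x y l u : A < B -> gap A B m x -> gap A B m y -> x <= y ->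
  (forall t, x <= t <= y -> l <= K A B t / 2 <= u) ->
  l * (y - x) <= hil A B m y - hil A B m x <= u * (y - x).
Proof.
move=> AB /andP[x1 x2] /andP[y1 y2] xy H.
have g t : x <= t <= y -> gap A B m t.
  by move=> /andP[t1 t2]; apply/andP; split; lra.
move: xy; rewrite le_eqVlt => /orP[/eqP->|xy]; first by rewrite !subrr !mulr0 lexx.
have [t /andP[t1 t2] ->] := @MVTd R (hil A B m) (fun t => K A B t / 2) x y xy (fun t ht => is_derive_hil AB (g t ht)).
have /andP[h1 h2] := H t ltac:(apply/andP; split; lra).
by rewrite !ler_pM2r ?subr_gt0// h1.
Qed.

(* One block of letters expands the Hilbert distance of the complement of [A, B]. *)
Lemma hil_expand (G G' : R -> R) A B c (m z : int) x y : A < B -> x <= y ->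
  gap A B m x -> gap A B m y -> gap A B z (G x) -> gap A B z (G y) ->
  (forall t, x <= t <= y -> is_derive t 1 G (G' t)) ->
  (forall t, x <= t <= y -> gap A B z (G t) -> (1 + c) * K A B t <= G' t * K A B (G t)) ->
  {in `[x, y] &, {homo G : u v / u <= v}} ->
  (1 + c) * (hil A B m y - hil A B m x) <= hil A B z (G y) - hil A B z (G x).
Proof.
move=> AB xy /andP[x1 x2] /andP[y1 y2] /andP[gx1 gx2] /andP[gy1 gy2] dG eG mG.
have g t : x <= t <= y -> gap A B m t.
  by move=> /andP[t1 t2]; apply/andP; split; lra.
have gG t : x <= t <= y -> gap A B z (G t).
  move=> /andP[t1 t2].
  have m1 : G x <= G t by apply: mG; rewrite ?in_itv /= ?lexx ?xy ?t1 ?t2.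
  have m2 : G t <= G y by apply: mG; rewrite ?in_itv /= ?lexx ?xy ?t1 ?t2.
  by apply/andP; split; lra.
pose H t := hil A B z (G t) - (1 + c) * hil A B m t.
suff : H x <= H y by rewrite /H; lra.
apply: (@le_derive R H (fun t => K A B (G t) / 2 * G' t - (1 + c) * (K A B t / 2))) => // t ht.
  have d1 := is_derive_hil AB (g t ht).
  have d2 := is_derive_hil AB (gG t ht).
  have d3 := dG t ht.
  have d4 : is_derive t 1 (fun t => hil A B z (G t)) (K A B (G t) / 2 * G' t).
    exact: (@is_derive1_comp R (hil A B z) G).
  by rewrite /H; apply: is_derive_eq; rewrite /GRing.scale /=; ring.
have := eG t ht (gG t ht); lra.
Qed.

Lemma hil_expand_dec (G G' : R -> R) A B c (m z : int) x y : A < B -> x <= y ->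
  gap A B m x -> gap A B m y -> gap A B z (G x) -> gap A B z (G y) ->
  (forall t, x <= t <= y -> is_derive t 1 G (- G' t)) ->
  (forall t, x <= t <= y -> gap A B z (G t) -> (1 + c) * K A B t <= G' t * K A B (G t)) ->
  {in `[x, y] &, {homo G : u v /~ u <= v}} ->
  (1 + c) * (hil A B m y - hil A B m x) <= hil A B z (G x) - hil A B z (G y).
Proof.
move=> AB xy /andP[x1 x2] /andP[y1 y2] /andP[gx1 gx2] /andP[gy1 gy2] dG eG mG.
have g t : x <= t <= y -> gap A B m t.
  by move=> /andP[t1 t2]; apply/andP; split; lra.
have gG t : x <= t <= y -> gap A B z (G t).
  move=> /andP[t1 t2].
  have m1 : G t <= G x by apply: mG; rewrite ?in_itv /= ?lexx ?xy ?t1 ?t2.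
  have m2 : G y <= G t by apply: mG; rewrite ?in_itv /= ?lexx ?xy ?t1 ?t2.
  by apply/andP; split; lra.
pose H t := - hil A B z (G t) - (1 + c) * hil A B m t.
suff : H x <= H y by rewrite /H; lra.
apply: (@le_derive R H (fun t => K A B (G t) / 2 * G' t - (1 + c) * (K A B t / 2))) => // t ht.
  have d1 := is_derive_hil AB (g t ht).
  have d2 := is_derive_hil AB (gG t ht).
  have d3 := dG t ht.
  have d4 : is_derive t 1 (fun t => hil A B z (G t)) (K A B (G t) / 2 * - G' t).
    exact: (@is_derive1_comp R (hil A B z) G).
  by rewrite /H; apply: is_derive_eq; rewrite /GRing.scale /=; ring.
have := eG t ht (gG t ht); lra.
Qed.

End Expansion.

(** * Shadowing chains *)

Section Shadowing.
Variables (R : realType) (b : R) (d : nat).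
Hypotheses (hb : 1 < b) (hd : (2 <= d)%N).
Implicit Types x y u v th p q a r A B : R.
Local Notation Phi := (Phi b).
Local Notation letters := (letters d).
Local Notation transitions := (transitions d).

Lemma chain_exists (e : nat -> nat) th N x : letters e ->
  exists2 Z : nat -> R, Z N = x & forall n, (n < N)%N -> Z n.+1 = Phi (e n) th (Z n).
Proof.
move=> he.
have /boolp.choice[G hG] : forall y, exists x, Gam b x = y by exact: Gam_surj.
(* [Zr j] is the chain at time N - j, obtained by solving each step backwards with an inverse of
   [Gam]. *)
pose Zr := fix Zr j := if j is i.+1 then G ((th - Zr i) / (e (N - j)%N)%:R) else x.
exists (fun n => Zr (N - n)%N); first by rewrite subnn.
move=> n nN; have E : (N - n = (N - n.+1).+1)%N by rewrite subnSK.
have E2 : (N - (N - n.+1).+1 = n)%N by rewrite -E subKn// ltnW.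
rewrite E /= E2 /Phi hG; field.
by rewrite pnatr_eq0 -lt0n; case/andP: (he n).
Qed.

(** Each single letter expands lengths weighted by [kap] by a factor [c1]. The Hilbert density has
    this property only over whole blocks, so [kap] interpolates it at the intermediate times. *)
Definition weights (e : nat -> nat) (Y : nat -> R) (c1 w0 w1 : R) (kap : nat -> R) : Prop :=
  [/\ 1 < c1, 0 < w0, forall n, w0 <= kap n <= w1 &
      forall n, c1 * kap n <= (e n)%:R * dGam b (Y n) * kap n.+1].

Lemma dGam_bounds x : (b - 1) / (b + 1) <= dGam b x <= (b + 1) / (b - 1).
Proof.
have hb1 := hb; have b1 : 0 < b - 1 by lra.
have b2 : 0 < b + 1 by lra.
rewrite /dGam ler_pdivlMr ?Nsq_gt0// ler_pdivrMr ?Nsq_gt0//.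
have -> : b ^+ 2 - 1 = (b - 1) * (b + 1) by ring.
apply/andP; split.
  rewrite mulrAC ler_pdivrMr// -mulrA ler_pM2l//.
  by rewrite -expr2 Nsq_le.
rewrite mulrAC ler_pdivlMr// mulrC mulrA -expr2 mulrC ler_pM2l//.
by rewrite Nsq_ge.
Qed.

Lemma dGam_near c x y : 1 < c -> 2 * b * `|x - y| <= (c - 1) * (b - 1) ^+ 2 ->
  dGam b x <= c * dGam b y.
Proof.
move=> c1 h; have hb1 := hb.
rewrite /dGam mulrCA ler_pM2l ?b2_gt1//.
rewrite ler_pdivlMr ?Nsq_gt0// mulrC ler_pdivrMr ?Nsq_gt0//.
have Nx := Nsq_ge hb x.
suff : Nsq b y - Nsq b x <= (c - 1) * Nsq b x by lra.
apply: le_trans (_ : (c - 1) * (b - 1) ^+ 2 <= _); last by rewrite ler_pM2l ?subr_gt0.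
apply: le_trans h.
have -> : Nsq b y - Nsq b x = 2 * b * (cos y - cos x) by rewrite /Nsq; ring.
rewrite ler_pM2l; last lra.
have [xy|xy|->] := ltgtP x y; last by rewrite subrr normr_ge0.
  have [t _ ->] := @MVTd R cos (fun t => - sin t) x y xy (fun t _ => is_derive_cos t).
  rewrite distrC gtr0_norm ?subr_gt0// -[leRHS]mul1r ler_pM2r ?subr_gt0//.
have [t _ E] := @MVTd R cos (fun t => - sin t) y x xy (fun t _ => is_derive_cos t).
have -> : cos y - cos x = sin t * (x - y) by rewrite -opprB E; ring.
by rewrite gtr0_norm ?subr_gt0// -[leRHS]mul1r ler_pM2r ?subr_gt0// ?sin_le1.
Qed.

(** Backward induction from the common end point: were [Z n] outside its window of radius rho / kap
    n, expansion would push [Z n.+1] out of the next window, even after the change of parameter is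
    paid for. The gain [c1] is split: a factor [c2] absorbs the variation of [dGam] and c1 / c2
    absorbs the parameter. *)
Lemma real_shadow e (Y : nat -> R) al c1 w0 w1 kap : letters e ->
  (forall n, Y n.+1 = Phi (e n) al (Y n)) -> weights e Y c1 w0 w1 kap ->
  exists2 rho0, 0 < rho0 & forall rho, 0 < rho <= rho0 -> exists2 eta, 0 < eta &
  forall th, `|th - al| <= eta -> forall N (Z : nat -> R), Z N = Y N ->
  (forall n, (n < N)%N -> Z n.+1 = Phi (e n) th (Z n)) ->
  forall n, (n <= N)%N -> `|Z n - Y n| <= rho / kap n.
Proof.
move=> he hY [c11 w00 hk hw]; have hb1 := hb.
have w01 : w0 <= w1 by have /andP[h1 h2] := hk 0%N; exact: le_trans h2.
pose c2 := (1 + c1) / 2.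
have c21 : 1 < c2 by rewrite /c2; lra.
have c2c : c2 < c1 by rewrite /c2; lra.
(* Windows have radius at most rho0 / w0; by [dGam_near], [dGam] changes by a factor at most [c2] on
   them. *)
pose rho0 := (c2 - 1) * (b - 1) ^+ 2 * w0 / (2 * b).
have rho00 : 0 < rho0.
  by rewrite divr_gt0 ?mulr_gt0// ?exprn_gt0// ?subr_gt0//; lra.
exists rho0 => // rho /andP[r0 r1].
(* Half of what the remaining factor c1 / c2 gains on the smallest possible window, of radius rho /
   w1. *)
pose eta := (c1 / c2 - 1) * (rho / w1) / 2.
have cc : 0 < c1 / c2 - 1 by rewrite subr_gt0 ltr_pdivlMr ?mul1r//; lra.
have w10 : 0 < w1 by exact: lt_le_trans w01.
have eta0 : 0 < eta by rewrite divr_gt0// mulr_gt0// divr_gt0.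
exists eta => // th hth N Z ZN hZ.
have H j n : (n + j)%N = N -> `|Z n - Y n| <= rho / kap n.
  elim: j n => [|j IH] n.
    rewrite addn0 => ->; rewrite ZN subrr normr0.
    by have /andP[h1 _] := hk N; rewrite divr_ge0 ?ltW// (lt_le_trans w00).
  rewrite addnS -addSn => E; have {}IH := IH _ E.
  have nN : (n < N)%N by rewrite -E ltn_addr.
  have /andP[k0 k1] := hk n; have /andP[k0' k1'] := hk n.+1.
  have kn : 0 < kap n by exact: lt_le_trans k0.
  have kn' : 0 < kap n.+1 by exact: lt_le_trans k0'.
  pose t : R := rho / kap n; rewrite -/t; have t0 : 0 < t by rewrite divr_gt0.
  have tw : 2 * b * t <= (c2 - 1) * (b - 1) ^+ 2.
    rewrite mulrC -ler_pdivlMr; last lra.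
    rewrite /t ler_pdivrMr// (le_trans r1)// /rho0 mulrAC ler_pM2l//.
    by rewrite mulr_gt0 ?exprn_gt0 ?invr_gt0 ?subr_gt0//; rewrite ?divr_gt0 ?mulr_gt0 ?exprn_gt0 ?subr_gt0//; lra.
  have en : (0 : R) < (e n)%:R by rewrite ltr0n; case/andP: (he n).
  pose T : R := rho / kap n.+1.
  have T0 : 0 < T by rewrite divr_gt0.
  have key : c1 / c2 * T <= (e n)%:R * (dGam b (Y n) / c2 * t).
    have c20 : 0 < c2 by lra.
    have -> : (e n)%:R * (dGam b (Y n) / c2 * t) = ((e n)%:R * dGam b (Y n) / kap n) * (rho / c2).
      by rewrite /t; field; rewrite !gt_eqF.
    have -> : c1 / c2 * T = c1 / kap n.+1 * (rho / c2) by rewrite /T; field; rewrite !gt_eqF.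
    rewrite ler_pM2r; last exact: divr_gt0.
    rewrite ler_pdivlMr// mulrAC ler_pdivrMr// hw.
  have eta1 : eta < (c1 / c2 - 1) * T.
    rewrite /eta -mulrA ltr_pM2l//.
    apply: lt_le_trans (_ : rho / w1 <= _).
      by rewrite -[ltRHS]mulr1 ltr_pM2l ?divr_gt0//; lra.
    by rewrite /T ler_pM2l// lef_pV2 ?posrE.
  have E1 : (e n)%:R * (Gam b (Z n) - Gam b (Y n)) = (th - al) - (Z n.+1 - Y n.+1).
    by rewrite hZ// hY /Phi; ring.
  have lo y : Y n - t <= y <= Y n + t -> dGam b (Y n) / c2 <= dGam b y.
    move=> /andP[y1 y2]; rewrite ler_pdivrMr; last lra.
    rewrite mulrC; apply: dGam_near => //.
    rewrite (le_trans _ tw)// ler_pM2l; last lra.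
    by rewrite ler_norml; apply/andP; split; lra.
  move: hth IH; rewrite !ler_norml -/T -/t => /andP[a1 a2] /andP[b1 b2].
  apply/andP; split; rewrite leNgt; apply/negP => h.
    have l1 : Y n - t < Y n by lra.
    have [y /andP[y1 y2] e1] := MVTd l1 (fun y _ => is_derive_Gam hb y).
    have l2 := lo y ltac:(apply/andP; split; lra).
    have l3 : Gam b (Z n) < Gam b (Y n - t) by apply: ltr_Gam => //; lra.
    have l4 : dGam b (Y n) / c2 * t <= Gam b (Y n) - Gam b (Z n).
      apply: le_trans (_ : Gam b (Y n) - Gam b (Y n - t) <= _); last lra.
      by rewrite e1 (_ : Y n - (Y n - t) = t) ?ler_pM2r//; ring.
    have l5 : (e n)%:R * (dGam b (Y n) / c2 * t) <= (e n)%:R * (Gam b (Y n) - Gam b (Z n)).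
      by rewrite ler_pM2l.
    lra.
  have l1 : Y n < Y n + t by lra.
  have [y /andP[y1 y2] e1] := MVTd l1 (fun y _ => is_derive_Gam hb y).
  have l2 := lo y ltac:(apply/andP; split; lra).
  have l3 : Gam b (Y n + t) < Gam b (Z n) by apply: ltr_Gam => //; lra.
  have l4 : dGam b (Y n) / c2 * t <= Gam b (Z n) - Gam b (Y n).
    apply: le_trans (_ : Gam b (Y n + t) - Gam b (Y n) <= _); last lra.
    by rewrite e1 (_ : Y n + t - Y n = t) ?ler_pM2r//; ring.
  have l5 : (e n)%:R * (dGam b (Y n) / c2 * t) <= (e n)%:R * (Gam b (Z n) - Gam b (Y n)).
    by rewrite ler_pM2l.
  lra.
by move=> n nN; apply: (H (N - n)%N); rewrite subnKC.
Qed.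

Section Trapped.
Variables (e : nat -> nat) (s : nat -> bool) (A B A1 B1 c : R).
Hypotheses (he : letters e) (hs : transitions e s) (hs0 : s 0%N = false).
Hypothesis hc : 0 < c.
Hypothesis hK : forall A' B' x, A1 <= A' -> A' <= B' -> B' <= B1 -> B < x < A + 2 * pi ->
    (1 + c) * K A' B' x <= K A B x.

Lemma block n : s n = false ->
  (e n = d /\ s n.+1 = false) \/
  [/\ (1 <= e n < d)%N, s n.+1 = true, e n.+1 = 1%N & s n.+2 = false].
Proof.
move=> sn; have := hs n; rewrite sn => -[|[h1 h2]]; [by left|right].
have := hs n.+1; rewrite h2 => -[h3 h4]; split => //.
by rewrite h1 andbT; case/andP: (he n).
Qed.

(** At block starts the weight is the Hilbert density, bounded because the orbit stays between [x1]
    and [x2] modulo 2 pi. A block gains 1 + c, shared by at most two letters, hence c1 = sqrt (1 +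
    c). *)
Lemma weights_exist al (Y : nat -> R) (mm : nat -> int) x1 x2 :
  trap b d al A B A1 B1 -> B < x1 -> x1 <= x2 -> x2 < A + 2 * pi ->
  (forall n, Y n.+1 = Phi (e n) al (Y n)) ->
  (forall n, s n = false -> x1 + 2 * pi * (mm n)%:~R <= Y n <= x2 + 2 * pi * (mm n)%:~R) ->
  exists c1 w0 w1 kap, weights e Y c1 w0 w1 kap /\
    forall n, s n = false -> kap n = K A B (Y n).
Proof.
move=> T Bx x12 xA hY hg; have hb1 := hb; have hc1 := hc.
have [[AA1 AB1 BB1 BA] _] := T.
have AB : A < B by lra.
have gg n : s n = false -> gap A B (mm n) (Y n).
  by move=> sn; have /andP[g1 g2] := hg n sn; rewrite /gap intrD; apply/andP; split; lra.
have [C C0 HC] := K_le AB Bx x12 xA.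
have nz n : s n = false -> x1 <= Y n + 2 * pi * (- mm n)%:~R <= x2.
  by move=> sn; have /andP[g1 g2] := hg n sn; rewrite mulrNz; apply/andP; split; lra.
have KC n : s n = false -> K A B (Y n) <= C.
  by move=> sn; rewrite -(Kz A B (Y n) (- mm n)); apply: HC; exact: nz.
pose k0 := sin ((B - A) / 2).
have k00 : 0 < k0 by rewrite /k0 sin_gt0_pi//; apply/andP; split; lra.
have Kk n : s n = false -> k0 <= K A B (Y n).
  move=> sn; rewrite -(Kz A B (Y n) (- mm n)); apply: K_ge => //.
  by have /andP[g1 g2] := nz n sn; apply/andP; split; lra.
pose c1 := Num.sqrt (1 + c).
have c1s : c1 ^+ 2 = 1 + c by rewrite sqr_sqrtr//; lra.
have c10 : 0 <= c1 by exact: sqrtr_ge0.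
have c11 : 1 < c1 by rewrite -[ltLHS]sqrtr1 ltr_sqrt; lra.
pose g0 := (b - 1) / (b + 1); pose g1 := (b + 1) / (b - 1).
have g00 : 0 < g0 by apply: divr_gt0; lra.
have g10 : 0 < g1 by apply: divr_gt0; lra.
(* Inside a block the weight is chosen so that the closing letter 1 expands by exactly [c1]; the
   opening letter is then left with a gain of at least [c1]. *)
pose kap n := if s n then dGam b (Y n) * K A B (Y n.+1) / c1 else K A B (Y n).
have c1p : 0 < c1 by lra.
have sS n : s n = true -> s n.+1 = false by move=> sn; have := hs n; rewrite sn => -[].
exists c1, (Num.min k0 (g0 * k0 / c1)), (Num.max C (g1 * C / c1)), kap.
split; last by move=> n sn; rewrite /kap sn.
split => //.
- by rewrite lt_min k00 /= divr_gt0// mulr_gt0.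
- move=> n; rewrite /kap; case sn : (s n).
    have /andP[d1 d2] := dGam_bounds (Y n).
    have k1 := Kk _ (sS n sn); have k2 := KC _ (sS n sn).
    have k3 : 0 < K A B (Y n.+1) by exact: lt_le_trans k1.
    apply/andP; split.
      rewrite ge_min; apply/orP; right; rewrite ler_pM2r ?invr_gt0//.
      by rewrite ler_pM// ltW.
    rewrite le_max; apply/orP; right; rewrite ler_pM2r ?invr_gt0//.
    by rewrite ler_pM// ltW// dGam_gt0.
  by rewrite ge_min le_max Kk// KC.
- move=> n; rewrite {1}/kap; case sn : (s n).
    have [en _] : e n = 1%N /\ s n.+1 = false by have := hs n; rewrite sn.
    by rewrite /kap sS// en mul1r mulrC divfK ?gt_eqF.
  have Kn : 0 < K A B (Y n) by exact: lt_le_trans (Kk n sn).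
  have cc : c1 <= 1 + c by rewrite -c1s expr2 -[leLHS]mul1r ler_pM2r// ltW.
  have [[en sn1]|[en sn1 en1 sn2]] := block sn.
    rewrite /kap sn1 en.
    apply: le_trans (_ : (1 + c) * K A B (Y n) <= _); first by rewrite ler_pM2r.
    have := expand_d hb hd T hK hc (gg n sn) (z := mm n.+1).
    by rewrite -en -hY; apply; exact: gg.
  rewrite /kap sn1.
  have := expand_k hb T hK hc en (gg n sn) (z := mm n.+2).
  have E : Phi 1 al (Phi (e n) al (Y n)) = Y n.+2 by rewrite -en1 -!hY.
  rewrite E -hY => /(_ (gg _ sn2)) h.
  rewrite [leRHS](_ : _ = (e n)%:R * dGam b (Y n) * dGam b (Y n.+1) * K A B (Y n.+2) / c1); last first.
    by field; rewrite gt_eqF.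
  rewrite ler_pdivlMr//.
  have -> : c1 * K A B (Y n) * c1 = (1 + c) * K A B (Y n) by rewrite -c1s; ring.
  exact: h.
Qed.

(* Starting time of the j-th block. *)
Fixpoint ltime j := if j is i.+1 then
  (if e (ltime i) == d then (ltime i).+1 else (ltime i).+2) else 0%N.

Lemma ltimeP j : s (ltime j) = false.
Proof.
elim: j => //= j IH; have [[en sn1]|[en sn1 en1 sn2]] := block IH.
  by rewrite en eqxx.
by case/andP: en => _ h; rewrite (ltn_eqF h).
Qed.

Lemma leq_ltime j : (j <= ltime j)%N.
Proof.
elim: j => //= j IH; case: ifP => _; first by rewrite ltnS.
by rewrite ltnS (leq_trans IH)// leqnSn.
Qed.

Lemma leq_ltimeS i : (ltime i <= ltime i.+1)%N.
Proof. by rewrite /=; case: ifP => _; rewrite ?leqnSn// (leq_trans (leqnSn _)). Qed.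

(** Each of the [j] blocks multiplies the Hilbert distance by at least 1 + c, so two chains that
    stay together in the gaps started exponentially close. *)
Lemma chains_contract th (Y Z : nat -> R) (mm : nat -> int) j :
  trap b d th A B A1 B1 ->
  (forall n, (n < ltime j)%N -> Y n.+1 = Phi (e n) th (Y n)) ->
  (forall n, (n < ltime j)%N -> Z n.+1 = Phi (e n) th (Z n)) ->
  (forall n, (n <= ltime j)%N -> s n = false -> gap A B (mm n) (Y n) /\ gap A B (mm n) (Z n)) ->
  (1 + c) ^+ j * `|hil A B (mm 0%N) (Y 0%N) - hil A B (mm 0%N) (Z 0%N)| <=
  `|hil A B (mm (ltime j)) (Y (ltime j)) - hil A B (mm (ltime j)) (Z (ltime j))|.
Proof.
move=> T; have hb1 := hb; have hc1 := hc.
have [[AA1 AB1 BB1 BA] _] := T.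
have AB : A < B by lra.
elim: j => [|j IH] hY hZ hg; first by rewrite expr0 mul1r.
have lj := leq_ltimeS j.
have {}IH := IH (fun n hn => hY n (leq_trans hn lj)) (fun n hn => hZ n (leq_trans hn lj))
   (fun n hn => hg n (leq_trans hn lj)).
rewrite exprS -mulrA.
apply: le_trans (_ : (1 + c) * `|hil A B (mm (ltime j)) (Y (ltime j)) - hil A B (mm (ltime j)) (Z (ltime j))| <= _).
  by rewrite ler_pM2l//; have := hc; lra.
set n := ltime j in lj *; set n' := ltime j.+1 in lj hY hZ hg *.
have sn : s n = false by exact: ltimeP.
have sn' : s n' = false by exact: ltimeP.
have [gY gZ] := hg n lj sn; have [gY' gZ'] := hg n' (leqnn _) sn'.
have mon x y : gap A B (mm n) x -> gap A B (mm n) y -> x <= y -> hil A B (mm n) x <= hil A B (mm n) y.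
  move=> gx gy xy; apply: (@le_derive R _ (fun t => K A B t / 2)) => // t /andP[t1 t2].
    by apply: is_derive_hil => //; move: gx gy => /andP[u1 u2] /andP[v1 v2]; apply/andP; split; lra.
  have gt : gap A B (mm n) t by move: gx gy => /andP[u1 u2] /andP[v1 v2]; apply/andP; split; lra.
  by rewrite divr_ge0// ltW// -(Kz A B t (- mm n)) K_gt0// gapz.
clear IH; move: hY hZ gY gZ gY' gZ'; move: (Y) (Z) => Y' Z' hY hZ gY gZ gY' gZ'.
wlog le : Y' Z' hY hZ gY gZ gY' gZ' / Y' n <= Z' n.
  move=> W; have [h|h] := leP (Y' n) (Z' n); first exact: W.
  by rewrite distrC [leRHS]distrC; apply: W => //; exact: ltW.
have m0 := mon _ _ gY gZ le.
rewrite distrC ger0_norm ?subr_ge0//.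
have [[en sn1]|[en sn1 en1 sn2]] := block sn.
  have n'E : n' = n.+1 by rewrite /n' /= -/n en eqxx.
  have eY : Y' n' = Phi d th (Y' n) by rewrite n'E hY ?n'E// en.
  have eZ : Z' n' = Phi d th (Z' n) by rewrite n'E hZ ?n'E// en.
  rewrite eY eZ in gY' gZ' *.
  apply: le_trans (ler_norm _).
  apply: (@hil_expand_dec R (Phi d th) (fun t => d%:R * dGam b t) A B c (mm n) (mm n') _ _ AB le gY gZ gY' gZ').
  - by move=> t _; exact: is_derive_Phi.
  - move=> t /andP[t1 t2] gt; apply: (expand_d hb hd T hK hc (m := mm n)) gt.
    by move: gY gZ => /andP[u1 u2] /andP[v1 v2]; apply/andP; split; lra.
  - by move=> u v _ _ uv; rewrite Phi_le// (d1 hd).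
have n'E : n' = n.+2 by rewrite /n' /= -/n; case/andP: en => _ h; rewrite (ltn_eqF h).
have eY : Y' n' = Phi 1 th (Phi (e n) th (Y' n)).
  by rewrite n'E hY ?n'E// en1 hY ?n'E.
have eZ : Z' n' = Phi 1 th (Phi (e n) th (Z' n)).
  by rewrite n'E hZ ?n'E// en1 hZ ?n'E.
rewrite eY eZ in gY' gZ' *.
rewrite distrC; apply: le_trans (ler_norm _).
have k1 : (1 <= e n)%N by case/andP: en.
apply: (@hil_expand R (fun t => Phi 1 th (Phi (e n) th t)) (fun t => (e n)%:R * dGam b t * dGam b (Phi (e n) th t)) A B c (mm n) (mm n') _ _ AB le gY gZ gY' gZ').
- move=> t _; have h1 := is_derive_Phi hb (e n) th t.
  have h2 := is_derive_Phi hb 1 th (Phi (e n) th t).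
  have := @is_derive1_comp R (Phi 1 th) (Phi (e n) th) t _ _ h2 h1.
  by move=> h3; apply: is_derive_eq; rewrite mul1r; ring.
- move=> t /andP[t1 t2] gt; apply: (expand_k hb T hK hc en (m := mm n)) gt.
  by move: gY gZ => /andP[u1 u2] /andP[v1 v2]; apply/andP; split; lra.
- by move=> u v _ _ uv; rewrite Phi_le// Phi_le.
Qed.

End Trapped.
End Shadowing.

(** * Vitali's theorem for polynomials *)

Section Modulus.
Variable R : realType.
Implicit Types z w : Cx R.

(* The norm of [Cx R] takes its values in [Cx R]. *)
Definition nc z : R := complex.Re `|z|.

Lemma ncE z : `|z| = (nc z)%:C.
Proof. by rewrite /nc normc_def. Qed.

Lemma nc_def z : nc z = Num.sqrt (complex.Re z ^+ 2 + complex.Im z ^+ 2).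
Proof. by rewrite /nc normc_def. Qed.

Lemma nc_ge0 z : 0 <= nc z.
Proof. by rewrite nc_def sqrtr_ge0. Qed.

Lemma nc0 : nc 0 = 0. Proof. by rewrite /nc normr0. Qed.
Lemma nc1 : nc 1 = 1. Proof. by rewrite /nc normr1. Qed.
Lemma ncN z : nc (- z) = nc z. Proof. by rewrite /nc normrN. Qed.
Lemma ncB z w : nc (z - w) = nc (w - z). Proof. by rewrite -ncN opprB. Qed.

Lemma ncM z w : nc (z * w) = nc z * nc w.
Proof. by apply: complexI; rewrite -ncE normrM !ncE -rmorphM. Qed.

Lemma le_ncD z w : nc (z + w) <= nc z + nc w.
Proof. by rewrite -lecR -ncE rmorphD /= -!ncE ler_normD. Qed.

Lemma ncX z n : nc (z ^+ n) = nc z ^+ n.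
Proof. by elim: n => [|n IH]; rewrite ?expr0 ?nc1// !exprS ncM IH. Qed.

Lemma nc_eq0 z : (nc z == 0) = (z == 0).
Proof.
rewrite -[RHS]normr_eq0 ncE; apply/eqP/eqP => [->//|].
by move=> /(congr1 (@complex.Re R)).
Qed.

Lemma ncV z : nc z^-1 = (nc z)^-1.
Proof.
have [->|z0] := eqVneq z 0; first by rewrite invr0 nc0 invr0.
apply: (mulfI (x := nc z)); first by rewrite nc_eq0.
by rewrite -ncM mulfV// nc1 mulfV// nc_eq0.
Qed.

Lemma ncC (x : R) : nc (x%:C) = `|x|.
Proof. by rewrite nc_def /= expr0n addr0 sqrtr_sqr. Qed.

Lemma nc_nat n : nc n%:R = n%:R.
Proof.
have -> : n%:R = (n%:R : R)%:C :> Cx R by rewrite rmorph_nat.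
by rewrite ncC ger0_norm.
Qed.

Lemma ncB_ge z w : nc z - nc w <= nc (z - w).
Proof. by rewrite lerBlDr; have := le_ncD (z - w) w; rewrite subrK. Qed.
End Modulus.

Section Wiener.
Variable (R : realType) (r : R).
Hypothesis r0 : 0 <= r.
Implicit Types p q : {poly Cx R}.

(* The l^1 norm on coefficients with weight [r]: an algebra norm dominating both
   the sup norm on the disc of radius [r] and the Cauchy estimates. *)
Definition wn q : R := \sum_(i < size q) nc q`_i * r ^+ i.

Lemma wnE q n : (size q <= n)%N -> wn q = \sum_(i < n) nc q`_i * r ^+ i.
Proof.
move=> h; rewrite /wn (big_ord_widen _ (fun i => nc q`_i * r ^+ i) h) [RHS](bigID (fun i : 'I_n => (i < size q)%N)) /=.
rewrite [X in _ + X]big1 ?addr0// => i; rewrite -leqNgt => hi.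
by rewrite nth_default// nc0 mul0r.
Qed.

Lemma wn_ge0 q : 0 <= wn q.
Proof. by apply: sumr_ge0 => i _; rewrite mulr_ge0 ?nc_ge0 ?exprn_ge0. Qed.

Lemma wnMXaddC q c : wn (q * 'X + c%:P) = r * wn q + nc c.
Proof.
have h : (size (q * 'X + c%:P)%R <= (size q).+1)%N.
  by rewrite size_MXaddC; case: ifP.
rewrite (wnE h) big_ord_recl /= coefD coefMX coefC /= add0r expr0 mulr1 addrC; congr (_ + _).
rewrite /wn mulr_sumr; apply: eq_bigr => i _.
by rewrite /bump /= add1n coefD coefMX coefC /= addr0 exprS; ring.
Qed.

Lemma wnC c : wn c%:P = nc c.
Proof. by have := wnMXaddC 0 c; rewrite mul0r add0r /wn size_poly0 big_ord0 mulr0 add0r. Qed.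

Lemma wn1 : wn 1 = 1. Proof. by rewrite -[1]/(1%:P) wnC nc1. Qed.

Lemma wnX : wn 'X = r.
Proof. by have := wnMXaddC 1 0; rewrite mul1r addr0 wn1 mulr1 nc0 addr0. Qed.

Lemma wnD p q : wn (p + q) <= wn p + wn q.
Proof.
rewrite (wnE (size_polyD p q)) (wnE (leq_maxl (size p) (size q))) (wnE (leq_maxr (size p) (size q))).
rewrite -big_split /=; apply: ler_sum => i _; rewrite coefD -mulrDl.
by rewrite ler_wpM2r ?exprn_ge0// le_ncD.
Qed.

Lemma wnN p : wn (- p) = wn p.
Proof. by rewrite /wn size_polyN; apply: eq_bigr => i _; rewrite coefN ncN. Qed.

Lemma wnB p q : wn (p - q) <= wn p + wn q.
Proof. by rewrite -(wnN q); exact: wnD. Qed.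

Lemma wnBC p q : wn (p - q) = wn (q - p).
Proof. by rewrite -wnN opprB. Qed.

Lemma wnCM c q : wn (c%:P * q) = nc c * wn q.
Proof.
have h : (size (c%:P * q)%R <= size q)%N by rewrite mul_polyC size_scale_leq.
rewrite (wnE h) mulr_sumr; apply: eq_bigr => i _.
by rewrite coefCM ncM mulrA.
Qed.

Lemma wnM p q : wn (p * q) <= wn p * wn q.
Proof.
elim/poly_ind: p => [|p c IH].
  by rewrite mul0r -[0]/(0%:P) wnC nc0 mul0r.
rewrite wnMXaddC mulrDl mulrDl (le_trans (wnD _ _))// lerD ?wnCM//.
have -> : p * 'X * q = (p * q) * 'X + 0%:P by rewrite addr0; ring.
by rewrite wnMXaddC nc0 addr0 -mulrA ler_wpM2l.
Qed.

Lemma nc_horner q x : nc x <= r -> nc q.[x] <= wn q.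
Proof.
move=> xr; elim/poly_ind: q => [|q c IH]; first by rewrite horner0 nc0 wn_ge0.
rewrite hornerMXaddC wnMXaddC (le_trans (le_ncD _ _))// lerD2r ncM mulrC.
by rewrite ler_pM ?nc_ge0.
Qed.

Lemma wn_drop q : wn q = r * wn (drop_poly 1 q) + nc q`_0.
Proof.
rewrite -wnMXaddC; congr wn; apply/polyP => i.
rewrite coefD coefMX coefC coef_drop_poly; case: i => [|i] /=; first by rewrite add0r.
by rewrite ?add1n ?addn1 addr0.
Qed.

Lemma horner_drop q x : q.[x] = (drop_poly 1 q).[x] * x + q`_0.
Proof.
rewrite -hornerMXaddC; congr (_.[_]); apply/polyP => i.
rewrite coefD coefMX coefC coef_drop_poly; case: i => [|i] /=; first by rewrite add0r.
by rewrite ?add1n ?addn1 addr0.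
Qed.

Definition tends0 (u : nat -> R) := forall eps, 0 < eps -> exists N0, forall N, (N0 <= N)%N -> u N < eps.

Variable (mu : nat -> Cx R).
Hypothesis mu0 : forall j, mu j != 0 /\ nc (mu j) <= r.
Hypothesis mu_small : forall eps : R, 0 < eps -> exists j, nc (mu j) < eps.

(** Write q(mu) = q(0) + mu h(mu) with |h| <= M / r on the disc. A node [mu j] close to 0 makes the
    last term small uniformly in [N]; then [N] is taken large for that node. *)
Lemma vitali_coef0 M (q : nat -> {poly Cx R}) : 0 < r -> (forall N, wn (q N) <= M) ->
  (forall j, tends0 (fun N => nc (q N).[mu j])) -> tends0 (fun N => nc (q N)`_0).
Proof.
move=> r_gt0 hM hq eps e0.
have M0 : 0 <= M by rewrite (le_trans (wn_ge0 (q 0%N))).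
have M1 : 0 < M + 1 by rewrite ltr_wpDl.
have [j hj] : exists j, nc (mu j) < eps / 2 * r / (M + 1).
  by apply: mu_small; rewrite divr_gt0// mulr_gt0// divr_gt0.
have [N0 hN] := hq j (eps / 2) ltac:(by rewrite divr_gt0).
exists N0 => N hNN.
have {hN} h1 := hN N hNN.
have E : (q N)`_0 = (q N).[mu j] - (drop_poly 1 (q N)).[mu j] * mu j.
  by rewrite (horner_drop (q N)); ring.
rewrite E; have h2 := le_ncD (q N).[mu j] (- ((drop_poly 1 (q N)).[mu j] * mu j)).
rewrite ncN ncM in h2.
have h3 : nc (drop_poly 1 (q N)).[mu j] * r <= M.
  rewrite mulrC (le_trans _ (hM N))// [leRHS]wn_drop.
  rewrite (le_trans (_ : _ <= r * wn (drop_poly 1 (q N))))//; last by rewrite lerDl nc_ge0.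
  by rewrite ler_pM2l// nc_horner//; case: (mu0 j).
have h4 : nc (drop_poly 1 (q N)).[mu j] * nc (mu j) < eps / 2.
  set D := nc _ in h3 *.
  have D0 : 0 <= D by exact: nc_ge0.
  have : nc (mu j) * (M + 1) < eps / 2 * r by rewrite -ltr_pdivlMr.
  move=> h; rewrite -(ltr_pM2r r_gt0).
  apply: le_lt_trans h; rewrite mulrAC mulrC ler_wpM2l ?nc_ge0//; lra.
lra.
Qed.

(** The constant coefficients tend to 0, so q and q - q(0) have the same limit behaviour and a
    factor X can be divided out. The quotients satisfy the same hypotheses with M / r, and each
    division gains a factor |x| / r. *)
Lemma vitali_bound m : forall M (q : nat -> {poly Cx R}), 0 < r -> (forall N, wn (q N) <= M) ->
  (forall j, tends0 (fun N => nc (q N).[mu j])) -> forall x, nc x <= r ->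
  forall eps, 0 < eps -> exists N0, forall N, (N0 <= N)%N -> nc (q N).[x] < M * (nc x / r) ^+ m + eps.
Proof.
elim: m => [|m IH] M q r_gt0 hM hq x xr eps e0.
  exists 0%N => N _; rewrite expr0 mulr1; apply: le_lt_trans (nc_horner (q N) xr) _.
  by rewrite (le_lt_trans (hM N))// ltrDl.
have hM' N : wn (drop_poly 1 (q N)) <= M / r.
  rewrite ler_pdivlMr// mulrC (le_trans _ (hM N))// [leRHS]wn_drop lerDl nc_ge0//.
have c0 := vitali_coef0 r_gt0 hM hq.
have hq' j : tends0 (fun N => nc (drop_poly 1 (q N)).[mu j]).
  move=> e e1; have [m0 mr] := mu0 j.
  have nm : 0 < nc (mu j) by rewrite lt_neqAle eq_sym nc_eq0 m0 nc_ge0.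
  have [N1 h1] := hq j (e * nc (mu j) / 2) ltac:(by rewrite divr_gt0// mulr_gt0).
  have [N2 h2] := c0 (e * nc (mu j) / 2) ltac:(by rewrite divr_gt0// mulr_gt0).
  exists (maxn N1 N2) => N; rewrite geq_max => /andP[n1 n2].
  have := h1 N n1; have := h2 N n2 => {h1 h2} h2 h1.
  rewrite -(ltr_pM2r nm) -ncM.
  have -> : (drop_poly 1 (q N)).[mu j] * mu j = (q N).[mu j] - (q N)`_0 by rewrite (horner_drop (q N)); ring.
  apply: le_lt_trans (le_ncD _ _) _; rewrite ncN; lra.
have [N1 h1] := IH _ _ r_gt0 hM' hq' x xr (eps / (2 * r)) ltac:(by rewrite divr_gt0// mulr_gt0).
have [N2 h2] := c0 (eps / 2) ltac:(by rewrite divr_gt0).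
exists (maxn N1 N2) => N; rewrite geq_max => /andP[n1 n2].
have {}h1 := h1 N n1; have {}h2 := h2 N n2.
rewrite horner_drop; apply: le_lt_trans (le_ncD _ _) _; rewrite ncM.
set D := nc _ in h1 *; have D0 : 0 <= D by exact: nc_ge0.
set X := nc x in xr h1 *; have X0 : 0 <= X by exact: nc_ge0.
have h3 : D * X <= (M / r * (X / r) ^+ m + eps / (2 * r)) * X by rewrite ler_wpM2r// ltW.
have h4 : eps / (2 * r) * X <= eps / 2.
  have -> : eps / (2 * r) * X = eps / 2 * (X / r) by field; rewrite gt_eqF.
  by rewrite -[leRHS]mulr1 ler_pM2l ?divr_gt0// ler_pdivrMr// mul1r.
have E : M / r * (X / r) ^+ m * X = M * (X / r) ^+ m.+1 by rewrite exprS; field; rewrite gt_eqF.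
rewrite mulrDl E in h3; lra.
Qed.

(* A Vitali theorem: convergence to 0 at points accumulating at the centre
   propagates to the disc of half radius. *)
Lemma vitali M (q : nat -> {poly Cx R}) : 0 < r -> (forall N, wn (q N) <= M) ->
  (forall j, tends0 (fun N => nc (q N).[mu j])) -> forall x, nc x <= r / 2 ->
  tends0 (fun N => nc (q N).[x]).
Proof.
move=> r_gt0 hM hq x xr eps e0.
have M0 : 0 <= M by rewrite (le_trans (wn_ge0 (q 0%N))).
have [m hm] : exists m, M * (1 / 2 : R) ^+ m < eps / 2.
  have [m hm] : exists m : nat, M < (eps / 2) * m%:R.
    exists (Num.truncn (M / (eps / 2))).+1; rewrite mulrC -ltr_pdivrMr ?divr_gt0//.
    by rewrite truncnS_gt// divr_ge0// ltW// divr_gt0.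
  exists m; rewrite expr_div_n expr1n mulrA mulr1 ltr_pdivrMr ?exprn_gt0//.
  apply: lt_le_trans hm _; rewrite ler_pM2l ?divr_gt0// -natrX ler_nat.
  by apply: ltnW; rewrite ltn_expl.
have xr' : nc x <= r by rewrite (le_trans xr)//; lra.
have [N0 h] := vitali_bound m r_gt0 hM hq (x := x) xr' (eps := eps / 2) ltac:(by rewrite divr_gt0).
exists N0 => N hN; apply: lt_le_trans (h N hN) _.
have h2 : M * (nc x / r) ^+ m <= M * (1 / 2) ^+ m.
  rewrite ler_wpM2l// lerXn2r ?nnegrE ?divr_ge0 ?nc_ge0//.
  rewrite ler_pdivrMr//; lra.
lra.
Qed.

End Wiener.

(** * Polynomial approximation of shadowing chains *)

Section Newton.
Variables (R : realType).
Implicit Types (U V x y : {poly Cx R}).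

Lemma wn_mul1 (r al be : R) (x y : {poly Cx R}) : 0 <= r -> wn r (x - 1) <= al -> wn r (y - 1) <= be ->
  wn r (x * y - 1) <= (1 + al) * (1 + be) - 1.
Proof.
move=> r0 hx hy.
have -> : x * y - 1 = (x - 1) * (y - 1) + ((x - 1) + (y - 1)) by ring.
apply: le_trans (wnD r0 _ _) _.
have h1 := wnD r0 (x - 1) (y - 1).
have h2 := wnM r0 (x - 1) (y - 1).
have h3 : wn r (x - 1) * wn r (y - 1) <= al * be.
  by apply: ler_pM => //; exact: wn_ge0.
lra.
Qed.

Lemma wn_exp1 (r al : R) (x : {poly Cx R}) n : 0 <= r -> wn r (x - 1) <= al ->
  wn r (x ^+ n - 1) <= (1 + al) ^+ n - 1.
Proof.
move=> r0 hx; elim: n => [|n IH].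
  by rewrite !expr0 !subrr -[0]/(0%:P) wnC nc0.
rewrite !exprS; have := wn_mul1 r0 hx IH.
by have -> : 1 + ((1 + al) ^+ n - 1) = (1 + al) ^+ n by ring.
Qed.

(* Iteration converging to the small root x of U (1 + x)^k = V. *)
Definition newton (k : nat) U V x := x - (k%:R^-1)%:P * (U * (1 + x) ^+ k - V).

Lemma wn_sum (r : R) n (F : 'I_n -> {poly Cx R}) : 0 <= r ->
  wn r (\sum_i F i) <= \sum_i wn r (F i).
Proof.
move=> r0; elim/big_rec2: _ => [|i u v _ h]; first by rewrite -[0]/(0%:P) wnC nc0.
by rewrite (le_trans (wnD r0 _ _))// lerD2l.
Qed.

(** The derivative of [newton] in x is 1 - U (1 + x)^(k-1), which is small for U near 1 and x near
    0; the estimate is its version for divided differences in the algebra norm. *)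
Lemma newton_contract (r ep sg : R) k U V x y : 0 <= r -> (1 <= k)%N ->
  wn r (U - 1) <= ep -> wn r x <= sg -> wn r y <= sg ->
  wn r (newton k U V x - newton k U V y) <= ((1 + ep) * (1 + sg) ^+ k.-1 - 1) * wn r (x - y).
Proof.
move=> r0 k1 hU hx hy.
have k0 : (k%:R : Cx R) != 0 by rewrite pnatr_eq0 -lt0n.
(* S / k is the divided difference of [newton] between [x] and [y]. *)
pose S := \sum_(i < k) (1 - U * ((1 + x) ^+ (k.-1 - i) * (1 + y) ^+ i)).
have E : newton k U V x - newton k U V y = (k%:R^-1)%:P * S * (x - y).
  have h : (1 + x) ^+ k - (1 + y) ^+ k = (x - y) * \sum_(i < k) (1 + x) ^+ (k.-1 - i) * (1 + y) ^+ i.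
    by rewrite subrXX; congr (_ * _); ring.
  have hS : S = k%:R - U * \sum_(i < k) (1 + x) ^+ (k.-1 - i) * (1 + y) ^+ i.
    by rewrite /S sumrB -mulr_sumr sumr_const card_ord.
  have hk : (k%:R^-1)%:P * k%:R = 1 :> {poly Cx R}.
    have -> : (k%:R : {poly Cx R}) = (k%:R)%:P by rewrite polyC_natr.
    by rewrite -polyCM mulVf.
  rewrite hS (mulrBr (k%:R^-1)%:P) hk /newton.
  have -> : x - (k%:R^-1)%:P * (U * (1 + x) ^+ k - V) - (y - (k%:R^-1)%:P * (U * (1 + y) ^+ k - V)) =
    (x - y) - (k%:R^-1)%:P * U * ((1 + x) ^+ k - (1 + y) ^+ k) by ring.
  by rewrite h; ring.
rewrite E (le_trans (wnM r0 _ _))// ler_wpM2r ?wn_ge0// wnCM//.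
rewrite ncV nc_nat ler_pdivrMl ?ltr0n//.
apply: le_trans (wn_sum _ r0) _.
apply: le_trans (_ : \sum_(i < k) ((1 + ep) * (1 + sg) ^+ k.-1 - 1) <= _); last first.
  by rewrite sumr_const card_ord mulr_natl.
apply: ler_sum => i _; rewrite wnBC//.
have e1 z : wn r z <= sg -> wn r (1 + z - 1) <= sg by rewrite addrAC subrr add0r.
have h1 := wn_exp1 (k.-1 - i) r0 (e1 _ hx); have h2 := wn_exp1 i r0 (e1 _ hy).
have h3 := wn_mul1 r0 h1 h2.
have h4 := wn_mul1 r0 hU h3.
apply: le_trans h4 _.
rewrite lerD2r le_eqVlt; apply/orP; left; apply/eqP; congr (_ * _).
have -> : k.-1 = (k.-1 - i + i)%N.
  by rewrite subnK// -ltnS prednK.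
by rewrite addnK exprD; ring.
Qed.

Lemma exp1_le (sg : R) m : 0 <= sg -> sg <= 1 -> (1 + sg) ^+ m <= 1 + 3 ^+ m * sg.
Proof.
move=> s0 s1; elim: m => [|m IH]; first by rewrite !expr0 mul1r lerDl.
rewrite exprSr; apply: le_trans (_ : (1 + 3 ^+ m * sg) * (1 + sg) <= _).
  by rewrite ler_wpM2r//; lra.
have t1 : 1 <= (3 : R) ^+ m by rewrite exprn_ege1// ler1n.
have h1 : 3 ^+ m * sg * sg <= 3 ^+ m * sg.
  by rewrite -[leRHS]mulr1 ler_wpM2l// mulr_ge0// exprn_ge0.
have h2 : sg <= 3 ^+ m * sg by rewrite -[leLHS]mul1r ler_wpM2r.
rewrite exprS mulrDr mulr1 mulrDl mul1r -!mulrA; rewrite -mulrA in h1; lra.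
Qed.

Section Step.
Variables (b c : R) (d : nat).
Hypotheses (hb : 1 < b) (hc : 1 < c).

(** [k0] is the contraction rate and [sg] the radius of the ball on which Newton iteration is run;
    [e1] bounds the admissible error and parameter radius. The requirement c (1 - k0) >= 1 makes the
    ball of radius [c] times the first step invariant, so the loss per step is a factor [c] as close
    to 1 as desired. *)
Lemma newton_consts : exists k0 sg e1 : R, [/\ 0 < sg, 0 < e1, 0 <= k0 /\ k0 <= 1 / 2, c * (1 - k0) >= 1 &
  forall rho r (k : nat), 0 <= rho <= e1 -> 0 <= r <= e1 -> (1 <= k <= d)%N ->
  [/\ (1 + ((1 + r) * (1 + b / (b - 1) * rho) - 1)) * (1 + sg) ^+ k.-1 - 1 <= k0,
      c * ((b + 1) / (b - 1) * rho + 2 * r) <= sg, b / (b - 1) * rho <= 1, r <= 1 & (1 + sg) ^+ k <= 2]].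
Proof.
have hb1 := hb; have hc1 := hc.
pose k0 := Num.min (1 / 2 : R) (1 - 1 / c).
have c0 : 0 < c by lra.
have k00 : 0 < k0.
  rewrite lt_min; apply/andP; split; first lra.
  by rewrite subr_gt0 ltr_pdivrMr ?mul1r.
have k0h : k0 <= 1 / 2 by rewrite ge_min lexx.
have k0c : k0 <= 1 - 1 / c by rewrite ge_min lexx orbT.
have t0 : 0 < (3 : R) ^+ d.+2 by rewrite exprn_gt0.
pose sg := Num.min 1 (k0 / 3 ^+ d.+2).
have sg0 : 0 < sg by rewrite lt_min ltr01 divr_gt0.
have sg1 : sg <= 1 by rewrite ge_min lexx.
have hsg m : (m <= d.+2)%N -> (1 + sg) ^+ m <= 1 + k0.
  move=> md; apply: le_trans (_ : (1 + sg) ^+ d.+2 <= _).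
    by apply: ler_weXn2l => //; lra.
  apply: le_trans (exp1_le _ (ltW sg0) sg1) _; rewrite lerD2l mulrC -ler_pdivlMr//.
  by rewrite ge_min lexx orbT.
have bb : 0 < b / (b - 1) by apply: divr_gt0; lra.
have bb' : 0 < (b + 1) / (b - 1) by apply: divr_gt0; lra.
pose e1 := Num.min (Num.min sg (sg / (b / (b - 1)))) (sg / (c * ((b + 1) / (b - 1) + 2))).
have D0 : 0 < c * ((b + 1) / (b - 1) + 2) by rewrite mulr_gt0//; lra.
have mm (x y z : R) : [/\ Num.min (Num.min x y) z <= x, Num.min (Num.min x y) z <= y &
    Num.min (Num.min x y) z <= z] by rewrite !ge_min !lexx !orbT.
have [e1s e1b e1c] := mm sg (sg / (b / (b - 1))) (sg / (c * ((b + 1) / (b - 1) + 2))).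
rewrite -/e1 in e1s e1b e1c.
have e10 : 0 < e1.
  have mp (x y z : R) : 0 < x -> 0 < y -> 0 < z -> 0 < Num.min (Num.min x y) z.
    by move=> x0 y0 z0; rewrite !lt_min x0 y0.
  by apply: mp => //; exact: divr_gt0.
exists k0, sg, e1; split => //.
- by split => //; exact: ltW.
- have : c * k0 <= c * (1 - 1 / c) by rewrite ler_pM2l.
  rewrite mulrBr mulr1 mul1r mulfV ?gt_eqF//; lra.
move=> rho r k /andP[rho0 rho1] /andP[r0 r1] /andP[k1 kd].
have h1 : b / (b - 1) * rho <= sg.
  rewrite mulrC -ler_pdivlMr//; lra.
have h2 : r <= sg by lra.
split.
- have -> : 1 + ((1 + r) * (1 + b / (b - 1) * rho) - 1) = (1 + r) * (1 + b / (b - 1) * rho) by ring.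
  rewrite lerBlDl.
  apply: le_trans (hsg k.+1 _); last by rewrite !ltnS ltnW.
  have -> : k.+1 = (k.-1).+2 by rewrite prednK.
  rewrite !exprS mulrA ler_wpM2r//; first by rewrite exprn_ge0//; lra.
  have h3 : 0 <= b / (b - 1) * rho by rewrite mulr_ge0// ltW.
  by apply: ler_pM; lra.
- have h3 : c * ((b + 1) / (b - 1) * rho + 2 * r) <= c * ((b + 1) / (b - 1) + 2) * e1.
    rewrite -(mulrA c) ler_pM2l// [leRHS]mulrDl; apply: lerD; first by rewrite ler_pM2l.
    by rewrite ler_pM2l.
  by apply: le_trans h3 _; rewrite mulrC -ler_pdivlMr.
- lra.
- lra.
- by apply: le_trans (hsg k _) _; [rewrite ltnW// ltnW|lra].
Qed.

Lemma nc_sqr (z : Cx R) : nc z ^+ 2 = complex.Re z ^+ 2 + complex.Im z ^+ 2.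
Proof. by rewrite nc_def sqr_sqrtr// addr_ge0// sqr_ge0. Qed.

Lemma nc_bt1 (t : Cx R) : nc t = 1 -> nc ((b%:C : Cx R) * t - 1) = nc (t - b%:C).
Proof.
move=> ht; apply/eqP; rewrite -(@eqrXn2 _ 2)// ?nc_ge0//; apply/eqP.
have := nc_sqr t; rewrite ht expr1n !nc_sqr; case: t ht => x y ht /= h.
have h2 : y ^+ 2 = 1 - x ^+ 2 by lra.
by rewrite !mul0r !subr0 addr0 exprMn h2; ring.
Qed.

Lemma nc_tb_ge (t : Cx R) : nc t = 1 -> b - 1 <= nc (t - b%:C).
Proof.
move=> ht; have := ncB_ge (b%:C : Cx R) t; rewrite ht ncC ncB ger0_norm//.
by have := hb; lra.
Qed.

Lemma contract_bound (k0 M x y z : R) : 0 <= k0 -> x <= k0 * y -> y <= M ->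
  z <= (1 - k0) * M -> x + z <= M.
Proof.
move=> k00 h1 h2 h3; have h4 : k0 * y <= k0 * M by rewrite ler_wpM2l.
lra.
Qed.

(** One backward step of a chain, with polynomials in the parameter increment in place of numbers:
    given [Q] approximating t, find [P] approximating the root s near [s0] of the relation of
    [chain_rel]. The first bound propagates the size of the deviation with nearly the exact
    derivative; the second propagates the approximation error with a constant [C2] that may exceed
    1, which is harmless because [dl] is arbitrary. *)
Lemma newton_step : exists sg e1 C2 : R, [/\ 0 < sg, 0 < e1, 0 <= C2 &
  forall (k : nat) (s0 t0 l0 : Cx R) (rho r : R) (Q : {poly Cx R}), (1 <= k <= d)%N ->
  nc s0 = 1 -> nc t0 = 1 -> nc l0 = 1 ->
  l0 * s0 ^+ k * ((b%:C : Cx R) * t0 - 1) + (t0 - b%:C) = 0 ->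
  0 <= rho <= e1 -> 0 <= r <= e1 -> wn r (Q - t0%:P) <= rho ->
  forall dl, 0 < dl -> exists P : {poly Cx R},
  wn r (P - s0%:P) <= c * ((b ^+ 2 - 1) / (nc (t0 - b%:C)) ^+ 2 / k%:R * rho + 2 * r) /\
  forall mu t s, nc mu <= r -> nc (s - s0) <= sg ->
    (l0 + mu) * s ^+ k * ((b%:C : Cx R) * t - 1) + (t - b%:C) = 0 ->
    nc (P.[mu] - s) <= dl + C2 * nc (Q.[mu] - t)].
Proof.
have hb1 := hb; have hc1 := hc.
have [k0 [sg [e1 [sg0 e10 [k00 k0h] k0c H]]]] := newton_consts.
have b10 : 0 < b - 1 by lra.
have b0 : 0 <= b by lra.
have c0 : 0 < c by lra.
have b20 : 0 <= b ^+ 2 - 1.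
  by have -> : b ^+ 2 - 1 = (b - 1) * (b + 1) by [ring]; rewrite mulr_ge0//; lra.
have b1p : 0 <= b + 1 by lra.
have b11 : b - 1 != 0 by rewrite gt_eqF.
have p2 : 0 <= (b + 1) / (b - 1) by rewrite divr_ge0// ltW.
pose C1 := 2 * (b / (b - 1)) * 2 + 1 / (b - 1).
have C10 : 0 <= C1.
  have B0 : 0 <= b / (b - 1) by apply: divr_ge0; lra.
  have I0 : 0 <= 1 / (b - 1) by apply: divr_ge0; lra.
  by rewrite /C1 addr_ge0// mulr_ge0// mulr_ge0.
exists sg, e1, (2 * C1); split => //; first by rewrite mulr_ge0.
move=> k s0 t0 l0 rho r Q hk ns nt nl E0 hrho hr hQ dl dl0.
have [H1 H2 H3 H4 H5] := H rho r k hrho hr hk.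
have /andP[r0 r1] := hr; have /andP[rho0 rho1] := hrho; have /andP[k1 kd] := hk.
pose bc : Cx R := b%:C.
pose w := (bc * t0 - 1)^-1; pose v := (t0 - bc)^-1.
pose T := nc (t0 - bc).
have T1 : b - 1 <= T by exact: nc_tb_ge.
have T0 : 0 < T by exact: lt_le_trans T1.
have nw : nc w = T^-1 by rewrite /w ncV nc_bt1.
have nv : nc v = T^-1 by rewrite /v ncV.
have nb : nc bc = b by rewrite /bc ncC ger0_norm// ltW// (lt_trans ltr01).
have t0b : t0 - bc != 0 by rewrite -nc_eq0 gt_eqF.
have bt0 : bc * t0 - 1 != 0 by rewrite -nc_eq0 nc_bt1// gt_eqF.
have s00 : s0 != 0 by rewrite -nc_eq0 ns oner_eq0.
have l00 : l0 != 0 by rewrite -nc_eq0 nl oner_eq0.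
have bwT : b * T^-1 <= b / (b - 1) by rewrite ler_wpM2l// lef_pV2 ?posrE.
have bT0 : 0 <= b * T^-1 by rewrite mulr_ge0// invr_ge0 ltW.
pose eta := Q - t0%:P.
(* ['X] stands for the increment of the parameter. Dividing the relation by its instance at [l0],
   [s0], [t0] gives U (1 + x)^k = V with s = s0 (1 + x), where U and V are near 1. *)
pose U := (1 + (l0^-1)%:P * 'X) * (1 + (bc * w)%:P * eta).
pose V := 1 + v%:P * eta.
have a1 : wn r (1 + (l0^-1)%:P * 'X - 1) <= r.
  by rewrite addrAC subrr add0r wnCM// wnX// ncV nl invr1 mul1r.
have a2 : wn r (1 + (bc * w)%:P * eta - 1) <= b / (b - 1) * rho.
  rewrite addrAC subrr add0r wnCM// ncM nw nb.
  apply: ler_pM => //; last exact: wn_ge0.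
have hU := wn_mul1 r0 a1 a2; rewrite -/U in hU.
have cM x y : wn r x <= sg -> wn r y <= sg ->
    wn r (newton k U V x - newton k U V y) <= k0 * wn r (x - y).
  move=> hx hy; apply: le_trans (newton_contract V r0 k1 hU hx hy) _.
  by rewrite ler_wpM2r ?wn_ge0.
(* The modulus of ds/dt at the base point; the term 2 r added to G rho below accounts for the change
   of parameter. *)
pose G := (b ^+ 2 - 1) / T ^+ 2 / k%:R.
pose M := c * (G * rho + 2 * r).
have kR : (0 : R) < k%:R by rewrite ltr0n.
have kR1 : (1 : R) <= k%:R by rewrite ler1n.
have G0 : 0 <= G.
  by rewrite /G !divr_ge0 ?exprn_ge0 ?(ltW T0).
have GB : G <= (b + 1) / (b - 1).
  rewrite /G ler_pdivrMr// ler_pdivrMr ?exprn_gt0//.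
  have -> : b ^+ 2 - 1 = (b + 1) / (b - 1) * 1 * (b - 1) ^+ 2 by field.
  apply: ler_pM; rewrite ?mulr1 ?exprn_ge0 ?(ltW b10)//.
    by rewrite ler_peMr.
  by rewrite lerXn2r ?nnegrE ?(ltW b10) ?(ltW T0).
have M0 : 0 <= M by rewrite /M (mulr_ge0 (ltW c0))// addr_ge0// mulr_ge0.
have Msg : M <= sg.
  by apply: le_trans H2; rewrite ler_pM2l// lerD2r ler_wpM2r.
have z1 : wn r (newton k U V 0) <= G * rho + 2 * r.
  have -> : newton k U V 0 = (k%:R^-1)%:P * ((v - bc * w)%:P * eta - (l0^-1)%:P * 'X * (1 + (bc * w)%:P * eta)).
    rewrite /newton addr0 expr1n mulr1 /U /V polyCB; ring.
  rewrite wnCM// ncV nc_nat.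
  have e2 : nc (v - bc * w) = (b ^+ 2 - 1) / T ^+ 2.
    have -> : v - bc * w = ((b ^+ 2 - 1)%:C : Cx R) / ((t0 - bc) * (bc * t0 - 1)).
      have -> : ((b ^+ 2 - 1)%:C : Cx R) = bc ^+ 2 - 1 by rewrite rmorphB rmorphXn rmorph1.
      by rewrite /v /w; field; rewrite t0b bt0.
    by rewrite ncM ncV ncM nc_bt1// ncC -/T ger0_norm// -[T ^+ 2]expr2.
  have h1 : wn r ((v - bc * w)%:P * eta - (l0^-1)%:P * 'X * (1 + (bc * w)%:P * eta)) <=
     (b ^+ 2 - 1) / T ^+ 2 * rho + 2 * r.
    apply: le_trans (wnB r0 _ _) _; apply: lerD.
      rewrite wnCM// e2 ler_wpM2l//.
      by move: G0; rewrite /G pmulr_lge0 ?invr_gt0.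
    apply: le_trans (wnM r0 _ _) _; rewrite wnCM// wnX// ncV nl invr1 mul1r mulrC ler_wpM2r//.
    apply: le_trans (wnD r0 _ _) _; rewrite wn1.
    rewrite addrAC subrr add0r in a2.
    by apply: lerD => //; exact: le_trans a2 H3.
  rewrite ler_pdivrMl//; apply: le_trans h1 _.
  rewrite mulrDr; apply: lerD.
    by rewrite le_eqVlt; apply/orP; left; apply/eqP; rewrite /G; field; rewrite !gt_eqF.
  by rewrite -[leLHS]mul1r ler_wpM2r// mulr_ge0.
pose z := fun i => iter i (newton k U V) 0.
have wz i : wn r (z i) <= M.
  elim: i => [|i IH]; first by rewrite /z /= -[0]/(0%:P) wnC nc0.
  rewrite /z iterS -/(z i).
  have -> : newton k U V (z i) = (newton k U V (z i) - newton k U V 0) + newton k U V 0 by rewrite subrK.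
  apply: le_trans (wnD r0 _ _) _.
  have h0 : wn r (0 : {poly Cx R}) <= sg by rewrite -[0]/(0%:P) wnC nc0 ltW.
  have := cM (z i) 0 (le_trans IH Msg) h0; rewrite subr0 => h1.
  have h3 : G * rho + 2 * r <= (1 - k0) * M.
    rewrite /M mulrA [(1 - k0) * c]mulrC -[leLHS]mul1r ler_wpM2r//.
    by rewrite addr_ge0// mulr_ge0.
  exact: contract_bound k00 h1 IH (le_trans z1 h3).
(* Newton iteration is stopped once its error falls below [dl], which keeps the answer
   polynomial. *)
have [i hi] : exists i : nat, (1 / 2 : R) ^+ i * sg < dl.
  have [m hm] : exists m : nat, sg < dl * m%:R.
    exists (Num.truncn (sg / dl)).+1; rewrite mulrC -ltr_pdivrMr//.
    by rewrite truncnS_gt// divr_ge0// ltW.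
  exists m; rewrite mulrC expr_div_n expr1n mulrA mulr1 ltr_pdivrMr ?exprn_gt0//.
  apply: lt_le_trans hm _; rewrite ler_pM2l// -natrX ler_nat.
  by apply: ltnW; rewrite ltn_expl.
exists (s0%:P * (1 + z i)); split.
  have -> : s0%:P * (1 + z i) - s0%:P = s0%:P * z i by ring.
  by rewrite wnCM// ns mul1r.
move=> mu t s hmu hs E1.
pose ze := s / s0 - 1.
have nze : nc ze <= sg.
  have -> : ze = (s - s0) / s0 by rewrite /ze; field.
  by rewrite ncM ncV ns invr1 mulr1.
have sze : s = s0 * (1 + ze) by rewrite /ze; field.
pose D := nc (Q.[mu] - t).
have D0 : 0 <= D by exact: nc_ge0.
have eU : U.[mu] = (1 + mu / l0) * (1 + bc * w * (Q.[mu] - t0)).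
  by rewrite /U /eta !hornerE; ring.
have eV : V.[mu] = 1 + v * (Q.[mu] - t0) by rewrite /V /eta !hornerE.
have zS j : z j.+1 = newton k U V (z j) by [].
have z00 : z 0%N = 0 by [].
move: cM hU eU eV {z1} wz zS z00; clearbody z U V => cM hU eU eV wz zS z00.
pose Us := (1 + mu / l0) * (1 + bc * w * (t - t0)).
pose Vs := 1 + v * (t - t0).
have fix1 : Us * (1 + ze) ^+ k = Vs.
  have s0k : s0 ^+ k != 0 by rewrite expf_neq0.
  have e3 : (1 + ze) ^+ k = s ^+ k / s0 ^+ k by rewrite /ze addrC subrK expr_div_n.
  have e4 : t - bc = - ((l0 + mu) * s ^+ k * (bc * t - 1)).
    by apply/eqP; rewrite -addr_eq0 addrC E1.
  have e5 : t0 - bc = - (l0 * s0 ^+ k * (bc * t0 - 1)).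
    by apply/eqP; rewrite -addr_eq0 addrC E0.
  have -> : Vs = (t - bc) / (t0 - bc) by rewrite /Vs /v; field.
  rewrite e3 e4 e5 /Us /w; field.
  by rewrite s0k l00 bt0.
have Uc : wn r ((U.[mu])%:P - 1) <= (1 + r) * (1 + b / (b - 1) * rho) - 1.
  rewrite -polyCB wnC; apply: le_trans hU.
  have -> : U.[mu] - 1 = (U - 1).[mu] by rewrite [RHS]hornerD hornerN -[1 in RHS]/(1%:P) hornerC.
  exact: nc_horner.
pose y j := (z j).[mu].
have yS j : y j.+1 = y j - k%:R^-1 * (U.[mu] * (1 + y j) ^+ k - V.[mu]).
  rewrite /y zS; move: (z j) => zj; rewrite /newton.
  have h1 : (1 : {poly Cx R}).[mu] = 1 by exact: hornerC.
  by rewrite hornerD hornerN hornerM hornerC hornerD hornerN hornerM horner_exp hornerD h1.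
have yb j : nc (y j) <= sg.
  by apply: le_trans (nc_horner r0 _ hmu) _; exact: le_trans (wz j) Msg.
(* The exact root [ze] is fixed by the Newton map built with [t] instead of [Q.[mu]]; replacing one
   by the other costs at most C1 D per step. *)
have es j : nc (y j.+1 - ze) <= k0 * nc (y j - ze) + C1 * D.
  pose TQ (x : Cx R) := x - k%:R^-1 * (U.[mu] * (1 + x) ^+ k - V.[mu]).
  have -> : y j.+1 - ze = (TQ (y j) - TQ ze) + (TQ ze - ze) by rewrite yS -/(TQ (y j)); ring.
  apply: le_trans (le_ncD _ _) _; apply: lerD.
    have h1 : wn r (y j)%:P <= sg by rewrite wnC.
    have h2 : wn r ze%:P <= sg by rewrite wnC.
    have := newton_contract (V.[mu])%:P r0 k1 Uc h1 h2.
    have -> : newton k (U.[mu])%:P (V.[mu])%:P (y j)%:P - newton k (U.[mu])%:P (V.[mu])%:P ze%:P = (TQ (y j) - TQ ze)%:P.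
      by rewrite /newton /TQ !(polyCB, polyCM, polyCD, polyC_exp, polyC1).
    rewrite -polyCB !wnC => h; apply: le_trans h _.
    by rewrite ler_wpM2r ?nc_ge0.
  have -> : TQ ze - ze = - (k%:R^-1 * ((U.[mu] - Us) * (1 + ze) ^+ k - (V.[mu] - Vs))).
    by rewrite /TQ mulrBl fix1; ring.
  rewrite ncN ncM ncV nc_nat ler_pdivrMl//.
  apply: le_trans (_ : C1 * D <= _); last first.
    by rewrite -[leLHS]mul1r ler_wpM2r// mulr_ge0.
  apply: le_trans (le_ncD _ _) _; rewrite ncN ncM /C1 mulrDl; apply: lerD.
    have -> : U.[mu] - Us = (1 + mu / l0) * (bc * w) * (Q.[mu] - t) by rewrite eU /Us; ring.
    rewrite !ncM nw nb -/D.
    have n1 : nc (1 + mu / l0) <= 2.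
      apply: le_trans (le_ncD _ _) _; rewrite nc1 ncM ncV nl invr1 mulr1.
      by apply: lerD => //; exact: le_trans hmu H4.
    have n2 : nc ((1 + ze) ^+ k) <= 2.
      rewrite ncX; apply: le_trans H5; rewrite lerXn2r ?nnegrE ?nc_ge0 ?addr_ge0 ?(ltW sg0)//.
      by apply: le_trans (le_ncD _ _) _; rewrite nc1 lerD2l.
    have n3 : nc (1 + mu / l0) * (b * T^-1) <= 2 * (b / (b - 1)).
      by apply: ler_pM => //; rewrite nc_ge0.
    rewrite -[leLHS]mulrA [leRHS]mulrAC -[leRHS]mulrA.
    apply: ler_pM => //.
    - by rewrite mulr_ge0 ?nc_ge0.
    - by rewrite mulr_ge0 ?nc_ge0.
    - by rewrite ler_wpM2l.
  have -> : V.[mu] - Vs = v * (Q.[mu] - t) by rewrite eV /Vs; ring.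
  rewrite ncM nv -/D mul1r ler_wpM2r// lef_pV2 ?posrE//.
have eb j : nc (y j - ze) <= (1 / 2) ^+ j * sg + 2 * C1 * D.
  elim: j => [|j IH].
    rewrite expr0 mul1r /y z00 horner0 sub0r ncN.
    by rewrite (le_trans nze)// lerDl !mulr_ge0.
  apply: le_trans (es j) _; rewrite exprS.
  have h1 : k0 * nc (y j - ze) <= 1 / 2 * ((1 / 2) ^+ j * sg + 2 * C1 * D).
    by apply: ler_pM => //; exact: nc_ge0.
  apply: le_trans (_ : 1 / 2 * ((1 / 2) ^+ j * sg + 2 * C1 * D) + C1 * D <= _).
    by rewrite lerD2r.
  by rewrite le_eqVlt; apply/orP; left; apply/eqP; field.
have -> : (s0%:P * (1 + z i)).[mu] - s = s0 * (y i - ze) by rewrite !hornerE -/(y i) sze; ring.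
rewrite ncM ns mul1r; apply: le_trans (eb i) _; rewrite -/D lerD2r; exact: ltW.
Qed.

End Step.
End Newton.

(** * The exponential parametrization of the circle *)

Section Expi.
Variable R : realType.
Implicit Types x y : R.

Lemma expiD x y : expi (x + y) = expi x * expi y.
Proof. by rewrite /expi cosD sinD; apply/eqP; rewrite eq_complex /= eqxx /= addrC. Qed.

Lemma expi0 : expi (0 : R) = 1.
Proof. by rewrite /expi cos0 sin0. Qed.

Lemma nc_expi x : nc (expi x) = 1.
Proof. by rewrite nc_def /= cos2Dsin2 sqrtr1. Qed.

Lemma expi_neq0 x : expi x != 0.
Proof. by rewrite -nc_eq0 nc_expi oner_eq0. Qed.

Lemma expiN x : expi (- x) = (expi x)^-1.
Proof. by apply: (mulfI (expi_neq0 x)); rewrite -expiD subrr expi0 mulfV// expi_neq0. Qed.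

Lemma expiMn x n : expi (n%:R * x) = expi x ^+ n.
Proof.
elim: n => [|n IH]; first by rewrite mul0r expi0 expr0.
by rewrite -natr1 mulrDl mul1r expiD IH exprSr.
Qed.

Lemma expiz x (z : int) : expi (x + 2 * pi * z%:~R) = expi x.
Proof. by rewrite /expi cosz sinz. Qed.

Lemma expi_inj x y : expi x = expi y -> exists z : int, x = y + 2 * pi * z%:~R.
Proof.
move=> /eqP; rewrite eq_complex /= => /andP[/eqP h1 /eqP h2].
have s0 : sin ((x - y) / 2) = 0.
  have : cos (x - y) = 1 by rewrite cosB h1 h2 -!expr2 cos2Dsin2.
  rewrite {1}(_ : x - y = ((x - y) / 2) *+ 2); last by rewrite -mulr_natr; field.
  rewrite cos_mulr2n cos2sin2 -mulr_natl => h3; apply/eqP; rewrite -sqrf_eq0; apply/eqP; lra.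
have [j hj] := sin_eq0P s0; exists j; lra.
Qed.

Lemma nc_le (z : Cx R) : nc z <= `|complex.Re z| + `|complex.Im z|.
Proof.
case: z => x y /=; have -> : (x +i* y) = (x%:C : Cx R) + (0 +i* y) :> Cx R.
  by apply/eqP; rewrite eq_complex /= addr0 add0r !eqxx.
rewrite (le_trans (le_ncD _ _))// ncC lerD2l nc_def /= expr0n add0r sqrtr_sqr//.
Qed.

Lemma cos_lip x y : `|cos x - cos y| <= `|x - y|.
Proof.
wlog xy : x y / y < x.
  move=> W; have [h|h|->] := ltgtP y x; last by rewrite !subrr.
    exact: W.
  by rewrite distrC [leRHS]distrC; exact: W.
have [t _ ->] := @MVTd R cos (fun t => - sin t) y x xy (fun t _ => is_derive_cos t).
by rewrite normrM -[leRHS]mul1r ler_wpM2r// normrN sin_max.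
Qed.

Lemma sin_lip x y : `|sin x - sin y| <= `|x - y|.
Proof.
wlog xy : x y / y < x.
  move=> W; have [h|h|->] := ltgtP y x; last by rewrite !subrr.
    exact: W.
  by rewrite distrC [leRHS]distrC; exact: W.
have [t _ ->] := @MVTd R (@sin R) (fun t => cos t) y x xy (fun t _ => is_derive_sin t).
by rewrite normrM -[leRHS]mul1r ler_wpM2r// cos_max.
Qed.

Lemma expi_lip x y : nc (expi x - expi y) <= 2 * `|x - y|.
Proof.
apply: le_trans (nc_le _) _ => /=.
have := cos_lip x y; have := sin_lip x y; lra.
Qed.

End Expi.

(** * Chains of angles as solutions of algebraic equations *)

Section Chain.
Variables (R : realType) (b : R) (d : nat).
Hypotheses (hb : 1 < b).
Implicit Types x y th al : R.
Local Notation Phi := (Phi b).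
Local Notation bc := (b%:C : Cx R).

Lemma bexpi_Nsq x : nc (bc * expi x + 1) ^+ 2 = Nsq b x.
Proof.
have h := cos2Dsin2 x.
rewrite nc_sqr /= /Nsq !mul0r subr0 !addr0.
have -> : (b * cos x + 1) ^+ 2 + (b * sin x) ^+ 2 = b ^+ 2 * (cos x ^+ 2 + sin x ^+ 2) + 1 + 2 * b * cos x by ring.
by rewrite h mulr1.
Qed.

Lemma bexpi_neq0 x : bc * expi x + 1 != 0.
Proof.
rewrite -nc_eq0 -sqrf_eq0 bexpi_Nsq gt_eqF// Nsq_gt0//.
Qed.

(** After division by h = e^(ix/2), numerator and denominator are complex conjugates, and [sin_Gam2]
    gives the argument of the denominator as [Gam b x / 2]. *)
Lemma mobius_expi x : (expi x + bc) / (bc * expi x + 1) = expi (- Gam b x).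
Proof.
have [s1 c1] := sin_Gam2 hb x.
set N := Num.sqrt _ in s1 c1.
have N0 : N != 0 by rewrite sqrtr_eq0 -ltNge Nsq_gt0.
pose h : Cx R := expi (x / 2).
have hx : expi x = h ^+ 2 by rewrite -expiMn; congr expi; field.
have h0 : h != 0 by exact: expi_neq0.
have hV : h^-1 = expi (- (x / 2)) by rewrite expiN.
have E1 : h + bc * h^-1 = (N%:C : Cx R) * expi (- (Gam b x / 2)).
  rewrite hV /h /expi !cosN !sinN s1 c1; apply/eqP; rewrite eq_complex /=.
  by apply/andP; split; apply/eqP; field.
have E2 : bc * h + h^-1 = (N%:C : Cx R) * expi (Gam b x / 2).
  rewrite hV /h /expi !cosN !sinN s1 c1; apply/eqP; rewrite eq_complex /=.
  by apply/andP; split; apply/eqP; field.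
have NC : (N%:C : Cx R) != 0 by rewrite -nc_eq0 ncC normr_eq0.
have -> : (expi x + bc) / (bc * expi x + 1) = (h + bc * h^-1) / (bc * h + h^-1).
  have n1 : h ^+ 2 + bc = h * (h + bc * h^-1) by field.
  have n2 : bc * h ^+ 2 + 1 = h * (bc * h + h^-1) by field.
  by rewrite hx n1 n2 -mulf_div mulfV// mul1r.
by rewrite E1 E2 -mulf_div mulfV// mul1r -expiN -expiD; congr expi; field.
Qed.

Lemma fising_expi (k : nat) th x : fising b k (expi th) (expi x) = expi (Phi k th x).
Proof.
rewrite /fising mobius_expi -expiMn -expiD; congr expi; rewrite /Phi; ring.
Qed.

(** One step in the variable s = e^(-i Gam x) rather than e^(ix): the earlier point enters only
    through its k-th power, so going backwards amounts to extracting a k-th root near a known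
    value. *)
Lemma chain_rel (k : nat) th x : expi th * expi (- Gam b x) ^+ k *
    (bc * expi (- Gam b (Phi k th x)) - 1) + (expi (- Gam b (Phi k th x)) - bc) = 0.
Proof.
have -> : expi th * expi (- Gam b x) ^+ k = expi (Phi k th x).
  by rewrite -expiMn -expiD; congr expi; rewrite /Phi; ring.
rewrite -mobius_expi; have h := bexpi_neq0 (Phi k th x).
by field.
Qed.

(** Hence (b^2 - 1) / |s - b|^2 = 1 / [dGam b x] for s = e^(-i Gam x), which turns the derivative in
    [newton_step] into the quantities governed by [weights]. *)
Lemma nc_mobius x : nc (expi (- Gam b x) - bc) ^+ 2 = (b ^+ 2 - 1) ^+ 2 / Nsq b x.
Proof.
rewrite -mobius_expi; have h := bexpi_neq0 x.
have -> : (expi x + bc) / (bc * expi x + 1) - bc = ((1 - b ^+ 2)%:C : Cx R) * expi x / (bc * expi x + 1).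
  have -> : ((1 - b ^+ 2)%:C : Cx R) = 1 - bc ^+ 2 by rewrite rmorphB rmorphXn rmorph1.
  by field.
rewrite !ncM ncV nc_expi mulr1 exprMn exprVn bexpi_Nsq ncC real_normK ?num_real//.
by congr (_ / _); ring.
Qed.

(** Backward induction with [newton_step]. The radius [r] and the bound [M] depend neither on the
    length [N] nor on the precision [dl], as Vitali's theorem requires. *)
Lemma poly_shadow (e : nat -> nat) al (Y : nat -> R) c1 w0 w1 kap : letters d e ->
  (forall n, Y n.+1 = Phi (e n) al (Y n)) -> weights b e Y c1 w0 w1 kap ->
  exists rho2 r M : R, [/\ 0 < rho2, 0 < r & forall N dl, 0 < dl ->
  exists2 P : {poly Cx R}, wn r P <= M &
  forall th (Z : nat -> R), nc (expi th - expi al) <= r -> Z N = Y N ->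
  (forall n, (n < N)%N -> Z n.+1 = Phi (e n) th (Z n)) ->
  (forall n, (n <= N)%N -> `|Z n - Y n| <= rho2) ->
  nc (P.[expi th - expi al] - expi (- Gam b (Z 0%N))) <= dl].
Proof.
move=> he hY [c11 w00 hk hw]; have hb1 := hb.
pose c := (1 + c1) / 2.
have c1c : 1 < c by rewrite /c; lra.
have cc1 : c < c1 by rewrite /c; lra.
have c10 : 0 < c1 by lra.
have c0 : 0 < c by lra.
have [sg [e1 [C2 [sg0 e10 C20 H]]]] := @newton_step R b c d hb c1c.
pose g0 := (b - 1) / (b + 1); pose g1 := (b + 1) / (b - 1).
have g00 : 0 < g0 by apply: divr_gt0; lra.
have g10 : 0 < g1 by apply: divr_gt0; lra.
have w10 : 0 < w1 by have /andP[h1 h2] := hk 0%N; exact: lt_le_trans (le_trans h1 h2).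
(* The weight of the coordinate Gam x, in which [newton_step] works, instead of x. *)
pose w n := kap n / dGam b (Y n).
pose v0 := w0 / g1; pose v1 := w1 / g0.
have v00 : 0 < v0 by rewrite divr_gt0.
have v10 : 0 < v1 by rewrite divr_gt0.
have wv n : v0 <= w n <= v1.
  have /andP[k0 k1] := hk n; have /andP[d1 d2] := dGam_bounds hb (Y n).
  have d0 := dGam_gt0 hb (Y n).
  apply/andP; split; apply: ler_pM => //; rewrite ?invr_ge0 ?(ltW w00) ?(ltW g10) ?(ltW d0)//.
  - by rewrite lef_pV2 ?posrE.
  - by rewrite (le_trans (ltW w00)).
  - by rewrite lef_pV2 ?posrE.
have wp n : 0 < w n by have /andP[h _] := wv n; exact: lt_le_trans h.
pose rho := e1 * v0.
have rho0 : 0 < rho by rewrite mulr_gt0.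
have rw n : 0 <= rho / w n <= e1.
  rewrite divr_ge0 ?(ltW rho0) ?(ltW (wp n))//= ler_pdivrMr// ler_pM2l//.
  by have /andP[] := wv n.
have cc : 0 < 1 - c / c1 by rewrite subr_gt0 ltr_pdivrMr// mul1r.
(* Small enough for the cost 2 c r of moving the parameter to fit into the fraction 1 - c / c1 of
   the smallest window, rho / v1. *)
pose r := Num.min e1 ((1 - c / c1) * (rho / v1) / (2 * c)).
have r0 : 0 < r.
  rewrite lt_min e10 /= divr_gt0//; first by rewrite mulr_gt0// divr_gt0.
  by rewrite mulr_gt0.
have re : 0 <= r <= e1 by rewrite (ltW r0) ge_min lexx.
have rr : r <= (1 - c / c1) * (rho / v1) / (2 * c) by rewrite ge_min lexx orbT.
pose rho2 := sg / (2 * g1).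
have rho20 : 0 < rho2 by rewrite divr_gt0// mulr_gt0.
pose s n : Cx R := expi (- Gam b (Y n)).
have glip x y : `|Gam b x - Gam b y| <= g1 * `|x - y|.
  wlog xy : x y / y < x.
    move=> W; have [h|h|->] := ltgtP y x; last by rewrite !subrr normr0 mulr0.
      exact: W.
    by rewrite distrC [X in _ <= _ * X]distrC; exact: W.
  have [t _ ->] := @MVTd R (Gam b) (dGam b) y x xy (fun t _ => is_derive_Gam hb t).
  rewrite normrM ler_wpM2r// gtr0_norm ?dGam_gt0//.
  by have /andP[] := dGam_bounds hb t.
exists rho2, r, (e1 + 1); split => // N dl dl0.
have ind j : (j <= N)%N -> forall dl, 0 < dl -> exists2 P : {poly Cx R},
    wn r (P - (s (N - j)%N)%:P) <= rho / w (N - j)%N &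
    forall th (Z : nat -> R), nc (expi th - expi al) <= r -> Z N = Y N ->
    (forall n, (n < N)%N -> Z n.+1 = Phi (e n) th (Z n)) ->
    (forall n, (n <= N)%N -> `|Z n - Y n| <= rho2) ->
    nc (P.[expi th - expi al] - expi (- Gam b (Z (N - j)%N))) <= dl.
  elim: j => [_ {}dl {}dl0|j IH jN {}dl {}dl0].
    exists (s N)%:P; first by rewrite subn0 subrr -[0]/(0%:P) wnC nc0; have /andP[] := rw N.
    by move=> th Z _ ZN _ _; rewrite subn0 hornerC ZN /s subrr nc0 ltW.
  set n := (N - j.+1)%N.
  have En : (N - j)%N = n.+1 by rewrite /n subnSK.
  have nN : (n < N)%N by rewrite /n ltn_subrL /= (leq_ltn_trans _ jN).
  have C21 : 0 < 2 * (C2 + 1) by rewrite mulr_gt0// ltr_wpDl.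
  have [Q hQ1 hQ2] := IH (ltnW jN) (dl / (2 * (C2 + 1))) ltac:(by rewrite divr_gt0).
  rewrite En in hQ1 hQ2.
  have E0 : expi al * s n ^+ e n * (bc * s n.+1 - 1) + (s n.+1 - bc) = 0.
    by rewrite /s hY; exact: chain_rel.
  have [P [hP1 hP2]] := H (e n) (s n) (s n.+1) (expi al) (rho / w n.+1) r Q (he n)
    (nc_expi _) (nc_expi _) (nc_expi _) E0 (rw _) re hQ1 (dl / 2) ltac:(by rewrite divr_gt0).
  exists P.
    apply: le_trans hP1 _.
    have d0 := dGam_gt0 hb (Y n); have d0' := dGam_gt0 hb (Y n.+1).
    have kn := lt_le_trans w00 (andP (hk n)).1; have kn' := lt_le_trans w00 (andP (hk n.+1)).1.
    have en : (0 : R) < (e n)%:R by rewrite ltr0n; case/andP: (he n).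
    have N0 := Nsq_gt0 hb (Y n.+1).
    have b2 := b2_gt1 hb.
    have -> : (b ^+ 2 - 1) / nc (s n.+1 - bc) ^+ 2 / (e n)%:R * (rho / w n.+1) = rho / ((e n)%:R * kap n.+1).
      rewrite nc_mobius /w /dGam; field.
      by rewrite !gt_eqF.
    have h1 : rho / ((e n)%:R * kap n.+1) <= rho / w n / c1.
      have p1 : 0 < (e n)%:R * kap n.+1 by exact: mulr_gt0.
      have p2 : 0 < w n * c1 by apply: mulr_gt0 => //; exact: wp.
      rewrite -[leRHS]mulrA ler_pM2l// -invfM lef_pV2 ?posrE//.
      by rewrite /w mulrAC ler_pdivrMr// mulrC (le_trans (hw n))// mulrAC.
    have h2 : 2 * c * r <= (1 - c / c1) * (rho / w n).
      apply: le_trans (_ : (1 - c / c1) * (rho / v1) <= _).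
        by rewrite mulrC -ler_pdivlMr// mulr_gt0.
      rewrite ler_pM2l// ler_pM2l// lef_pV2 ?posrE//.
      by have /andP[] := wv n.
    have h3 : c * (rho / ((e n)%:R * kap n.+1)) <= c * (rho / w n / c1) by apply: ler_wpM2l h1; exact: ltW.
    rewrite mulrDr; set A := rho / w n in h2 h3 *.
    have E : c * (A / c1) = c / c1 * A by rewrite mulrA mulrAC.
    have E' : c * (2 * r) = 2 * c * r by ring.
    rewrite E in h3; rewrite E' mulrBl mul1r in h2 *.
    apply: le_trans (lerD h3 h2) _; rewrite addrC subrK//.
  move=> th Z hth ZN hZ hZY.
  have hr : nc (expi (- Gam b (Z n)) - s n) <= sg.
    apply: le_trans (expi_lip _ _) _.
    have -> : `|- Gam b (Z n) - - Gam b (Y n)| = `|Gam b (Z n) - Gam b (Y n)|.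
      by rewrite -opprD normrN.
    have := glip (Z n) (Y n) => h1.
    have h2 : g1 * `|Z n - Y n| <= g1 * rho2 by rewrite ler_pM2l// hZY// ltnW.
    have h3 : 2 * (g1 * rho2) = sg by rewrite /rho2; field; rewrite gt_eqF.
    lra.
  have rel : (expi al + (expi th - expi al)) * expi (- Gam b (Z n)) ^+ e n *
      (bc * expi (- Gam b (Z n.+1)) - 1) + (expi (- Gam b (Z n.+1)) - bc) = 0.
    by rewrite (addrC (expi al)) subrK hZ//; exact: chain_rel.
  apply: le_trans (hP2 _ _ _ hth hr rel) _.
  have h4 := hQ2 th Z hth ZN hZ hZY.
  have h5 : C2 * nc (Q.[expi th - expi al] - expi (- Gam b (Z n.+1))) <= C2 * (dl / (2 * (C2 + 1))).
    by rewrite ler_wpM2l.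
  have h6 : C2 * (dl / (2 * (C2 + 1))) <= dl / 2.
    rewrite mulrCA ler_pM2l// ler_pdivrMr// mulrC ler_pdivlMr//; lra.
  apply: le_trans (lerD (lexx _) (le_trans h5 h6)) _; by rewrite -splitr.
have [P hP1 hP2] := ind N (leqnn N) dl dl0.
rewrite subnn in hP1 hP2.
exists P => //.
rewrite -[P](subrK (s 0%N)%:P); apply: le_trans (wnD (ltW r0) _ _) _.
by rewrite wnC nc_expi lerD2r (le_trans hP1)//; have /andP[] := rw 0%N.
Qed.

End Chain.

(** * Continuation in the parameter *)

Section Core.
Variables (R : realType) (b : R) (d : nat).
Hypotheses (hb : 1 < b) (hd : (2 <= d)%N).
Implicit Types x y th al e eta del : R.
Local Notation Phi := (Phi b).
Local Notation dyn := (dyn b d).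
Local Notation F2 th := (fun x => Phi d th (Phi d th x)).
Local Notation X := (X b).

Let g0 := (b - 1) / (b + 1).
Let g1 := (b + 1) / (b - 1).

Lemma g1_gt0 : 0 < g1.
Proof. have h := hb; apply: divr_gt0; lra. Qed.

Lemma g0_gt0 : 0 < g0.
Proof. have h := hb; apply: divr_gt0; lra. Qed.

Lemma Gam_lip x y : `|Gam b x - Gam b y| <= g1 * `|x - y|.
Proof.
wlog xy : x y / y < x.
  move=> W; have [h|h|->] := ltgtP y x; last by rewrite !subrr normr0 mulr0.
    exact: W.
  by rewrite distrC [X in _ <= _ * X]distrC; exact: W.
have [t _ ->] := @MVTd R (Gam b) (dGam b) y x xy (fun t _ => is_derive_Gam hb t).
rewrite normrM ler_wpM2r// gtr0_norm ?dGam_gt0//.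
by have /andP[] := dGam_bounds hb t.
Qed.

Lemma Gam_lip_ge x y : g0 * `|x - y| <= `|Gam b x - Gam b y|.
Proof.
wlog xy : x y / y < x.
  move=> W; have [h|h|->] := ltgtP y x; last by rewrite !subrr normr0 mulr0.
    exact: W.
  by rewrite distrC [X in _ <= X]distrC; exact: W.
have [t _ ->] := @MVTd R (Gam b) (dGam b) y x xy (fun t _ => is_derive_Gam hb t).
rewrite normrM ler_wpM2r// gtr0_norm ?dGam_gt0//.
by have /andP[] := dGam_bounds hb t.
Qed.

Lemma Phi_lip (k : nat) th x y : `|Phi k th x - Phi k th y| <= k%:R * g1 * `|x - y|.
Proof.
by rewrite PhiB normrM normr_nat -mulrA ler_wpM2l// distrC Gam_lip.
Qed.

Lemma Phi1k_lip (k : nat) th th' x y :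
  `|Phi 1 th (Phi k th x) - Phi 1 th' (Phi k th' y)| <=
  (1 + g1) * `|th - th'| + g1 * (k%:R * g1) * `|x - y|.
Proof.
have g10 := g1_gt0.
have -> : Phi 1 th (Phi k th x) - Phi 1 th' (Phi k th' y) =
  (th - th') - (Gam b (Phi k th x) - Gam b (Phi k th' y)) by rewrite {1 3}/Phi; ring.
apply: le_trans (ler_normB _ _) _.
have h1 := Gam_lip (Phi k th x) (Phi k th' y).
have h2 : `|Phi k th x - Phi k th' y| <= `|th - th'| + k%:R * g1 * `|x - y|.
  have -> : Phi k th x - Phi k th' y = (th - th') + (Phi k th x - Phi k th y) by rewrite /Phi; ring.
  by apply: le_trans (ler_normD _ _) _; rewrite lerD2l Phi_lip.
have h3 : g1 * `|Phi k th x - Phi k th' y| <= g1 * (`|th - th'| + k%:R * g1 * `|x - y|) by rewrite ler_pM2l.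
move: h1 h2 h3; set u := `|_|; set v := `|Phi _ _ _ - _|; set w := `|th - th'|; set t := `|x - y|.
rewrite mulrDr; lra.
Qed.

Lemma finite_margin n (f : nat -> R) : (forall k, (k < n)%N -> 0 < f k) ->
  exists2 e : R, 0 < e & forall k, (k < n)%N -> e <= f k.
Proof.
elim: n => [|n IH] H; first by exists 1.
have [|e e0 He] := IH; first by move=> k kn; apply: H; exact: leqW.
exists (Num.min e (f n)); first by rewrite lt_min e0 H.
move=> k; rewrite ltnS leq_eqVlt => /orP[/eqP->|kn]; rewrite ge_min ?lexx ?orbT//.
by rewrite He.
Qed.

Lemma lt_fix th p a q x : dyn th p a q -> x < Phi d th x -> x < a.
Proof.
move=> [_ [[ea _ _] _]] h; rewrite ltNge; apply/negP => ax.
have : Phi d th x <= Phi d th a by rewrite Phi_le// (d1 hd).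
rewrite ea => h2; lra.
Qed.

Lemma gt_fix th p a q x : dyn th p a q -> Phi d th x < x -> a < x.
Proof.
move=> [_ [[ea _ _] _]] h; rewrite ltNge; apply/negP => ax.
have : Phi d th a <= Phi d th x by rewrite Phi_le// (d1 hd).
rewrite ea => h2; lra.
Qed.

Lemma dyn_lt th p a q x : dyn th p a q -> x < a -> x < Phi d th x.
Proof.
move=> [_ [[ea _ _] _]] h.
have : Phi d th a < Phi d th x by rewrite Phi_lt// (d1 hd).
rewrite ea; lra.
Qed.

Variables (th0 th2 : R) (P A Q : R -> R).
Hypothesis hdyn : forall th, th0 <= th < th2 -> dyn th (P th) (A th) (Q th).
Hypothesis hP0 : P th0 = 0.
Hypothesis hPpos : forall th, th0 < th < th2 -> 0 < P th.
Hypothesis hinv : forall th, th0 <= th < th2 -> forall k, (1 <= k < d)%N ->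
  forall x, P th <= x <= Q th -> P th < Phi 1 th (Phi k th x) < Q th.

Lemma near_pos (f : R -> R) th : continuous f -> 0 < f th ->
  exists2 e : R, 0 < e & forall th', `|th' - th| < e -> 0 < f th'.
Proof.
move=> cf f0; have [e e0 H] := cvg_pos (cf th) f0; exists e => // th' h; apply: H.
by move: h; rewrite ltr_norml => /andP[? ?]; apply/andP; split; lra.
Qed.

Lemma continuous_Phi_th (k : nat) x : continuous (fun th => Phi k th x).
Proof. by apply: (continuous_PhiX hb) => t; exact: cvg_cst. Qed.

Lemma continuous_F2_th x : continuous (fun th => F2 th x).
Proof. by apply: (continuous_PhiX hb); exact: continuous_Phi_th. Qed.

(** The endpoint p is enclosed between x1 and x2 by strict inequalities on f_d and f_d o f_d at
    these two points, and such inequalities persist for nearby parameters. *)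
Lemma contP th e : th0 <= th < th2 -> 0 < e -> exists2 del : R, 0 < del &
  forall th', th0 <= th' < th2 -> `|th' - th| < del -> `|P th' - P th| < e.
Proof.
move=> hth e0; have D := hdyn hth.
pose e' := Num.min e ((A th - P th) / 2).
have [[p0 pa aq qt tp] [[ea ep eq] [H1 H2 H3 H4]]] := D.
have e'0 : 0 < e' by rewrite lt_min e0 /=; lra.
have e'e : e' <= e by rewrite ge_min lexx.
have e'a : e' <= (A th - P th) / 2 by rewrite ge_min lexx orbT.
pose x1 := P th - e'; pose x2 := P th + e'.
have x1p : x1 < P th by rewrite /x1; lra.
have x2a : x2 < A th by rewrite /x2; lra.
have cB (f g : R -> R) : continuous f -> continuous g -> continuous (fun t => f t - g t).
  by move=> cf cg t; apply: cvgB; [exact: cf|exact: cg].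
have cc x : continuous (fun _ : R => x) by move=> t; exact: cvg_cst.
have [d1 d10 E1] := @near_pos (fun t => x1 - F2 t x1) th (cB _ _ (cc x1) (@continuous_F2_th x1))
  ltac:(by rewrite subr_gt0; exact: H1).
have [d2 d20 E2] := @near_pos (fun t => F2 t x2 - x2) th (cB _ _ (@continuous_F2_th x2) (cc x2))
  ltac:(by rewrite subr_gt0; apply: H2; rewrite x2a andbT /x2; lra).
have [d3 d30 E3] := @near_pos (fun t => Phi d t x2 - x2) th (cB _ _ (@continuous_Phi_th d x2) (cc x2))
  ltac:(by rewrite subr_gt0; exact: (dyn_lt D)).
have [d4 d40 E4] := @near_pos (fun t => Phi d t x1 - x1) th (cB _ _ (@continuous_Phi_th d x1) (cc x1))
  ltac:(by rewrite subr_gt0; apply: (dyn_lt D); exact: lt_trans pa).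
exists (Num.min (Num.min d1 d2) (Num.min d3 d4)); first by rewrite !lt_min d10 d20 d30 d40.
move=> th' hth'; rewrite !lt_min => /andP[/andP[l1 l2] /andP[l3 l4]].
have D' := hdyn hth'.
have [_ [[ea' ep' eq'] [H1' H2' H3' H4']]] := D'.
have := E1 _ l1; have := E2 _ l2; have := E3 _ l3; have := E4 _ l4.
rewrite !subr_gt0 => k4 k3 k2 k1.
have a1 := lt_fix D' k4; have a2 := lt_fix D' k3.
have b1 : x1 < P th'.
  have [//|h|h] := ltgtP x1 (P th').
    by have := H2' x1; rewrite h a1 => /(_ isT); lra.
  by move: k1; rewrite h ep' eq' ltxx.
have b2 : P th' < x2.
  have [//|h|h] := ltgtP (P th') x2.
    by have := H1' x2 h; lra.
  by move: k2; rewrite -h ep' eq' ltxx.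
rewrite ltr_norml; move: b1 b2; rewrite /x1 /x2 => b1 b2; apply/andP; split; lra.
Qed.

Lemma contPQ th e : th0 <= th < th2 -> 0 < e -> exists2 del : R, 0 < del &
  forall th', th0 <= th' < th2 -> `|th' - th| < del -> `|P th' - P th| < e /\ `|Q th' - Q th| < e.
Proof.
move=> hth e0; have g10 := g1_gt0.
have d0 : (0 : R) < d%:R by rewrite ltr0n (d1 hd).
pose e' := Num.min e (e / 2 / (d%:R * g1)).
have e'0 : 0 < e' by rewrite lt_min e0 !divr_gt0// mulr_gt0.
have [del del0 H] := contP hth e'0.
exists (Num.min del (e / 2)); first by rewrite lt_min del0 divr_gt0.
move=> th' hth'; rewrite lt_min => /andP[h1 h2].
have h3 := H th' hth' h1.
split; first by apply: lt_le_trans h3 _; rewrite ge_min lexx.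
have [_ [[_ ep _] _]] := hdyn hth; have [_ [[_ ep' _] _]] := hdyn hth'.
have -> : Q th' - Q th = (th' - th) + (Phi d th (P th') - Phi d th (P th)) by rewrite -ep -ep' /Phi; ring.
apply: le_lt_trans (ler_normD _ _) _.
have h4 := Phi_lip d th (P th') (P th).
have h5 : d%:R * g1 * `|P th' - P th| < e / 2.
  rewrite mulrC -ltr_pdivlMr; last exact: mulr_gt0.
  by apply: lt_le_trans h3 _; rewrite ge_min lexx orbT.
move: h2 h4 h5; set u := `|th' - th|; set v := `|P th' - P th|; lra.
Qed.

(* The trap [A0, B0] is slightly smaller than the invariant arc and serves all
   parameters near [al]. *)
Lemma trap_exists al : th0 <= al < th2 -> exists A0 B0 A1 B1 eta : R, [/\ 0 < eta,
  P al < A0, B0 < Q al, A0 < B0 &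
  forall th, th0 <= th < th2 -> `|th - al| <= eta ->
  [/\ trap b d th A0 B0 A1 B1, P th < A0 < A th /\ A th < B0 < Q th &
      forall k, (1 <= k < d)%N -> forall x, P th <= x <= Q th -> A0 <= Phi 1 th (Phi k th x) <= B0]].
Proof.
move=> hal; have D := hdyn hal; have g10 := g1_gt0.
have [[p0 pa aq qt tp] [[ea ep eq] [H1 H2 H3 H4]]] := D.
set p := P al in p0 pa ep eq H1 H2 *; set a := A al in pa aq ea H2 H3 *; set q := Q al in aq qt ep eq H3 H4 *.
have d0 : (0 : R) < d%:R by rewrite ltr0n (d1 hd).
(* A margin common to the finitely many k with which f_1 o f_k maps the closed arc inside itself. *)
have [e0 e00 He0] : exists2 e : R, 0 < e & forall k, (1 <= k < d)%N ->
   p + 2 * e <= Phi 1 al (Phi k al p) /\ Phi 1 al (Phi k al q) <= q - 2 * e.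
  pose f k := if (1 <= k)%N then Num.min (Phi 1 al (Phi k al p) - p) (q - Phi 1 al (Phi k al q)) else 1.
  have [|e e0 He] := @finite_margin d f.
    move=> k kd; rewrite /f; case: ifP => // k1.
    have hk : (1 <= k < d)%N by rewrite k1 kd.
    have /andP[i1 i2] := hinv hal hk (x := p) ltac:(rewrite -/p -/q; apply/andP; split; lra).
    have /andP[i3 i4] := hinv hal hk (x := q) ltac:(rewrite -/p -/q; apply/andP; split; lra).
    by rewrite lt_min !subr_gt0 i1 i4.
  exists (e / 2); first by rewrite divr_gt0.
  move=> k /andP[k1 kd]; have := He k kd; rewrite /f k1 le_min => /andP[h1 h2]; split; lra.
have [e1 e10 He1] : exists2 e : R, 0 < e & forall x, p - e < x < p + e -> 0 < Phi d al x - (q - e0).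
  apply: (@cvg_pos R (fun x => Phi d al x - (q - e0))).
    by apply: cvgB; [exact: continuous_Phi|exact: cvg_cst].
  rewrite ep; lra.
(* Take [C0] slightly above p, let [B0] be its image under f_d and choose [A0] between [C0] and its
   second image. Then f_d sends [A0] below [B0] and [B0] above [A0], both strictly. *)
pose C0 : R := Num.min (p + e0 / 2) (Num.min (p + e1 / 2) ((p + a) / 2)).
have C0p : p < C0 by rewrite !lt_min; apply/and3P; split; lra.
have C0e : C0 <= p + e0 / 2 by rewrite ge_min lexx.
have C0e1 : C0 <= p + e1 / 2 by rewrite !ge_min lexx orbT.
have C0a : C0 <= (p + a) / 2 by rewrite !ge_min lexx !orbT.
have FC : C0 < F2 al C0 by apply: H2; apply/andP; split; lra.
pose B0 := Phi d al C0.
have B0q : B0 < q by rewrite /B0 -ep Phi_lt// (d1 hd).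
have B0e : q - e0 < B0 by have := He1 C0 ltac:(apply/andP; split; lra); rewrite -/B0; lra.
have aB0 : a < B0 by rewrite /B0 -{1}ea Phi_lt ?(d1 hd)//; lra.
pose A0 : R := (C0 + Num.min (F2 al C0) (Num.min a (p + e0))) / 2.
have m1 : C0 < Num.min (F2 al C0) (Num.min a (p + e0)) by rewrite !lt_min FC; apply/andP; split; lra.
have m2 : Num.min (F2 al C0) (Num.min a (p + e0)) <= F2 al C0 by rewrite ge_min lexx.
have m3 : Num.min (F2 al C0) (Num.min a (p + e0)) <= a by rewrite !ge_min lexx orbT.
have m4 : Num.min (F2 al C0) (Num.min a (p + e0)) <= p + e0 by rewrite !ge_min lexx !orbT.
have A0C : C0 < A0 by rewrite /A0; lra.
have A0F : A0 < Phi d al B0 by rewrite /A0 /B0; lra.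
have A0a : A0 < a by rewrite /A0; lra.
have A0e : A0 <= p + e0 by rewrite /A0; lra.
have FA : Phi d al A0 < B0 by rewrite /B0 Phi_lt// (d1 hd).
have A0A : A0 < Phi d al A0 by exact: (dyn_lt D).
have B0B : Phi d al B0 < B0.
  have : Phi d al B0 < Phi d al a by rewrite Phi_lt// (d1 hd).
  rewrite ea; lra.
clearbody A0 B0.
pose e3 := Num.min e0 (Num.min (Phi d al A0 - A0) (B0 - Phi d al B0)).
have e30 : 0 < e3 by rewrite !lt_min e00 !subr_gt0 A0A B0B.
have [e31 e32 e33] : [/\ e3 <= e0, e3 <= Phi d al A0 - A0 & e3 <= B0 - Phi d al B0].
  by rewrite !ge_min !lexx !orbT.
(* A quarter of the smallest margin; the target arc of the trap is [A0 + h, B0 - h]. *)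
pose h : R := Num.min (Num.min (Phi d al B0 - A0) (B0 - Phi d al A0)) (Num.min e3 (B0 - A0)) / 4.
have hh (x y z t : R) : 0 < x -> 0 < y -> 0 < z -> 0 < t ->
   let m := Num.min (Num.min x y) (Num.min z t) / 4 in [/\ 0 < m, 4 * m <= x, 4 * m <= y & (4 * m <= z) /\ 4 * m <= t].
  move=> x0 y0 z0 t0 m; have E : 4 * m = Num.min (Num.min x y) (Num.min z t) by rewrite /m; field.
  split; [|by rewrite E !ge_min lexx|by rewrite E !ge_min lexx !orbT|split].
  - by rewrite divr_gt0// !lt_min x0 y0 z0 t0.
  - by rewrite E !ge_min lexx !orbT.
  - by rewrite E !ge_min lexx !orbT.
have [h0 hx hy [hz ht]] := hh (Phi d al B0 - A0) (B0 - Phi d al A0) e3 (B0 - A0) ltac:(lra) ltac:(lra) e30 ltac:(lra).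
rewrite -/h in h0 hx hy hz ht; clearbody h e3.
have dg0 : 0 < g1 * (d%:R * g1) by apply: mulr_gt0 => //; exact: mulr_gt0.
have [h' h'0 [h'1 h'2 h'3]] : exists2 h' : R, 0 < h' & [/\ h' <= A0 - p, h' <= q - B0 & g1 * (d%:R * g1) * h' <= h].
  exists (Num.min (Num.min (A0 - p) (q - B0)) (h / (g1 * (d%:R * g1)))).
    by rewrite !lt_min !subr_gt0 B0q divr_gt0// andbT andbT; lra.
  split; rewrite ?ge_min ?lexx ?orbT//.
  by rewrite mulrC -ler_pdivlMr// !ge_min lexx orbT.
have [del del0 Hdel] := contPQ hal h'0.
have [h'' h''0 [h''1 h''2 h''3]] : exists2 h'' : R, 0 < h'' & [/\ h'' < del, h'' <= h & (1 + g1) * h'' <= h].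
  have G : 0 < 1 + g1 by lra.
  exists (Num.min (del / 2) (h / (1 + g1))); first by rewrite lt_min !divr_gt0.
  split.
  - by rewrite gt_min; apply/orP; left; lra.
  - rewrite ge_min; apply/orP; right.
    by rewrite ler_pdivrMr// mulrDr mulr1 lerDl mulr_ge0// ltW.
  - by rewrite mulrC -ler_pdivlMr// ge_min lexx orbT.
exists A0, B0, (A0 + h), (B0 - h), h''; split; [exact: h''0|exact: lt_trans C0p A0C|exact: B0q|exact: lt_trans A0a aB0|].
move=> th hth thal.
have [hp hq] := Hdel th hth (le_lt_trans thal h''1).
rewrite -/p in hp; rewrite -/q in hq.
clear H1 H2 H3 H4 He1 C0p C0e C0e1 C0a FC m1 m2 m3 m4 A0C hh Hdel del0 h''0 h''1 dg0 e30 pa aq ea D hal.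
have Pd x : Phi d th x = Phi d al x + (th - al) by rewrite /Phi; ring.
have thal2 : (1 + g1) * `|th - al| <= h.
  by apply: le_trans h''3; rewrite ler_wpM2l//; lra.
have kl k x y : (1 <= k < d)%N -> `|x - y| <= h' -> `|Phi 1 th (Phi k th x) - Phi 1 al (Phi k al y)| <= 2 * h.
  move=> /andP[k1 kd] xy; apply: le_trans (Phi1k_lip _ _ _ _ _) _.
  have : g1 * (k%:R * g1) * `|x - y| <= h.
    apply: le_trans h'3; apply: ler_pM => //; first by apply: mulr_ge0; [exact: ltW|apply: mulr_ge0 => //; exact: ltW].
    by rewrite ler_pM2l// ler_pM2r// ler_nat ltnW.
  by move: thal2; clear - hb hd hdyn hP0 hPpos hinv; lra.
have mon k x y : (1 <= k)%N -> x <= y -> Phi 1 th (Phi k th x) <= Phi 1 th (Phi k th y).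
  by move=> k1 xy; rewrite Phi_le// Phi_le.
have mona k x y : (1 <= k)%N -> x <= y -> Phi 1 al (Phi k al x) <= Phi 1 al (Phi k al y).
  by move=> k1 xy; rewrite Phi_le// Phi_le.
have thal3 : - h <= th - al <= h.
  by rewrite -ler_norml (le_trans thal).
have D' := hdyn hth.
move: hp hq; rewrite !ltr_norml => /andP[hp1 hp2] /andP[hq1 hq2].
split.
- split; first by split; clear - hb hd hdyn hP0 hPpos hinv h0 ht B0q qt tp p0 h'0 h'1; have := pi_gt0 R; lra.
  split; rewrite ?Pd; try by clear - hb hd hdyn hP0 hPpos hinv thal3 hx hy; lra.
  move=> k hk; have /andP[k1 kd] := hk; have [E1 E2] := He0 k hk.
  have := kl k A0 A0 hk; have := kl k B0 B0 hk; rewrite !subrr normr0 => /(_ (ltW h'0)) + /(_ (ltW h'0)).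
  rewrite !ler_norml => /andP[s1 s2] /andP[s3 s4].
  have pA0 : p <= A0 by clear - hb hd hdyn hP0 hPpos hinv h'0 h'1; lra.
  have := mona k p A0 k1 pA0; have := mona k B0 q k1 (ltW B0q).
  by clear - hb hd hdyn hP0 hPpos hinv s1 s2 s3 s4 E1 E2 A0e B0e hz e31; split; lra.
- have aA : A0 < A th by apply: (lt_fix D'); rewrite Pd; clear - hb hd hdyn hP0 hPpos hinv thal3 h0 hz e32; lra.
  have aB : A th < B0 by apply: (gt_fix D'); rewrite Pd; clear - hb hd hdyn hP0 hPpos hinv thal3 h0 hz e33; lra.
  by rewrite aA aB; clear - hb hd hdyn hP0 hPpos hinv hp2 hq1 h'1 h'2; split; [rewrite andbT|rewrite andTb]; lra.
- move=> k hk x /andP[x1 x2]; have /andP[k1 kd] := hk; have [E1 E2] := He0 k hk.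
  have n1 : `|P th - p| <= h' by rewrite ler_norml; clear - hb hd hdyn hP0 hPpos hinv hp1 hp2; apply/andP; split; lra.
  have n2 : `|Q th - q| <= h' by rewrite ler_norml; clear - hb hd hdyn hP0 hPpos hinv hq1 hq2; apply/andP; split; lra.
  have := kl k _ _ hk n1; have := kl k _ _ hk n2.
  rewrite !ler_norml => /andP[s1 s2] /andP[s3 s4].
  have := mon k _ _ k1 x1; have := mon k _ _ k1 x2.
  by clear - hb hd hdyn hP0 hPpos hinv s1 s2 s3 s4 E1 E2 A0e B0e hz e31; move=> t1 t2; apply/andP; split; lra.
Qed.

End Core.

(** * Escape from the arc and contraction of chain starts *)

Section Core2.
Variables (R : realType) (b : R) (d : nat).
Hypotheses (hb : 1 < b) (hd : (2 <= d)%N).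
Implicit Types x y th al e eta del : R.
Local Notation Phi := (Phi b).
Local Notation dyn := (dyn b d).
Local Notation F2 th := (fun x => Phi d th (Phi d th x)).
Local Notation X := (X b).
Variables (th0 th2 : R) (P A Q : R -> R).
Hypothesis hdyn : forall th, th0 <= th < th2 -> dyn th (P th) (A th) (Q th).
Hypothesis hP0 : P th0 = 0.
Hypothesis hPpos : forall th, th0 < th < th2 -> 0 < P th.
Hypothesis hinv : forall th, th0 <= th < th2 -> forall k, (1 <= k < d)%N ->
  forall x, P th <= x <= Q th -> P th < Phi 1 th (Phi k th x) < Q th.

Lemma nc_expi_small x : `|x| <= 1 -> cos 1 * `|x| <= nc (expi x - 1).
Proof.
move=> x1; have p2 := pi_ge2 R.
have c1 := cos1_gt0 R.
have h1 : nc (expi x - 1) >= `|sin x|.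
  rewrite nc_def /= subr0 -(sqrtr_sqr (sin x)) ler_sqrt ?addr_ge0 ?sqr_ge0// lerDr sqr_ge0 //.
apply: le_trans h1.
have key y : 0 < y -> y <= 1 -> cos 1 * y <= sin y.
  move=> y0 y1.
  have [t /andP[t0 t1]] := @MVTd R (@sin R) (@cos R) 0 y y0 (fun t _ => is_derive_sin t).
  rewrite sin0 !subr0 => ->; rewrite ler_pM2r//.
  apply: ltW; rewrite ltr_cos ?in_itv /=; [lra| |]; apply/andP; split; lra.
have [h|h|->] := ltgtP x 0; last by rewrite normr0 mulr0 sin0 normr0.
  rewrite ltr0_norm// in x1 *.
  have := key (- x) ltac:(lra) x1; rewrite sinN => h2.
  by apply: le_trans h2 _; rewrite -normrN ler_norm.
rewrite gtr0_norm// in x1 *.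
by apply: le_trans (key x h x1) _; exact: ler_norm.
Qed.

Lemma gap_disjoint A0 B0 (m i : int) x : A0 <= B0 -> gap A0 B0 m x ->
  A0 + 2 * pi * i%:~R <= x <= B0 + 2 * pi * i%:~R -> False.
Proof.
move=> AB /andP[g1 g2] /andP[h1 h2].
have pi2 : 0 < 2 * pi :> R by rewrite mulr_gt0// pi_gt0.
have l1 : 2 * pi * i%:~R < 2 * pi * (m + 1)%:~R :> R by lra.
have l2 : 2 * pi * m%:~R < 2 * pi * i%:~R :> R by lra.
rewrite ltr_pM2l// ltr_int in l1; rewrite ltr_pM2l// ltr_int in l2.
lia.
Qed.

Lemma lip_orbit (e : nat -> nat) th (U Z : nat -> R) N : letters d e ->
  (forall n, (n < N)%N -> U n.+1 = Phi (e n) th (U n)) ->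
  (forall n, (n < N)%N -> Z n.+1 = Phi (e n) th (Z n)) ->
  forall n, (n <= N)%N -> `|Z n - U n| <= (d%:R * ((b + 1) / (b - 1))) ^+ n * `|Z 0%N - U 0%N|.
Proof.
move=> he hU hZ; have g10 := g1_gt0 hb.
elim=> [|n IH] nN; first by rewrite expr0 mul1r.
rewrite hU// hZ// exprS -mulrA.
apply: le_trans (Phi_lip hb _ _ _ _) _.
apply: ler_pM => //; first by rewrite mulr_ge0// ltW.
  by rewrite ler_pM2r// ler_nat; case/andP: (he n).
by apply: IH; exact: ltnW.
Qed.

(* At block starts the orbit of 0 avoids the arc, and [mm] records the turns. *)
Definition Qprop (e : nat -> nat) (s : nat -> bool) (mm : nat -> int) th :=
  forall n, s n = false ->
    Q th + 2 * pi * (mm n)%:~R <= X e th n <= P th + 2 * pi * (mm n + 1)%:~R.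

(** An orbit that avoids the small arc [A0, B0] at block starts avoids all of (p, q). From inside
    (p, q) a block (k, 1) would end in [A0, B0], so every later letter is d; then f_d attracts the
    orbit to [A th], an interior point of [A0, B0]. *)
Lemma trapped_escape (e : nat -> nat) (s : nat -> bool) th A0 B0 (mm : nat -> int) : letters d e -> transitions d e s -> s 0%N = false ->
  th0 <= th < th2 -> A0 < B0 -> P th < A0 -> A0 < A th -> A th < B0 -> B0 < Q th ->
  (forall k, (1 <= k < d)%N -> forall x, P th <= x <= Q th -> A0 <= Phi 1 th (Phi k th x) <= B0) ->
  (forall n, s n = false -> gap A0 B0 (mm n) (X e th n)) ->
  forall n (i : int), s n = false -> P th + 2 * pi * i%:~R < X e th n < Q th + 2 * pi * i%:~R -> False.
Proof.
move=> he hs hs0 hth AB PA Aa aB BQ hk hg n i sn hx.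
have D := hdyn hth.
have [[p0 pa aq qt tp] [[ea ep eq] _]] := D.
have step n' (i' : int) : s n' = false -> P th + 2 * pi * i'%:~R < X e th n' < Q th + 2 * pi * i'%:~R -> e n' = d /\ s n'.+1 = false.
  move=> sn' /andP[x1 x2].
  have [//|[en sn1 en1 sn2]] := block he hs sn'.
  exfalso.
  have E : X e th n'.+2 = Phi 1 th (Phi (e n') th (X e th n' + 2 * pi * (- i')%:~R)) + 2 * pi * (- (- (- i' * e n')) )%:~R * (-1).
    rewrite /= en1 !Phiz mulr1 !opprK mulrNz; ring.
  have := hk (e n') en (X e th n' + 2 * pi * (- i')%:~R) ltac:(rewrite mulrNz; apply/andP; split; lra).
  have g := hg _ sn2.
  move=> /andP[y1 y2]; apply: (gap_disjoint (ltW AB) g (i := - (- (- (- i' * e n'))))).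
  rewrite E !mulrNz; apply/andP; rewrite !mulrNz in y1 y2 *; split; lra.
have all_d j : exists i' : int, [/\ s (n + j)%N = false, 
    X e th (n + j) = iter j (Phi d th) (X e th n) & P th + 2 * pi * i'%:~R < X e th (n + j) < Q th + 2 * pi * i'%:~R].
  elim: j => [|j [i' [s1 E1 h1]]]; first by exists i; rewrite addn0.
  have [en sn1] := step _ _ s1 h1.
  exists (- i' * d); rewrite addnS; split => //=; first by rewrite en E1.
  rewrite en -[X e th (n + j)](addrNK (2 * pi * i'%:~R)) Phiz.
  move: h1 => /andP[h1 h2]; rewrite -ep -{1}eq !(ltrD2r) !Phi_lt ?(d1 hd)//.
  by apply/andP; split; lra.
have [N hN] := att hb hd (x := X e th n + 2 * pi * (- i)%:~R) (e := Num.min (A th - A0) (B0 - A th)) D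
   ltac:(rewrite mulrNz; move/andP: hx => [? ?]; apply/andP; split; lra) ltac:(by rewrite lt_min !subr_gt0 Aa aB).
have := hN N (leqnn N).
have [z' ez] := iter_F2z b d th (X e th n) (- i) N.
rewrite ez => /andP[y1 y2].
have [i' [s1 E1 _]] := all_d N.*2.
have I j x : iter j.*2 (Phi d th) x = iter j (F2 th) x.
  by elim: j => //= j ->.
rewrite I in E1; have g := hg _ s1; rewrite E1 in g.
apply: (gap_disjoint (ltW AB) g (i := - z')).
have m1 : Num.min (A th - A0) (B0 - A th) <= A th - A0 by rewrite ge_min lexx.
have m2 : Num.min (A th - A0) (B0 - A th) <= B0 - A th by rewrite ge_min lexx orbT.
rewrite mulrNz; apply/andP; split; lra.
Qed.

Lemma hil_bilip A0 B0 x1 x2 : A0 < B0 -> B0 < x1 -> x1 <= x2 -> x2 < A0 + 2 * pi ->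
  exists2 u : R, 0 < u & forall (m : int) x y,
    x1 + 2 * pi * m%:~R <= x <= x2 + 2 * pi * m%:~R ->
    x1 + 2 * pi * m%:~R <= y <= x2 + 2 * pi * m%:~R ->
    sin ((B0 - A0) / 2) / 2 * `|x - y| <= `|hil A0 B0 m x - hil A0 B0 m y| <= u * `|x - y|.
Proof.
move=> AB Bx x12 xA; have [C C0 HC] := K_le AB Bx x12 xA.
have BA : B0 < A0 + 2 * pi by lra.
have l0 : 0 < sin ((B0 - A0) / 2) by apply: sin_gt0_pi; rewrite ?in_itv /=; apply/andP; split; lra.
exists (C / 2); first by rewrite divr_gt0.
move=> m.
have gp x : x1 + 2 * pi * m%:~R <= x <= x2 + 2 * pi * m%:~R -> gap A0 B0 m x.
  by move=> /andP[h1 h2]; rewrite /gap intrD; apply/andP; split; lra.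
have key x y : x1 + 2 * pi * m%:~R <= x -> y <= x2 + 2 * pi * m%:~R -> x <= y ->
  sin ((B0 - A0) / 2) / 2 * `|x - y| <= `|hil A0 B0 m x - hil A0 B0 m y| <= C / 2 * `|x - y|.
  move=> hx hy xy.
  have gx : gap A0 B0 m x by apply: gp; apply/andP; split; lra.
  have gy : gap A0 B0 m y by apply: gp; apply/andP; split; lra.
  have HK t : x <= t <= y -> sin ((B0 - A0) / 2) / 2 <= K A0 B0 t / 2 <= C / 2.
    move=> /andP[t1 t2].
    have E : K A0 B0 t = K A0 B0 (t + 2 * pi * (- m)%:~R) by rewrite Kz.
    rewrite E !ler_pM2r ?invr_gt0//; apply/andP; split.
      by apply: (K_ge AB BA); rewrite mulrNz; apply/andP; split; lra.
    by apply: HC; rewrite mulrNz; apply/andP; split; lra.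
  have /andP[h1 h2] := hil_lip AB gx gy xy HK.
  rewrite (distrC x) (distrC (hil _ _ _ x)) (@ger0_norm _ (y - x)) ?subr_ge0// ger0_norm ?h1//.
  by apply: le_trans h1; apply: mulr_ge0; [rewrite divr_ge0// ltW|rewrite subr_ge0].
move=> x y /andP[hx1 hx2] /andP[hy1 hy2]; have [xy|/ltW xy] := leP x y; first exact: key.
by rewrite (distrC x) (distrC (hil _ _ _ x)); exact: key.
Qed.

(** [chains_contract] with the Hilbert distance replaced by the usual one, both being comparable
    between [x1] and [x2]. The reference chain [W] is infinite, so the bound [C] is the same for all
    [j]. *)
Lemma chain_start_bound (e : nat -> nat) (s : nat -> bool) (mm : nat -> int) A0 B0 A1 B1 c th x1 x2 (W : nat -> R) :
  letters d e -> transitions d e s -> s 0%N = false -> 0 < c ->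
  (forall A' B' x, A1 <= A' -> A' <= B' -> B' <= B1 -> B0 < x < A0 + 2 * pi ->
    (1 + c) * K A' B' x <= K A0 B0 x) ->
  trap b d th A0 B0 A1 B1 -> B0 < x1 -> x1 <= x2 -> x2 < A0 + 2 * pi ->
  (forall n, W n.+1 = Phi (e n) th (W n)) ->
  (forall n, s n = false -> x1 + 2 * pi * (mm n)%:~R <= W n <= x2 + 2 * pi * (mm n)%:~R) ->
  exists2 C : R, 0 < C & forall j (Z : nat -> R), (forall n, (n < ltime d e j)%N -> Z n.+1 = Phi (e n) th (Z n)) ->
   (forall n, (n <= ltime d e j)%N -> s n = false -> x1 + 2 * pi * (mm n)%:~R <= Z n <= x2 + 2 * pi * (mm n)%:~R) ->
   (1 + c) ^+ j * `|W 0%N - Z 0%N| <= C.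
Proof.
move=> he hs hs0 c0 hK T Bx x12 xA hW gW.
have [[AA1 AB1 BB1 BA] _] := T.
have AB : A0 < B0 by lra.
have [u u0 Hu] := hil_bilip AB Bx x12 xA.
have l0 : 0 < sin ((B0 - A0) / 2) / 2.
  by rewrite divr_gt0//; apply: sin_gt0_pi; rewrite ?in_itv /=; apply/andP; split; lra.
set l := sin _ / 2 in l0 Hu.
exists (u * (x2 - x1 + 1) / l); first by rewrite divr_gt0// mulr_gt0//; lra.
move=> j Z hZ gZ.
have gp n x : x1 + 2 * pi * (mm n)%:~R <= x <= x2 + 2 * pi * (mm n)%:~R -> gap A0 B0 (mm n) x.
  by move=> /andP[h1 h2]; rewrite /gap intrD; apply/andP; split; lra.
have c1 : 0 < (1 + c) ^+ j by rewrite exprn_gt0//; lra.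
have Lj : s (ltime d e j) = false by exact: (ltimeP he hs hs0).
have := chains_contract hb hd he hs hs0 c0 hK (Y := W) (Z := Z) (mm := mm) (j := j) T (fun n _ => hW n) hZ
  (fun n nj sn => conj (gp _ _ (gW n sn)) (gp _ _ (gZ n nj sn))) => H.
have /andP[h1 _] := Hu _ _ _ (gW 0%N hs0) (gZ 0%N (leq0n _) hs0).
have /andP[_ h2] := Hu _ _ _ (gW _ Lj) (gZ _ (leqnn _) Lj).
rewrite ler_pdivlMr// -mulrA (mulrC _ l).
apply: le_trans (_ : (1 + c) ^+ j * `|hil A0 B0 (mm 0%N) (W 0%N) - hil A0 B0 (mm 0%N) (Z 0%N)| <= _).
  by rewrite ler_pM2l.
apply: le_trans H _; apply: le_trans h2 _; rewrite ler_pM2l//.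
have /andP[a1 a2] := gW _ Lj; have /andP[b1 b2] := gZ _ (leqnn _) Lj.
by rewrite ler_norml; apply/andP; split; lra.
Qed.

Lemma tends0_geo c C (u : nat -> R) : 0 < c -> (forall j, (1 + c) ^+ j * u j <= C) -> tends0 u.
Proof.
move=> c0 H eps e0.
have ber j : 1 + j%:R * c <= (1 + c) ^+ j.
  elim: j => [|j IH]; first by rewrite mul0r addr0 expr0.
  rewrite exprS; apply: le_trans (_ : (1 + c) * (1 + j%:R * c) <= _); last by rewrite ler_pM2l//; lra.
  have j0 : 0 <= j%:R * c * c by rewrite !mulr_ge0// ltW.
  rewrite -natr1; lra.
have [N hN] : exists N : nat, C / (c * eps) < N%:R.
  by exists (Num.truncn (C / (c * eps))).+1; exact: truncnS_gt.
exists N => j Nj; rewrite ltNge; apply/negP => h.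
have := H j; apply/negP; rewrite -ltNge.
apply: lt_le_trans (_ : (1 + j%:R * c) * eps <= _).
  rewrite ltr_pdivrMr ?mulr_gt0// in hN.
  have : N%:R * (c * eps) <= j%:R * (c * eps) by rewrite ler_pM2r ?mulr_gt0// ler_nat.
  lra.
apply: le_trans (_ : (1 + c) ^+ j * eps <= _); first by rewrite ler_pM2r.
by rewrite ler_pM2l// exprn_gt0//; lra.
Qed.

End Core2.

(** * Holomorphic families of chains and their collapse *)

Section Core3.
Variables (R : realType) (b : R) (d : nat).
Hypotheses (hb : 1 < b) (hd : (2 <= d)%N).
Implicit Types x y th al eta del : R.
Local Notation Phi := (Phi b).
Local Notation dyn := (dyn b d).
Local Notation F2 th := (fun x => Phi d th (Phi d th x)).
Local Notation X := (X b).

(** Unites [real_shadow] and [poly_shadow]: the chains that end on the orbit at [al] stay within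
    [marg] of it, and polynomials with a common bound describe their starts up to 1 / (j + 1). *)
Lemma shadow_family (e : nat -> nat) al c1 w0 w1 kap (N : nat -> nat) (marg : R) : letters d e ->
  weights b e (X e al) c1 w0 w1 kap -> 0 < marg ->
  exists eta r M : R, exists q : nat -> {poly Cx R}, [/\ 0 < eta, 0 < r, forall j, wn r (q j) <= M &
   forall th, `|th - al| <= eta -> nc (expi th - expi al) <= r / 2 /\
    exists Z : nat -> nat -> R, forall j, 
    [/\ forall n, (n < N j)%N -> Z j n.+1 = Phi (e n) th (Z j n),
        forall n, (n <= N j)%N -> `|Z j n - X e al n| <= marg &
        nc ((q j).[expi th - expi al] - (expi (- Gam b (Z j 0%N)) - 1)) <= j.+1%:R^-1 ] ].
Proof.
move=> he W m0; have W' := W; have [c11 w00 hk hw] := W'.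
have [rho0 rho00 HS] := real_shadow hb he (fun n => erefl) W.
have [rho2 [r [M [rho20 r0 HP]]]] := poly_shadow hb he (fun n => erefl) W.
pose rho := Num.min rho0 (Num.min (w0 * marg) (w0 * rho2)).
have rhop : 0 < rho by rewrite !lt_min rho00 !mulr_gt0.
have [rh1 rh2 rh3] : [/\ rho <= rho0, rho <= w0 * marg & rho <= w0 * rho2].
  by rewrite /rho !ge_min !lexx !orbT.
have [eta eta0 HZ] := HS rho ltac:(by rewrite rhop rh1).
have kap0 n : 0 < kap n by have /andP[h _] := hk n; exact: lt_le_trans h.
have bd n (m : R) : 0 < m -> rho <= w0 * m -> rho / kap n <= m.
  move=> mp h; rewrite ler_pdivrMr ?kap0//; apply: le_trans h _; rewrite mulrC ler_pM2l//.
  by have /andP[] := hk n.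
have /boolp.choice[P hP] : forall j, exists P : {poly Cx R}, wn r P <= M /\
  forall th (Z : nat -> R), nc (expi th - expi al) <= r -> Z (N j) = X e al (N j) ->
  (forall n, (n < N j)%N -> Z n.+1 = Phi (e n) th (Z n)) ->
  (forall n, (n <= N j)%N -> `|Z n - X e al n| <= rho2) ->
  nc (P.[expi th - expi al] - expi (- Gam b (Z 0%N))) <= j.+1%:R^-1.
  by move=> j; have [|P h1 h2] := HP (N j) j.+1%:R^-1; [rewrite invr_gt0|exists P].
(* Subtracting 1 = e^(i 0) turns convergence of the starts to the point 0 into convergence of the
   polynomials to 0. The bound r / 4 on the angle puts the increment in the disc of radius r / 2. *)
exists (Num.min eta (r / 4)), r, (M + 1), (fun j => P j - 1); split => //.
- by rewrite lt_min eta0 divr_gt0.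
- move=> j; apply: le_trans (wnB _ _ _) _; first exact: ltW.
  by rewrite wn1 ?lerD2r; have [] := hP j.
move=> th; rewrite le_min => /andP[t1 t2].
have nr : nc (expi th - expi al) <= r / 2.
  by apply: le_trans (expi_lip _ _) _; lra.
split => //.
have /boolp.choice[Z hZ] : forall j, exists Z : nat -> R, Z (N j) = X e al (N j) /\
   forall n, (n < N j)%N -> Z n.+1 = Phi (e n) th (Z n).
  by move=> j; have [Z h1 h2] := chain_exists hb th (N j) (X e al (N j)) he; exists Z.
exists Z => j; have [Z1 Z2] := hZ j.
have sh n : (n <= N j)%N -> `|Z j n - X e al n| <= rho / kap n by exact: (HZ th t1 (N j) (Z j) Z1 Z2).
split => //.
  by move=> n nj; apply: le_trans (sh n nj) _; exact: bd.
have [_ H] := hP j.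
rewrite hornerD hornerN -polyC1 hornerC.
have -> (u v w : Cx R) : u - w - (v - w) = u - v by ring.
apply: H => //; first by apply: le_trans nr _; lra.
by move=> n nj; apply: le_trans (sh n nj) _; exact: bd.
Qed.

(* Vitali's theorem transports the collapse of the chains from the right of [al] to the left. *)
Lemma collapse (e : nat -> nat) al be c1 w0 w1 kap (N : nat -> nat) (marg : R) : letters d e ->
  weights b e (X e al) c1 w0 w1 kap -> 0 < marg -> al < be ->
  (forall th (Z : nat -> nat -> R), al < th < be -> 
     (forall j n, (n < N j)%N -> Z j n.+1 = Phi (e n) th (Z j n)) ->
     (forall j n, (n <= N j)%N -> `|Z j n - X e al n| <= marg) ->
     tends0 (fun j => `|Z j 0%N|)) ->
  exists2 eta : R, 0 < eta & forall th, `|th - al| <= eta -> exists Z : nat -> nat -> R,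
    [/\ forall j n, (n < N j)%N -> Z j n.+1 = Phi (e n) th (Z j n),
        forall j n, (n <= N j)%N -> `|Z j n - X e al n| <= marg &
        tends0 (fun j => `|Z j 0%N|)].
Proof.
move=> he W m0 albe HR.
have g10 := g1_gt0 hb; have g00 := g0_gt0 hb.
set g1 := (b + 1) / (b - 1) in g10; set g0 := (b - 1) / (b + 1) in g00.
(* Guarantees |Gam (Z j 0)| <= 1, where |e^(-i Gam Z) - 1| is comparable to |Z|. *)
pose marg' := Num.min marg g1^-1.
have m'0 : 0 < marg' by rewrite lt_min m0 invr_gt0.
have [m'1 m'2] : marg' <= marg /\ marg' <= g1^-1 by rewrite !ge_min !lexx orbT.
have [eta [r [M [q [eta0 r0 hM H]]]]] := shadow_family N he W m'0.
have inv_small (eps : R) : 0 < eps -> exists N0, forall j, (N0 <= j)%N -> j.+1%:R^-1 < eps.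
  move=> e0; exists (Num.truncn eps^-1) => j hj.
  rewrite invf_plt ?posrE//; apply: lt_le_trans (truncnS_gt _) _.
  by rewrite ler_nat.
have [eta' eta'0 [e1 e2 e3]] : exists2 eta' : R, 0 < eta' & [/\ eta' <= eta, al + eta' <= be & eta' <= 1].
  exists (Num.min eta (Num.min (be - al) 1)).
    by rewrite !lt_min eta0 subr_gt0 albe ltr01.
  split; rewrite ?ge_min ?lexx ?orbT//.
  have : Num.min eta (Num.min (be - al) 1) <= be - al by rewrite !ge_min lexx orbT.
  lra.
(* Parameters to the right of [al] converging to it; their increments are the nodes of Vitali's
   theorem. *)
pose t i := al + eta' / i.+2%:R.
have t1 i : 0 < t i - al < eta'.
  rewrite /t addrAC subrr add0r divr_gt0//=.
  by rewrite ltr_pdivrMr// ltr_pMr// ltr1n.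
have t2 i : `|t i - al| <= eta.
  by have /andP[h1 h2] := t1 i; rewrite gtr0_norm//; lra.
pose mu i := expi (t i) - expi al.
have p2 := pi_ge2 R.
have mu0 i : mu i != 0 /\ nc (mu i) <= r.
  split; last by have [h _] := H _ (t2 i); apply: le_trans h _; lra.
  rewrite subr_eq0; apply/eqP => /expi_inj[z ez].
  have /andP[h1 h2] := t1 i.
  have z0 : (0 : R) < z%:~R by rewrite -(@pmulr_rgt0 _ (2 * pi)); lra.
  rewrite ltr0z in z0.
  have z1 : (1 : R) <= z%:~R.
    by rewrite ler1z -gtz0_ge1.
  have : 2 * pi * 1 <= 2 * pi * z%:~R :> R by rewrite ler_pM2l//; lra.
  lra.
have mu_small (eps : R) : 0 < eps -> exists i, nc (mu i) < eps.
  move=> ep; have [n hn] := inv_small (eps / 2) ltac:(by rewrite divr_gt0).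
  exists n; apply: le_lt_trans (expi_lip _ _) _.
  have /andP[h1 h2] := t1 n; rewrite gtr0_norm// /t addrAC subrr add0r.
  have h3 := hn n (leqnn n).
  have h4 : n.+2%:R^-1 <= n.+1%:R^-1 :> R by rewrite lef_pV2 ?posrE// ler_nat.
  have h5 : eta' * n.+2%:R^-1 <= 1 * n.+2%:R^-1 by rewrite ler_pM2r ?invr_gt0//.
  clear - h3 h4 h5; move: h3 h4 h5; move: (n.+2%:R^-1) (n.+1%:R^-1) => u v; lra.
have bound (z : R) : nc (expi (- Gam b z) - 1) <= 2 * (g1 * `|z|).
  rewrite -expi0; apply: le_trans (expi_lip _ _) _.
  rewrite subr0 normrN ler_pM2l//.
  by have := Gam_lip hb z 0; rewrite Gam0 !subr0.
have right i : tends0 (fun j => nc (q j).[mu i]).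
  have [_ [Z hZ]] := H _ (t2 i).
  have T : tends0 (fun j => `|Z j 0%N|).
    apply: (HR (t i)).
    - by have /andP[h1 h2] := t1 i; apply/andP; split; lra.
    - by move=> j; have [] := hZ j.
    - by move=> j n nj; have [_ h _] := hZ j; apply: le_trans (h n nj) _.
  move=> eps ep.
  have [N1 h1] := inv_small (eps / 2) ltac:(by rewrite divr_gt0).
  have [N2 h2] := T (eps / 2 / (2 * g1)) ltac:(by apply: divr_gt0; [exact: divr_gt0|exact: mulr_gt0]).
  exists (maxn N1 N2) => j; rewrite geq_max => /andP[j1 j2].
  have [_ _ h3] := hZ j; have h4 := h2 j j2; have h5 := bound (Z j 0%N); have h6 := h1 j j1.
  rewrite ltr_pdivlMr in h4; last by apply: mulr_gt0.
  have -> : (q j).[mu i] = ((q j).[expi (t i) - expi al] - (expi (- Gam b (Z j 0%N)) - 1)) +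
      (expi (- Gam b (Z j 0%N)) - 1) by rewrite subrK.
  apply: le_lt_trans (le_ncD _ _) _.
  by move: h3 h4 h5 h6; set u := nc _; set v := nc _; set w := `|Z j _|; move: (j.+1%:R^-1) => inv; lra.
exists eta => // th hth.
have [h [Z hZ]] := H th hth.
have L := @vitali R r (ltW r0) mu mu0 mu_small M q r0 hM right (expi th - expi al) h.
exists Z; split.
- by move=> j; have [] := hZ j.
- by move=> j n nj; have [_ h' _] := hZ j; apply: le_trans (h' n nj) _.
have c0 := cos1_gt0 R.
have cg0 : 0 < cos 1 * g0 :> R by rewrite mulr_gt0.
move=> eps ep.
have ep' : 0 < eps * (cos 1 * g0) / 2 by rewrite divr_gt0// mulr_gt0.
have [N1 h1] := inv_small _ ep'; have [N2 h2] := L _ ep'.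
exists (maxn N1 N2) => j; rewrite geq_max => /andP[j1 j2].
have [_ h3 h4] := hZ j; have h5 := h1 j j1; have h6 := h2 j j2.
have Zm : `|Z j 0%N| <= marg' by have := h3 0%N isT; rewrite /= subr0.
have G1 : `|- Gam b (Z j 0%N)| <= 1.
  have := Gam_lip hb (Z j 0%N) 0; rewrite Gam0 !subr0 normrN -/g1 => k.
  apply: le_trans k _; apply: le_trans (_ : g1 * g1^-1 <= _); last by rewrite divff ?gt_eqF.
  by rewrite ler_pM2l//; lra.
have k1 := nc_expi_small G1.
have k2 : g0 * `|Z j 0%N| <= `|- Gam b (Z j 0%N)|.
  by have := Gam_lip_ge hb (Z j 0%N) 0; rewrite Gam0 !subr0 normrN.
have k3 : nc (expi (- Gam b (Z j 0%N)) - 1) <= nc ((q j).[expi th - expi al] - (expi (- Gam b (Z j 0%N)) - 1)) + nc ((q j).[expi th - expi al]).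
  have key (u v : Cx R) : nc v <= nc (u - v) + nc u by have := le_ncD (v - u) u; rewrite subrK ncB.
  exact: key.
have k4 : cos 1 * (g0 * `|Z j 0%N|) <= cos 1 * `|- Gam b (Z j 0%N)| by rewrite ler_pM2l.
rewrite -(ltr_pM2l cg0) -mulrA (mulrC _ eps).
apply: le_lt_trans k4 _; apply: le_lt_trans k1 _; apply: le_lt_trans k3 _.
move: h4 h5 h6; set u := nc _; set v := nc _; move: (j.+1%:R^-1) => inv; lra.
Qed.

End Core3.

(** * Continuation to the left and density of the zeros *)

Section Core4.
Variables (R : realType) (b : R) (d : nat).
Hypotheses (hb : 1 < b) (hd : (2 <= d)%N).
Implicit Types x y th al eta del : R.
Local Notation Phi := (Phi b).
Local Notation dyn := (dyn b d).
Local Notation F2 th := (fun x => Phi d th (Phi d th x)).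
Local Notation X := (X b).
Variables (th0 th2 : R) (P A Q : R -> R).
Hypothesis hdyn : forall th, th0 <= th < th2 -> dyn th (P th) (A th) (Q th).
Hypothesis hP0 : P th0 = 0.
Hypothesis hPpos : forall th, th0 < th < th2 -> 0 < P th.
Hypothesis hinv : forall th, th0 <= th < th2 -> forall k, (1 <= k < d)%N ->
  forall x, P th <= x <= Q th -> P th < Phi 1 th (Phi k th x) < Q th.

Lemma gap_Qprop (p q : R) (m : int) x (marg y : R) :
  q + 2 * pi * m%:~R <= y <= p + 2 * pi * (m + 1)%:~R ->
  `|x - y| <= marg -> q - marg + 2 * pi * m%:~R <= x <= p + marg + 2 * pi + 2 * pi * m%:~R.
Proof.
rewrite intrD ler_norml => /andP[h1 h2] /andP[h3 h4]; apply/andP; split; lra.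
Qed.

(** To the right of [al] the orbit of 0 is itself a confined chain, so by contraction the shadowing
    chains start ever closer to 0; [collapse] carries this to the left. There the orbit of 0 is the
    limit of the chains, hence stays near the orbit at [al] and off the trap, and [trapped_escape]
    keeps it off (p, q). *)
Lemma extend (e : nat -> nat) (s : nat -> bool) (mm : nat -> int) al be :
  letters d e -> transitions d e s -> s 0%N = false -> th0 < al -> al < be -> be <= th2 ->
  (forall th, al <= th < be -> Qprop b P Q e s mm th) ->
  exists2 eta : R, 0 < eta & forall th, th0 <= th -> al - eta < th < al -> Qprop b P Q e s mm th.
Proof.
move=> he hs hs0 al0 albe be2 HQ.
have hal : th0 <= al < th2 by apply/andP; split; lra.
have [A0 [B0 [A1 [B1 [eta [eta0 PA BQ AB HT]]]]]] := trap_exists hb hd hdyn hinv hal.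
have [T0 [/andP[PA0 Aa0] /andP[aB0 BQ0]] _] := HT al hal ltac:(by rewrite subrr normr0 ltW).
have [[p0 pa aq qt tp] _] := hdyn hal.
have [[AA1 AB1 BB1 BA] _] := T0.
have [c c0 hK] := K_sub AA1 AB1 BB1 BA.
have QA : Qprop b P Q e s mm al by apply: HQ; rewrite lexx albe.
have [|||||c1 [w0 [w1 [kap [W _]]]]] := @weights_exist R b d hb hd e s A0 B0 A1 B1 c he hs c0 hK al (X e al) mm (Q al) (P al + 2 * pi) T0.
- exact: BQ.
- lra.
- by rewrite ltrD2r.
- by [].
- by move=> n sn; have := QA n sn; rewrite intrD => /andP[h1 h2]; apply/andP; split; lra.
(* A quarter, because the orbit to the left is only known to stay within twice this distance of the
   orbit at [al]. *)
pose marg := Num.min ((Q al - B0) / 4) ((A0 - P al) / 4).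
have m0 : 0 < marg by rewrite lt_min; apply/andP; split; lra.
have [m1 m2] : marg <= (Q al - B0) / 4 /\ marg <= (A0 - P al) / 4 by rewrite !ge_min !lexx orbT.
pose be' := Num.min be (al + eta).
have albe' : al < be' by rewrite lt_min albe; lra.
have [be1 be3] : be' <= be /\ be' <= al + eta by rewrite !ge_min !lexx orbT.
have [|eta2 eta20 HZ] := @collapse R b d hb e al be' c1 w0 w1 kap (ltime d e) marg he W m0 albe'.
  move=> th Z /andP[th1 thbe] hZ gZ.
  have hth : th0 <= th < th2 by apply/andP; split; lra.
  have [|T [/andP[q1 q2] /andP[q3 q4]] _] := HT th hth.
    by clear - hb hd hdyn hP0 hPpos hinv th1 thbe be3; rewrite gtr0_norm; lra.
  pose x1 := Num.min (Q th) (Q al - marg).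
  pose x2 := Num.max (P th) (P al + marg) + 2 * pi.
  have [x11 x12] : x1 <= Q th /\ x1 <= Q al - marg by rewrite !ge_min !lexx orbT.
  have [x21 x22] : P th + 2 * pi <= x2 /\ P al + marg + 2 * pi <= x2 by rewrite !lerD2r !le_max !lexx orbT.
  have [[p0' pa' aq' qt' tp'] _] := hdyn hth.
  have Qth : Qprop b P Q e s mm th by apply: HQ; clear - hb hd hdyn hP0 hPpos hinv th1 thbe be1; apply/andP; split; lra.
  have Bx1 : B0 < x1 by rewrite lt_min q4 /=; lra.
  have xA : x2 < A0 + 2 * pi by rewrite ltrD2r gt_max q1 /=; lra.
  have gX n : s n = false -> x1 + 2 * pi * (mm n)%:~R <= X e th n <= x2 + 2 * pi * (mm n)%:~R.
    by move=> sn; have := Qth n sn; rewrite intrD => /andP[h1 h2]; clear - hb hd hdyn hP0 hPpos hinv h1 h2 x11 x21; apply/andP; split; lra.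
  have [C C0 HC] := @chain_start_bound R b d hb hd e s mm A0 B0 A1 B1 c th x1 x2 (X e th)
     he hs hs0 c0 hK T Bx1 ltac:(lra) xA (fun n => erefl) gX.
  apply: (tends0_geo (C := C) c0) => j.
  have := HC j (Z j) (hZ j); rewrite /= sub0r normrN; apply.
  move=> n nj sn; have /andP[h1 h2] := gap_Qprop (QA n sn) (gZ j n nj).
  by clear - hb hd hdyn hP0 hPpos hinv h1 h2 x12 x22; apply/andP; split; lra.
exists (Num.min eta eta2); first by rewrite lt_min eta0.
move=> th th0' /andP[t1 t2].
have [e1 e2] : Num.min eta eta2 <= eta /\ Num.min eta eta2 <= eta2 by rewrite !ge_min !lexx orbT.
have hth : th0 <= th < th2 by apply/andP; split; lra.
have nth2 : `|th - al| <= eta2 by clear - hb hd hdyn hP0 hPpos hinv t1 t2 e2; rewrite distrC gtr0_norm; lra.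
have [|T [/andP[q1 q2] /andP[q3 q4]] Hk] := HT th hth.
  by clear - hb hd hdyn hP0 hPpos hinv t1 t2 e1; rewrite distrC gtr0_norm; lra.
have [Z [hZ gZ tZ]] := HZ th nth2.
(* For fixed [n] the first [n] steps magnify the start by at most L^n; taking [j] large makes the
   start of the chain small against that. *)
have near n : `|X e th n - X e al n| <= 2 * marg.
  have L0 : 0 < d%:R * ((b + 1) / (b - 1)) by rewrite mulr_gt0 ?(g1_gt0 hb)// ltr0n (d1 hd).
  set L := d%:R * _ in L0.
  have [N0 HN] := tZ (marg / L ^+ n) ltac:(by rewrite divr_gt0// exprn_gt0).
  pose j := maxn N0 n.
  have nj : (n <= ltime d e j)%N by apply: leq_trans (leq_ltime _ _ _); exact: leq_maxr.
  have h1 := HN j (leq_maxl _ _).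
  have h2 := @lip_orbit R b d hb e th (X e th) (Z j) (ltime d e j) he (fun n _ => erefl) (hZ j) n nj.
  have h3 := gZ j n nj.
  rewrite /= subr0 -/L in h2.
  have h4 : L ^+ n * `|Z j 0%N| <= marg.
    by rewrite mulrC -ler_pdivlMr ?exprn_gt0// ltW.
  have -> : X e th n - X e al n = (Z j n - X e al n) - (Z j n - X e th n) by ring.
  apply: le_trans (ler_normB _ _) _; move: h2 h3 h4.
  by clear - hb hd hdyn hP0 hPpos hinv; set u := `|_|; set v := `|_|; set w := _ * _; lra.
have gp n : s n = false -> gap A0 B0 (mm n) (X e th n).
  move=> sn; have /andP[h1 h2] := gap_Qprop (QA n sn) (near n).
  by clear - hb hd hdyn hP0 hPpos hinv h1 h2 m1 m2 BQ PA; rewrite /gap intrD; apply/andP; split; lra.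
have esc := trapped_escape hb hd hdyn he hs hs0 hth AB q1 q2 q3 q4 Hk gp.
move=> n sn; have := gp n sn; rewrite /gap intrD => /andP[g1 g2].
apply/andP; split; rewrite leNgt; apply/negP => h.
  by apply: (esc n (mm n) sn); clear - hb hd hdyn hP0 hPpos hinv g1 g2 h q1 q4 AB q2 q3; apply/andP; split; lra.
by apply: (esc n (mm n + 1) sn); rewrite intrD; clear - hb hd hdyn hP0 hPpos hinv g1 g2 h q1 q4 AB q2 q3; apply/andP; split; lra.
Qed.

(** Confinement is stated with weak inequalities so that it passes to the limit; endpoints and orbit
    angles are continuous in the parameter. *)
Lemma Qprop_closed (e : nat -> nat) (s : nat -> bool) (mm : nat -> int) al be :
  th0 <= al -> al < be -> be < th2 ->
  (forall th, al < th <= be -> Qprop b P Q e s mm th) -> Qprop b P Q e s mm al.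
Proof.
move=> al0 albe be2 HQ n sn.
have hal : th0 <= al < th2 by apply/andP; split; lra.
have cX := @continuous_X R b hb e n.
have pick ep : 0 < ep -> exists2 th, al < th <= be &
   [/\ `|P th - P al| < ep, `|Q th - Q al| < ep & X e al n - ep < X e th n < X e al n + ep].
  move=> e0; have [del del0 H] := contPQ hb hd hdyn hal e0.
  have cB (f g : R -> R) : continuous f -> continuous g -> continuous (fun t => f t - g t).
    by move=> cf cg t; apply: cvgB; [exact: cf|exact: cg].
  have cc x : continuous (fun _ : R => x) by move=> t; exact: cvg_cst.
  have [d1 d10 E1] := @near_pos R (fun t => X e t n - (X e al n - ep)) al (cB _ _ cX (cc (X e al n - ep))) ltac:(by rewrite /= subKr).
  have [d2 d20 E2] := @near_pos R (fun t => (X e al n + ep) - X e t n) al (cB _ _ (cc (X e al n + ep)) cX) ltac:(by rewrite /= addrAC subrr add0r).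
  pose h := Num.min (Num.min d1 d2) (Num.min del (be - al)) / 2.
  have M : 0 < Num.min (Num.min d1 d2) (Num.min del (be - al)) by rewrite !lt_min d10 d20 del0 subr_gt0.
  have [u1 u2 u3 u4] : [/\ Num.min (Num.min d1 d2) (Num.min del (be - al)) <= d1,
     Num.min (Num.min d1 d2) (Num.min del (be - al)) <= d2,
     Num.min (Num.min d1 d2) (Num.min del (be - al)) <= del &
     Num.min (Num.min d1 d2) (Num.min del (be - al)) <= be - al] by rewrite !ge_min !lexx !orbT.
  have h0 : 0 < h by rewrite divr_gt0.
  have h2 : h < Num.min (Num.min d1 d2) (Num.min del (be - al)) by rewrite /h; lra.
  have nh : `|al + h - al| = h by rewrite addrAC subrr add0r gtr0_norm.
  exists (al + h); first by apply/andP; split; lra.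
  have [| |k1 k2] := H (al + h); [apply/andP; split; lra|rewrite nh; lra|].
  split => //; apply/andP; split.
    by have := E1 (al + h) ltac:(rewrite nh; lra); rewrite subr_gt0.
  by have := E2 (al + h) ltac:(rewrite nh; lra); rewrite subr_gt0.
apply/andP; split; rewrite leNgt; apply/negP => h.
  have [th hth] := pick ((Q al + 2 * pi * (mm n)%:~R - X e al n) / 2) ltac:(by rewrite divr_gt0 ?subr_gt0).
  rewrite !ltr_norml => -[_ /andP[k1 k2] /andP[k3 k4]].
  have /andP[h1 h2] := HQ th hth n sn; lra.
have [th hth] := pick ((X e al n - (P al + 2 * pi * (mm n + 1)%:~R)) / 2) ltac:(by rewrite divr_gt0 ?subr_gt0).
rewrite !ltr_norml => -[/andP[k1 k2] _ /andP[k3 k4]].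
have /andP[h1 h2] := HQ th hth n sn; lra.
Qed.

(** At [th0] the 2-cycle is 0, Q. From either of its points a block (k, 1) leads strictly inside the
    arc, so confinement leaves only the letter d. The value -1 of [mm] records that 0 = P th0 is the
    upper end of the gap below the arc. *)
Lemma Qprop_start (e : nat -> nat) (s : nat -> bool) (mm : nat -> int) :
  th0 < th2 -> letters d e -> transitions d e s -> s 0%N = false -> Qprop b P Q e s mm th0 ->
  forall j, [/\ s j.*2 = false, e j.*2 = d, e j.*2.+1 = d & mm j.*2 = -1].
Proof.
move=> t02 he hs hs0 HQ.
have hth : th0 <= th0 < th2 by rewrite lexx t02.
have [[p0 pa aq qt tp] [[ea ep eq] _]] := hdyn hth.
have pi0 := pi_gt0 R.
rewrite hP0 in p0 pa ep eq HQ.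
have out n : s n = false -> 0 < X e th0 n < Q th0 -> False.
  move=> sn /andP[x1 x2]; have := HQ n sn; rewrite hP0 add0r => /andP[h1 h2].
  have m0 : 2 * pi * 0 < 2 * pi * (mm n + 1)%:~R :> R by lra.
  have m1 : 2 * pi * (mm n)%:~R < 2 * pi * 0 :> R by lra.
  rewrite ltr_pM2l ?ltr0z ?ltrz0 in m0; last lra.
  rewrite ltr_pM2l ?ltrz0 in m1; last lra.
  by clear - m0 m1; move: m0 m1; move: (mm n) => m; lia.
have step n : s n = false -> X e th0 n = 0 \/ X e th0 n = Q th0 -> e n = d /\ s n.+1 = false.
  move=> sn hx; have [//|[en sn1 en1 sn2]] := block he hs sn.
  exfalso; apply: (out _ sn2); rewrite /= en1.
  have := hinv hth en (x := X e th0 n); rewrite hP0; apply.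
  by case: hx => ->; apply/andP; split; lra.
have main j : s j.*2 = false /\ X e th0 j.*2 = 0.
  elim: j => [|j [IH1 IH2]] //.
  have [e1 s1] := step _ IH1 (or_introl IH2).
  have x1 : X e th0 j.*2.+1 = Q th0 by rewrite /= e1 IH2.
  have [e2 s2] := step _ s1 (or_intror x1).
  by rewrite doubleS; split => //=; rewrite e2 e1 IH2 ep eq.
move=> j; have [sj xj] := main j; have [ej sj1] := step _ sj (or_introl xj).
have xj1 : X e th0 j.*2.+1 = Q th0 by rewrite /= ej xj.
have [ej1 _] := step _ sj1 (or_intror xj1).
split => //; have := HQ _ sj; rewrite xj hP0 add0r => /andP[h1 h2].
have m0 : 2 * pi * 0 <= 2 * pi * (mm j.*2 + 1)%:~R :> R by lra.
have m1 : 2 * pi * (mm j.*2)%:~R < 2 * pi * 0 :> R by lra.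
rewrite ler_pM2l ?ler0z in m0; last lra.
rewrite ltr_pM2l ?ltrz0 in m1; last lra.
clear - m0 m1; move: m0 m1; move: (mm _) => m; lia.
Qed.

Lemma zeros_dense c1 c2 : th0 <= c1 -> c1 < c2 -> c2 <= th2 ->
  exists e n th (z : int), [/\ letters d e, c1 < th < c2 & X e th n = pi + 2 * pi * z%:~R].
Proof.
move=> c01 c12 c22; apply: contrapT => NZ.
have zf (e : nat -> nat) : letters d e -> forall n th, c1 < th < c2 ->
    forall z : int, X e th n != pi + 2 * pi * z%:~R.
  by move=> he n th hth z; apply/eqP => E; apply: NZ; exists e, n, th, z.
clear NZ; pose ts := (c1 + c2) / 2.
have [ts1 ts2] : c1 < ts /\ ts < c2 by rewrite /ts; split; lra.
clearbody ts.
have hts : th0 <= ts < th2 by apply/andP; split; lra.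
have Pts : 0 < P ts by apply: hPpos; apply/andP; split; lra.
have Dts := hdyn hts.
have [[p0 pa aq qt tp] _] := Dts.
have [e [s [he hs hs0 ho]]] := word_exists hb hd Dts Pts.
have pq : P ts <= Q ts by rewrite ltW// (lt_trans pa).
have /boolp.choice[mm hmm] : forall n, exists m : int, s n = false ->
   Q ts + 2 * pi * m%:~R < X e ts n < P ts + 2 * pi * (m + 1)%:~R.
  move=> n; case E : (s n); first by exists 0.
  by have [m hm] := outside_gap pq (ho n E); exists m.
have Q1 th : c1 < th < c2 -> Qprop b P Q e s mm th.
  move=> hth n sn; have /andP[h1 h2] := hmm n sn.
  have D : dyn th (P th) (A th) (Q th) by apply: hdyn; move/andP: hth => [? ?]; apply/andP; split; lra.
  have hts' : c1 < ts < c2 by rewrite ts1 ts2.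
  apply/andP; split; apply: ltW.
    exact: (no_cross_q hb hd zf he hts' hth Dts D h1).
  exact: (no_cross_p hb hd zf he hts' hth Dts D h2).
have Qall : Qprop b P Q e s mm th0.
  apply: contrapT => NQ.
  (* The parameters at which confinement fails. At their supremum confinement holds by closedness,
     and [extend] then excludes failures just to the left of it. *)
  pose S := [set t | th0 <= t <= ts /\ ~ Qprop b P Q e s mm t].
  have S0 : S th0 by split => //; apply/andP; split; lra.
  have Sc t : S t -> t <= c1.
    move=> [/andP[h1 h2] h3]; rewrite leNgt; apply/negP => h; apply: h3; apply: Q1; apply/andP; split; lra.
  have hS : has_sup S by split; [exists th0|exists c1].
  pose al := sup S.
  have al0 : th0 <= al by exact: (ub_le_sup hS.2 S0).
  have alc : al <= c1 by apply: ge_sup; [exists th0|exact: Sc].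
  have Qal th : al < th <= ts -> Qprop b P Q e s mm th.
    move=> /andP[h1 h2]; apply: contrapT => h.
    have : S th by split => //; apply/andP; split; lra.
    by move=> /(ub_le_sup hS.2); rewrite -/al; lra.
  have Qa : Qprop b P Q e s mm al by apply: (@Qprop_closed e s mm al ts); lra || exact: Qal.
  have [E|al1] := eqVneq th0 al; first by apply: NQ; rewrite E.
  have al2 : th0 < al by rewrite lt_neqAle al1.
  have [|||eta eta0 He] := @extend e s mm al ts he hs hs0 al2; [lra|lra| |].
    move=> th /andP[]; rewrite le_eqVlt => /orP[/eqP<- //|h1 h2].
    by apply: Qal; rewrite h1 ltW.
  have [t St] := sup_adherent eta0 hS; rewrite -/al => tal.
  have := ub_le_sup hS.2 St; have [/andP[St1 St2] St3] := St.
  move=> tl; apply: St3; move: tl; rewrite -/al le_eqVlt => /orP[/eqP-> //|h].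
  by apply: He => //; rewrite tal h.
have H := Qprop_start ltac:(lra) he hs hs0 Qall.
have XI j : X e ts j.*2 = iter j (F2 ts) 0.
  by elim: j => //= j IH; have [_ -> -> _] := H j; rewrite IH.
(* The word is now d d d ... and 0 < p at [ts], so the orbit of 0 drifts downwards and leaves the
   gap with index -1, whose lower end Q - 2 pi exceeds -2 pi. *)
have [j hj] := esc_down hb hd (- (2 * pi)) Dts Pts.
have [sj _ _ mj] := H j.
have := Q1 ts ltac:(by rewrite ts1 ts2) _ sj.
by rewrite XI mj mulrNz => /andP[h1 h2]; lra.
Qed.

End Core4.

(** * Partition functions of spherically symmetric trees *)

Section Tree.
Variables (R : realType) (b : R) (l : Cx R).
Local Notation bc := (b%:C : Cx R).

Definition rootZ (T : rooted) (r : bool) : Cx R :=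
  \sum_(U : {set vertex (tree_graph T)} | (tree_root T \in U) == r)
    l ^+ #|U| * bc ^+ #|edge_boundary U|.

Lemma Zpart_root T : Zpart (tree_graph T) l b = rootZ T true + rootZ T false.
Proof.
rewrite /Zpart (bigID (fun U : {set vertex (tree_graph T)} => tree_root T \in U)) /=.
by congr (_ + _); apply: eq_bigl => U; [rewrite eqb_id|rewrite eqbF_neg].
Qed.

Lemma sum_option (T : finType) (F : option T -> nat) :
  (\sum_x F x = F None + \sum_t F (Some t))%N.
Proof.
rewrite (bigD1 None)//=; congr addn.
rewrite (reindex_omap Some id) /=; last by case.
by apply: eq_bigl => t; rewrite eqxx.
Qed.

Lemma cards_sum (T : finType) (A : {set T}) : #|A| = (\sum_x (x \in A))%N.
Proof. by rewrite -sum1_card big_mkcond /=; apply: eq_bigr => x _; case: (x \in A). Qed.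

Lemma edge_boundary_sum (G : sgraph) (U : {set vertex G}) :
  #|edge_boundary U| = (\sum_x \sum_y [&& adj x y, x \in U & y \notin U])%N.
Proof. by rewrite cards_sum pair_bigA /=; apply: eq_bigr => x _; rewrite inE. Qed.

Section Join.
Variables (k : nat) (T : rooted).
Local Notation V := (vertex (tree_graph T)).
Local Notation W := (vertex (tree_graph (join_copies k T))).

Lemma sum_join (F : W -> nat) :
  (\sum_x F x = F None + \sum_i \sum_v F (Some (i, v)))%N.
Proof.
rewrite (sum_option F); congr addn.
by rewrite pair_bigA /=; apply: eq_bigr => -[].
Qed.

Definition glue (r : bool) (f : {ffun 'I_k -> {set V}}) : {set W} :=
  [set x : W | if x is Some p then p.2 \in f p.1 else r]%SET.

Lemma card_glue r f : #|glue r f| = (r + \sum_i #|f i|)%N.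
Proof.
rewrite cards_sum sum_join inE; congr addn.
by apply: eq_bigr => i _; rewrite cards_sum; apply: eq_bigr => v _; rewrite inE.
Qed.

Lemma sum_root (F : V -> bool) : (\sum_v ((v == tree_root T) && F v))%N = F (tree_root T).
Proof.
rewrite (bigD1 (tree_root T))//= eqxx big1 ?addn0// => v /negbTE->.
by [].
Qed.

Lemma boundary_glue r f : #|edge_boundary (glue r f)| =
  (\sum_i (#|edge_boundary (f i)| + ((tree_root T \in f i) != r)))%N.
Proof.
rewrite edge_boundary_sum sum_join sum_join /= add0n -big_split /=.
apply: eq_bigr => i _.
under eq_bigr do rewrite !inE /=.
rewrite (sum_root (fun v => r && (v \notin f i))).
under [X in (_ + X)%N]eq_bigr => v _.
  rewrite sum_join !inE /= (bigD1 i)//= [X in (_ + (_ + X))%N]big1 ?addn0; last first.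
    by move=> j ji; apply: big1 => w _; rewrite /= eq_sym (negbTE ji).
  over.
rewrite big_split /= (sum_root (fun v => (v \in f i) && ~~ r)) edge_boundary_sum.
rewrite addnA addnC; congr addn.
  by apply: eq_bigr => v _; apply: eq_bigr => w _; rewrite /= eqxx !inE.
by case: r; case: (tree_root T \in f i).
Qed.

Lemma rootZ_join r : rootZ (join_copies k T) r =
  l ^+ r * (rootZ T r + bc * rootZ T (~~ r)) ^+ k.
Proof.
pose h' (U : {set W}) : {ffun 'I_k -> {set V}} := [ffun i => [set v : V | (Some (i, v) : W) \in U]%SET].
rewrite /rootZ (reindex_onto (glue r) h') /=; last first.
  by move=> U /eqP E; apply/setP => -[[i v]|]; rewrite inE ?ffunE ?inE// -E.
pose w (U : {set V}) : Cx R := l ^+ #|U| * bc ^+ #|edge_boundary U| * bc ^+ ((tree_root T \in U) != r).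
(* A configuration is a family of configurations of the copies, and its weight is a product over
   them, an edge to the new root costing b when its ends differ. Distributivity turns the sum into a
   k-th power. *)
transitivity (\sum_(f : {ffun 'I_k -> {set V}}) l ^+ r * \prod_i w (f i)).
  apply: eq_big => [f|f _].
    rewrite inE eqxx /=; apply/eqP/ffunP => i; rewrite ffunE; apply/setP => v.
    by rewrite !inE.
  rewrite card_glue boundary_glue exprD -mulrA; congr (_ * _).
  by rewrite /w !big_split /= !prodrXr -mulrA -exprD.
rewrite -big_distrr /= -(bigA_distr_bigA (fun=> w)) /= prodr_const card_ord.
congr (_ * _ ^+ _).
rewrite (bigID (fun U : {set V} => (tree_root T \in U) == r)) /=; congr (_ + _).
  by apply: eq_bigr => U /eqP E; rewrite /w E eqxx expr0 mulr1.
rewrite big_distrr /=; apply: eq_big => [U|U /negbTE E]; first by clear w; case: r; case: (_ \in _).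
by rewrite /w E expr1 mulrC.
Qed.
End Join.
End Tree.

(** The ratio of the two root sums is e^(i X), written as a product so that a vanishing denominator
    is covered. *)
Lemma rootZ_expi (R : realType) (b : R) (th : R) (e : nat -> nat) n : 1 < b ->
  rootZ b (expi th) (sphtree e n) true =
  expi (X b e th n.+1) * rootZ b (expi th) (sphtree e n) false.
Proof.
move=> hb; elim: n => [|n IH].
  have E r : rootZ b (expi th) one_vertex r = expi th ^+ r.
    rewrite /rootZ (big_pred1 [set x : unit | r]%SET) => [|U].
      rewrite edge_boundary_sum big1 ?mulr1; last by move=> x _; apply: big1.
      congr (_ ^+ _); rewrite cards_sum; case: r.
        by rewrite (eq_bigr (fun=> 1%N)) => [|x _]; rewrite ?inE ?sum1_card ?card_unit.
      by apply: big1 => x _; rewrite inE.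
    apply/eqP/eqP => [<-|->]; last by rewrite inE.
    by apply/setP => -[]; rewrite inE.
  by rewrite /= !E expr1 mulr1 /Phi Gam0 mulr0 subr0.
rewrite [sphtree _ _]/= !rootZ_join IH expr1 expr0 mul1r.
set x := X b e th n.+1; set z := rootZ _ _ _ false; set k := e n.+1.
have -> : expi x * z + b%:C * z = expi (- Gam b x) * (b%:C * (expi x * z) + z).
  rewrite -mobius_expi//; field.
  exact: bexpi_neq0.
have E : expi (Phi b k th x) = expi th * expi (- Gam b x) ^+ k.
  by rewrite -expiMn -expiD /Phi mulrN.
by rewrite [X b e th n.+2]/= -/k -/x E exprMn !mulrA [z + _]addrC.
Qed.

Lemma Zpart_zero (R : realType) (b : R) (th : R) (e : nat -> nat) n (z : int) : 1 < b ->
  X b e th n.+1 = pi + 2 * pi * z%:~R -> Zpart (tree_graph (sphtree e n)) (expi th) b = 0.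
Proof.
move=> hb E; rewrite Zpart_root rootZ_expi// E expiz.
have -> : expi (pi : R) = -1 by rewrite /expi cospi sinpi; apply/eqP; rewrite eq_complex /= oppr0 !eqxx.
by rewrite mulN1r addNr.
Qed.

(** * The Fatou component on the circle *)

Section Topology.
Variable R : realType.
Implicit Types (z w : Cx R) (r : R).

Lemma nbhs_nc z (A : set (Cx R)) :
  nbhs z A <-> exists2 r : R, 0 < r & forall w, nc (w - z) < r -> A w.
Proof.
split=> [/nbhs_ballP[e /= e0 He]|[r r0 H]].
  have E : e = (complex.Re e)%:C.
    by case: e e0 {He} => x y; rewrite ltcE /= => /andP[/eqP-> _].
  exists (complex.Re e); first by move: e0; rewrite E ltcR.
  by move=> w hw; apply: He; rewrite -ball_normE /= E distrC ncE ltcR.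
apply/nbhs_ballP; exists (r%:C : Cx R) => /=; first by rewrite ltcR.
by move=> w; rewrite -ball_normE /= distrC ncE ltcR; exact: H.
Qed.

Lemma near_nc z r : 0 < r -> \forall w \near z, nc (w - z) < r.
Proof. by move=> r0; apply/nbhs_nc; exists r. Qed.

Lemma open_disc z r : open [set w | nc (w - z) < r].
Proof.
rewrite openE => w hw; apply/nbhs_nc; exists (r - nc (w - z)); first by rewrite subr_gt0.
move=> v h; have := le_ncD (v - w) (w - z); rewrite addrA subrK /=.
by move: h; set u := nc _; set u' := nc _; lra.
Qed.

Lemma nbhs_Some z (A : set (riemann_sphere R)) :
  nbhs (Some z : riemann_sphere R) A <-> nbhs z (Some @^-1` A).
Proof. by []. Qed.

Lemma continuous_expi : continuous (@expi R).
Proof.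
move=> x A /nbhs_nc[r r0 H]; apply/(@nbhs_ballP R R); exists (r / 2); first by rewrite /= divr_gt0.
move=> y /=; rewrite /ball /= distrC => h; apply: H.
by apply: le_lt_trans (expi_lip _ _) _; lra.
Qed.

End Topology.

(** * Derivatives, attraction and Fatou points of the Ising maps *)

Section Ising.
Variables (R : realType) (b : R) (d : nat).
Hypotheses (hb : 1 < b) (hd : (2 <= d)%N).
Implicit Types (z w l : Cx R).
Local Notation bc := (b%:C : Cx R).

Lemma is_derive_fising (k : nat) l z : bc * z + 1 != 0 ->
  is_derive z 1 (fising b k l)
    (l * (k%:R * ((z + bc) / (bc * z + 1)) ^+ k.-1 * ((1 - bc ^+ 2) / (bc * z + 1) ^+ 2))).
Proof.
move=> nz.
have D1 : is_derive z (1 : Cx R) (fun w : Cx R => w + bc) 1.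
  by apply: is_derive_eq (is_deriveD (is_derive_id _ _) (is_derive_cst bc z 1)) _; rewrite addr0.
have D2 : is_derive z (1 : Cx R) (fun w : Cx R => bc * w + 1) bc.
  have D := is_deriveD (is_deriveZ bc (is_derive_id z (1 : Cx R))) (is_derive_cst (1 : Cx R) z (1 : Cx R)).
  have E : (bc *: (1 : Cx R) : Cx R) + 0 = bc by rewrite addr0 -[LHS]/(bc * 1) mulr1.
  by rewrite E in D; exact: D.
have D3 : is_derive z (1 : Cx R) (fun w : Cx R => (bc * w + 1)^-1) (- (bc * z + 1) ^- 2 *: bc).
  apply: DeriveDef; first by apply: derivableV => //; case: D2.
  have [D2e D2v] := D2; by rewrite (@deriveV _ _ (fun w : Cx R => bc * w + 1) z 1 nz D2e) D2v.
have D4 := is_deriveZ l (is_deriveX k (is_deriveM D1 D3)).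
have E : l *: ((k%:R * ((z + bc) / (bc * z + 1)) ^+ k.-1) *:
   ((z + bc) *: (- (bc * z + 1) ^- 2 *: bc) + (bc * z + 1)^-1 *: (1 : Cx R))) =
  l * (k%:R * ((z + bc) / (bc * z + 1)) ^+ k.-1 * ((1 - bc ^+ 2) / (bc * z + 1) ^+ 2)).
  change (l * ((k%:R * ((z + bc) / (bc * z + 1)) ^+ k.-1) *
   ((z + bc) * (- (bc * z + 1) ^- 2 * bc) + (bc * z + 1)^-1 * 1)) =
  l * (k%:R * ((z + bc) / (bc * z + 1)) ^+ k.-1 * ((1 - bc ^+ 2) / (bc * z + 1) ^+ 2))).
  congr (l * (_ * _)); field; exact: nz.
rewrite -E.
have F : fising b k l = l \*: ((fun w : Cx R => w + bc) * (fun w : Cx R => (bc * w + 1)^-1)) ^+ k.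
  by apply/funext => w; rewrite exprfctE.
by rewrite F; exact: D4.
Qed.

Lemma nc_multiplier (k : nat) th y : nc (expi th * (k%:R * ((expi y + bc) / (bc * expi y + 1)) ^+ k.-1 *
    ((1 - bc ^+ 2) / (bc * expi y + 1) ^+ 2))) = k%:R * dGam b y.
Proof.
have b2 := b2_gt1 hb.
rewrite mobius_expi// !ncM ncX !nc_expi expr1n mulr1 mul1r nc_nat ncV ncX bexpi_Nsq.
congr (_ * (_ / _)).
have -> : 1 - bc ^+ 2 = ((1 - b ^+ 2)%:C : Cx R) by rewrite rmorphB rmorphXn.
by rewrite ncC ltr0_norm ?opprB//; lra.
Qed.

Lemma fising_cvg (k : nat) l z : bc * z + 1 != 0 -> fising b k l @ z --> fising b k l z.
Proof.
move=> nz; have [D _] := is_derive_fising k l nz.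
exact/differentiable_continuous/derivable1_diffP.
Qed.

Lemma pole_near z : bc * z + 1 != 0 -> \forall w \near z, bc * w + 1 != 0.
Proof.
move=> nz.
have hb1 := hb; have b0 : 0 < b by lra.
have n0 : 0 < nc (bc * z + 1) by rewrite lt_def nc_eq0 nz nc_ge0.
apply/nbhs_nc; exists (nc (bc * z + 1) / b); first by rewrite divr_gt0.
move=> w; rewrite ltr_pdivlMr// mulrC => h; apply/eqP => E.
have : bc * z + 1 = - (bc * (w - z)) by rewrite -[LHS]subr0 -E; ring.
move=> /(congr1 (@nc R)); rewrite ncN ncM ncC gtr0_norm// => E2.
by rewrite E2 ltxx in h.
Qed.

Lemma attracting_contract (k : nat) l al mu : bc * al + 1 != 0 ->
  fixed_multiplier (fising b k l) al mu -> nc mu < 1 ->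
  exists e c : R, [/\ 0 < e, 0 <= c, c < 1 & forall w, nc (w - al) < e ->
    bc * w + 1 != 0 /\ nc (fising b k l w - al) <= c * nc (w - al)].
Proof.
move=> nz [fa [D Dmu]] mu1.
pose c := (1 + nc mu) / 2.
have mu0 := nc_ge0 mu.
have cmu : 0 < c - nc mu by rewrite /c; lra.
have D' : (fun h : Cx R => h^-1 *: (fising b k l (h *: (1 : Cx R) + al) - fising b k l al)) @ 0^' --> mu.
  by rewrite -Dmu; exact: D.
have := D' _ (near_nc _ cmu); rewrite /= => /nbhs_nc[e1 e10 H1].
have /nbhs_nc[e2 e20 H2] := pole_near nz.
exists (Num.min e1 e2), c; split; [by rewrite lt_min e10|by rewrite /c; lra|by rewrite /c; lra|].
move=> w; rewrite lt_min => /andP[w1 w2]; split; first exact: H2.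
have [->|wal] := eqVneq w al; first by rewrite fa subrr nc0 mulr0.
have wal0 : w - al != 0 by rewrite subr_eq0.
have h := H1 (w - al); rewrite subr0 in h; have {h} := h w1 wal0.
rewrite /= fa -[(w - al) *: _]/((w - al) * 1) mulr1 subrK -[_ *: _]/((w - al)^-1 * (fising b k l w - al)) => h.
have n0 : 0 < nc (w - al) by rewrite lt_def nc_eq0 wal0 nc_ge0.
have h2 := ncB_ge ((w - al)^-1 * (fising b k l w - al)) mu.
have h3 : nc ((w - al)^-1 * (fising b k l w - al)) <= c.
  by move: h h2; set u := nc _; set v := nc _; lra.
by move: h3; rewrite ncM ncV mulrC ler_pdivrMr.
Qed.

Local Notation F := (Fising b).

Lemma Fising_cvg (k : nat) l z : bc * z + 1 != 0 ->
  F k l @ (Some z : riemann_sphere R) --> F k l (Some z).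
Proof.
move=> nz A; rewrite /= (negbTE nz) => hA; apply/nbhs_Some.
have := fising_cvg nz hA; have := pole_near nz.
by apply: filterS2 => w wz /= Aw; rewrite /= (negbTE wz).
Qed.

Lemma subseq_choice (P : nat -> nat -> Prop) :
  (forall j i0, exists2 i, (i0 <= i)%N & P j i) ->
  exists2 phi : nat -> nat, {homo phi : i j / (i < j)%N} & forall j, P j (phi j).
Proof.
move=> H.
have /boolp.choice[f hf] : forall ji : nat * nat, exists i, (ji.2 <= i)%N /\ P ji.1 i.
  by move=> [j i0]; have [i h1 h2] := H j i0; exists i.
pose phi := fix phi j := if j is i.+1 then f (i.+1, (phi i).+1) else f (0%N, 0%N).
exists phi; last by case=> [|j] /=; [have [] := hf (0, 0)%N|have [] := hf (j.+1, (phi j).+1)].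
apply: (@homo_ltn _ phi (fun i j => is_true (i < j)%N)); first by move=> y x z; exact: ltn_trans.
by move=> j /=; have [] := hf (j.+1, (phi j).+1).
Qed.

(** Normality is tested on arbitrary sequences of exponents, bounded ones included: some subsequence
    either grows at least like its index or is constant. *)
Lemma subseq_dichotomy (n : nat -> nat) :
  (exists2 phi : nat -> nat, {homo phi : i j / (i < j)%N} & forall j, (j <= n (phi j))%N) \/
  (exists2 phi : nat -> nat, {homo phi : i j / (i < j)%N} & exists m, forall j, n (phi j) = m).
Proof.
have [H|/existsNP[j /existsNP[i0 H]]] := pselect (forall j i0, exists2 i, (i0 <= i)%N & (j <= n i)%N).
  by left; exact: (@subseq_choice (fun j i => is_true (j <= n i)%N) H).
right.
have {}H i : (i0 <= i)%N -> (n i < j)%N.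
  by move=> ii; rewrite ltnNge; apply/negP => h; apply: H; exists i.
elim: j => [|j IH] in i0 H *; first by have := H i0 (leqnn _).
have [H'|/existsNP[i1 H']] := pselect (forall i1, exists2 i, (i1 <= i)%N & n i = j).
  have [phi h1 h2] := @subseq_choice (fun _ i => n i = j) (fun _ => H').
  by exists phi => //; exists j.
apply: (IH (maxn i0 i1)) => i; rewrite geq_max => /andP[ii0 ii1].
have := H i ii0; rewrite ltnS leq_eqVlt => /orP[/eqP E|//].
by exfalso; apply: H'; exists i.
Qed.

(** On a neighbourhood whose N-th image lies in the contracted disc, iterates with growing exponents
    converge uniformly to [al], so the limit is constant; for constant exponents the limit is the
    iterate itself. *)
Lemma fatou_attracted (k : nat) l al (e c : R) z N : 0 < e -> 0 <= c -> c < 1 ->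
  (forall w, nc (w - al) < e -> bc * w + 1 != 0 /\ nc (fising b k l w - al) <= c * nc (w - al)) ->
  (forall n, bc * iter n (fising b k l) z + 1 != 0) ->
  nc (iter N (fising b k l) z - al) < e -> fatou_set (F k l) (Some z).
Proof.
move=> e0 c0 c1 HC nz zN.
set f := fising b k l in HC nz zN *; set G := F k l.
pose B : set (Cx R) := [set w | nc (w - al) < e].
have fB w : B w -> B (f w).
  move=> Bw; have [_ h] := HC w Bw; apply: le_lt_trans h _.
  by apply: le_lt_trans Bw; rewrite ler_piMl ?nc_ge0// ltW.
have oB : open B by exact: open_disc.
(* [V n] is the open set of points that reach the disc after [n] steps without meeting the pole. *)
pose V := fix V n : set (Cx R) := if n is m.+1 then [set w | bc * w + 1 != 0 /\ V m (f w)] else B.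
have Vf n w : V n w -> bc * w + 1 != 0 /\ V n.-1 (f w).
  by case: n => [|n] //= Bw; split; [have [] := HC w Bw|exact: fB].
have oV n : open (V n).
  elim: n => [//|n IH]; rewrite openE => w [wz Vw].
  have := fising_cvg wz (open_nbhs_nbhs (conj IH Vw)); have := pole_near wz.
  by apply: filterS2 => v vz /= Vv.
have VN : V N z.
  suff H n m : (n + m = N)%N -> V n (iter m f z) by exact: (H N 0%N (addn0 N)).
  elim: n m => [|n IH] m E /=; first by rewrite -E add0n in zN.
  by split; [exact: nz|rewrite -iterS; apply: IH; rewrite addnS -addSn].
have itG n m w : V n w -> iter m G (Some w) = Some (iter m f w).
  elim: m n w => // m IH n w Vw; have [wz Vw'] := Vf _ _ Vw.
  by rewrite !iterSr /= (negbTE wz); exact: IH Vw'.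
have conG n m w : V n w -> iter m G @ (Some w : riemann_sphere R) --> iter m G (Some w).
  elim: m n w => [|m IH] n w Vw; first exact: cvg_id.
  have [wz Vw'] := Vf _ _ Vw.
  have -> : iter m.+1 G = iter m G \o G by apply/funext => x; rewrite iterSr.
  apply: (@cvg_comp _ _ _ _ _ _ (nbhs (G (Some w)))); first exact: Fising_cvg.
  rewrite /= (negbTE wz); exact: IH Vw'.
have itB n w : V n w -> B (iter n f w).
  elim: n w => // n IH w Vw; have [_ Vw'] := Vf _ _ Vw; rewrite iterSr; exact: IH.
have geo m w : B w -> nc (iter m f w - al) <= c ^+ m * e /\ B (iter m f w).
  elim: m => [|m IH] Bw; first by rewrite expr0 mul1r; split => //; exact: ltW.
  have [h1 h2] := IH Bw; split; last exact: fB.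
  have [_ h] := HC _ h2; apply: le_trans h _; rewrite exprS -mulrA.
  exact: ler_wpM2l.
pose U : set (riemann_sphere R) := Some @` V N.
exists U; split; first exact: one_point_compactification_open_some.
  by exists z.
move=> n; have [[phi h1 h2]|[phi h1 [m h2]]] := subseq_dichotomy n; exists phi => //.
  exists (fun=> Some al); first by apply/subspace_continuousP => x _; exact: cvg_cst.
  move=> K O cK KU oO gO.
  have [[x0 Kx0]|K0] := pselect (exists x, K x); last first.
    by near=> j; move=> y [x Kx]; exfalso; apply: K0; exists x.
  have /nbhs_nc[r r0 Hr] : nbhs al (Some @^-1` O).
    have Oal : O (Some al) by apply: gO; exists x0.
    exact: (open_nbhs_nbhs (conj oO Oal)).
  have cc : (fun m => c ^+ m) @ \oo --> (0 : R) by apply: cvg_expr; rewrite ger0_norm.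
  have [M _ HM] := cvgr_lt 0 cc (r / e) (divr_gt0 r0 e0).
  exists (N + M)%N => // j /= hj y [x Kx <-].
  have [w Vw <-] := KU _ Kx; rewrite (itG _ _ _ Vw); apply: Hr.
  have := h2 j => nj.
  have E : (n (phi j) = (n (phi j) - N) + N)%N by rewrite subnK//; lia.
  rewrite E iterD; have [h _] := geo (n (phi j) - N)%N _ (itB _ _ Vw).
  apply: le_lt_trans h _; rewrite -ltr_pdivlMr//; apply: HM => /=; lia.
exists (iter m G).
  apply/subspace_continuousP => x [w Vw <-].
  by apply: cvg_within_filter; exact: conG Vw.
move=> K O cK KU oO gO; near=> j; rewrite h2; exact: gO.
Unshelve. all: by end_near. Qed.

End Ising.

Section Sphere.
Variable R : realType.
Implicit Types (z w : Cx R).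

Lemma sphere_separated (y : riemann_sphere R) z : y <> Some z ->
  exists O : set (riemann_sphere R), [/\ open O, O y & ~ O (Some z)].
Proof.
case: y => [w wz|_].
  have n0 : 0 < nc (z - w).
    by rewrite lt_def nc_ge0 nc_eq0 subr_eq0 andbT; apply/eqP => E; apply: wz; rewrite E.
  exists (Some @` [set v | nc (v - w) < nc (z - w)]); split.
  - exact/one_point_compactification_open_some/open_disc.
  - by exists w => //=; rewrite subrr nc0.
  - by move=> [v hv [E]]; move: hv; rewrite /= E ltxx.
exists (~` [set (Some z : riemann_sphere R)]); split => //; last by move=> /(_ erefl).
rewrite openE => -[v|] hv.
  apply/nbhs_Some/nbhs_nc; exists (nc (z - v)).
    rewrite lt_def nc_ge0 nc_eq0 subr_eq0 andbT; apply/eqP => E; apply: hv; by rewrite E.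
  by move=> w /= h [E]; rewrite E ltxx in h.
exists [set z].
  split; first exact: compact_set1.
  by apply: accessible_closed_set1; apply: hausdorff_accessible; exact: norm_hausdorff.
by move=> x [[w wz <-]|->] // [E]; apply: wz.
Qed.

Lemma unit_expi z (m : R) : nc z = 1 -> exists2 x, m - pi <= x <= m + pi & z = expi x.
Proof.
have base z' : nc z' = 1 -> exists2 x, - pi <= x <= pi & z' = expi x.
  case: z' => u v; rewrite nc_def /= => h.
  have E : u ^+ 2 + v ^+ 2 = 1.
    by rewrite -[LHS]sqr_sqrtr ?h ?expr1n// addr_ge0// sqr_ge0.
  have u1 : -1 <= u <= 1 by have := sqr_ge0 v => ?; apply/andP; split; nra.
  have a0 := acos_ge0 u1; have ap := acos_lepi u1.
  have s : sin (acos u) = `|v|.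
    by rewrite sin_acos// -E addrAC subrr add0r sqrtr_sqr.
  have [v0|v0] := leP 0 v.
    exists (acos u); first by apply/andP; split => //; have := pi_gt0 R; lra.
    by rewrite /expi acosK ?in_itv// s ger0_norm.
  exists (- acos u); first by apply/andP; split; lra.
  by rewrite /expi cosN sinN acosK ?in_itv// s ltr0_norm// opprK.
move=> z1; have [|x /andP[x1 x2] E] := base (z * expi (- m)); first by rewrite ncM nc_expi mulr1.
exists (m + x); first by apply/andP; split; lra.
by rewrite expiD -E mulrCA -expiD subrr expi0 mulr1.
Qed.

Lemma continuous_proj (u v : R) : continuous (fun z : Cx R => complex.Re z * u + complex.Im z * v).
Proof.
move=> z A /(@nbhs_ballP R R)[e /= e0 He].
have re (w : Cx R) : `|complex.Re w| <= nc w.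
  by rewrite nc_def -sqrtr_sqr ler_sqrt ?lerDl ?sqr_ge0// addr_ge0// sqr_ge0.
have im (w : Cx R) : `|complex.Im w| <= nc w.
  by rewrite nc_def -sqrtr_sqr ler_sqrt ?lerDr ?sqr_ge0// addr_ge0// sqr_ge0.
have s0 : 0 < `|u| + `|v| + 1 by rewrite ltr_wpDl// addr_ge0.
apply/nbhs_nc; exists (e / (`|u| + `|v| + 1)); first by rewrite divr_gt0.
move=> w; rewrite ltr_pdivlMr// => h; apply: He; rewrite /ball /=.
have -> : complex.Re z * u + complex.Im z * v - (complex.Re w * u + complex.Im w * v) =
  - (complex.Re (w - z) * u + complex.Im (w - z) * v).
  by case: z {h} => a1 a2; case: w => b1 b2 /=; ring.
rewrite normrN; apply: le_lt_trans (ler_normD _ _) _; rewrite !normrM.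
have h1 : `|complex.Re (w - z)| * `|u| <= nc (w - z) * `|u| by rewrite ler_wpM2r.
have h2 : `|complex.Im (w - z)| * `|v| <= nc (w - z) * `|v| by rewrite ler_wpM2r.
have h3 := nc_ge0 (w - z).
move: h h1 h2 h3; set c := nc _; set a := _ * `|u|; set a' := _ * `|v|; lra.
Qed.

End Sphere.

(** * The endpoints of the arc lie in the Julia set *)

Section Julia.
Variables (R : realType) (b : R) (d : nat).
Hypotheses (hb : 1 < b) (hd : (2 <= d)%N).
Local Notation Phi := (Phi b).
Local Notation dyn := (dyn b d).
Local Notation bc := (b%:C : Cx R).
Local Notation F2 th := (fun x => Phi d th (Phi d th x)).
Local Notation F := (Fising b).
Variables (th p a q : R).
Hypothesis D : dyn th p a q.

Lemma iter_fising (k n : nat) x :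
  iter n (fising b k (expi th)) (expi x) = expi (iter n (Phi k th) x).
Proof. by elim: n => //= n ->; rewrite fising_expi. Qed.

Lemma iter_Fising (k n : nat) x :
  iter n (F k (expi th)) (Some (expi x)) = Some (expi (iter n (Phi k th) x)).
Proof. by elim: n => //= n ->; rewrite /= (negbTE (bexpi_neq0 hb _)) fising_expi. Qed.

Lemma iter_double (f : R -> R) n x : iter n.*2 f x = iter n (fun x => f (f x)) x.
Proof. by elim: n => //= n ->. Qed.

(** Apply normality to the even iterates. A limit g fixes e^(ic), hence by continuity stays near
    e^(ic) at nearby points; but arbitrarily close points of the arc are attracted to e^(ia), at
    distance 2 r. *)
Lemma endpoint_not_fatou (c : R) : F2 th c = c -> expi c != expi a ->
  (forall r : R, 0 < r -> exists2 x : R, p < x < q & `|x - c| < r) ->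
  ~ fatou_set (F d (expi th)) (Some (expi c)).
Proof.
move=> Fc ca near_c [U [oU Uc /(_ double)[phi hphi [g cg Hg]]]].
have phij j : (j <= phi j)%N.
  by elim: j => // j IH; apply: leq_ltn_trans IH _; exact: hphi.
pose r := nc (expi c - expi a) / 2.
have r0 : 0 < r by rewrite divr_gt0// lt_def nc_ge0 nc_eq0 subr_eq0 ca.
have cst_iter n : iter n.*2 (F d (expi th)) (Some (expi c)) = Some (expi c).
  by rewrite iter_Fising iter_double iter_fix.
have gc : g (Some (expi c)) = Some (expi c).
  apply: contrapT => /sphere_separated [W0 [oO Og Oc]].
  have [| | | |N _ HN] := Hg [set Some (expi c)] W0.
  - exact: compact_set1.
  - by move=> _ ->.
  - exact: oO.
  - by move=> _ [_ -> <-].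
  by apply: Oc; apply: (HN N (leqnn N)); exists (Some (expi c)); rewrite // cst_iter.
pose O1 : set (riemann_sphere R) := Some @` [set w | nc (w - expi c) < r].
have oO1 : open O1 by exact/one_point_compactification_open_some/open_disc.
have O1c : O1 (g (Some (expi c))) by rewrite gc; exists (expi c); rewrite //= subrr nc0.
move/subspace_continuousP: cg => cg.
have := cg _ Uc _ (open_nbhs_nbhs (conj oO1 O1c)) => /= W.
have /nbhs_nc[r1 r10 H1] : nbhs (expi c) [set w | U (Some w) /\ O1 (g (Some w))].
  have U1 := open_nbhs_nbhs (conj oU Uc).
  have : nbhs (Some (expi c) : riemann_sphere R) [set y | U y /\ O1 (g y)].
    by apply: filterS2 U1 W => y Uy Wy; split => //; exact: Wy.
  by move=> /nbhs_Some.
have [x xpq xc] := near_c (r1 / 2) ltac:(by rewrite divr_gt0).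
have [Ux Ox] : U (Some (expi x)) /\ O1 (g (Some (expi x))).
  by apply: H1; apply: le_lt_trans (expi_lip _ _) _; lra.
have [n0 hn0] := att hb hd D xpq (e := r / 3) ltac:(by rewrite divr_gt0).
have [| | | |N _ HN] := Hg [set Some (expi x)] O1.
- exact: compact_set1.
- by move=> _ ->.
- exact: oO1.
- by move=> _ [_ -> <-].
have := HN (maxn N n0) (leq_maxl _ _) => /(_ (Some (expi (iter (phi (maxn N n0)) (F2 th) x)))).
case.
  by exists (Some (expi x)) => //; rewrite iter_Fising iter_double.
move=> w /= h [E]; rewrite E in h.
have := hn0 (phi (maxn N n0)) (leq_trans (leq_maxr N n0) (phij _)).
move: h; set t := iter _ _ _ => h /andP[t1 t2].
have h2 : nc (expi t - expi a) <= 2 * `|t - a| by exact: expi_lip.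
have h3 : `|t - a| < r / 3 by rewrite ltr_norml; apply/andP; split; lra.
have := le_ncD (expi c - expi t) (expi t - expi a); rewrite addrA subrK ncB.
have : nc (expi c - expi a) = 2 * r by rewrite /r; field.
move=> ->; move: h h2 h3; set u := nc _; set v := nc _; set s := `|_|; lra.
Qed.

End Julia.

(** * Identification of the Fatou component with the arc (p, q) *)

Section Arc.
Variables (R : realType) (b : R) (d : nat).
Hypotheses (hb : 1 < b) (hd : (2 <= d)%N).
Local Notation Phi := (Phi b).
Local Notation dyn := (dyn b d).
Local Notation bc := (b%:C : Cx R).
Local Notation F2 th := (fun x => Phi d th (Phi d th x)).
Local Notation F := (Fising b).
Variables (th p a q : R).
Hypothesis D : dyn th p a q.

Lemma expi_close (x y : R) : 0 < `|x - y| < 2 * pi -> expi x != expi y.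
Proof.
move=> /andP[h1 h2]; apply/eqP => /expi_inj[z E]; have pi0 := pi_gt0 R.
have z0 : z = 0.
  move: h2; rewrite E addrAC subrr add0r ltr_norml => /andP[u1 u2].
  apply: int_eq0; first by rewrite -(ltr_int R) -(ltr_pM2l (x := 2 * pi)); lra.
  by rewrite -(ltr_int R) -(ltr_pM2l (x := 2 * pi)); lra.
by move: h1; rewrite E z0 mulr0 addr0 subrr normr0 ltxx.
Qed.

Lemma multiplier_expi (y : R) mu : fixed_multiplier (fising b d (expi th)) (expi y) mu ->
  nc mu = d%:R * dGam b y.
Proof.
move=> [_ [_ <-]]; rewrite -(nc_multiplier hb d th y).
by have [_ ->] := is_derive_fising d (expi th) (bexpi_neq0 hb y).
Qed.

Lemma multiplier_exists : exists2 mu, fixed_multiplier (fising b d (expi th)) (expi a) mu & nc mu < 1.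
Proof.
have [[p0 pa aq qt tp] [[ea ep eq] _]] := D.
have H := is_derive_fising d (expi th) (bexpi_neq0 hb a).
eexists; first by split; [rewrite fising_expi// ea|exact: H].
rewrite nc_multiplier//; apply: (fixed_attracting hb hd pa aq _ ea ep eq).
have := pi_gt0 R; lra.
Qed.

Lemma arc_fatou (x : R) : p < x < q -> fatou_set (F d (expi th)) (Some (expi x)).
Proof.
move=> xpq; have [mu H1 H2] := multiplier_exists.
have [e [c [e0 c0 c1 HC]]] := attracting_contract hb (bexpi_neq0 hb a) H1 H2.
have [n0 hn0] := att hb hd D xpq (e := e / 2) ltac:(by rewrite divr_gt0).
apply: (fatou_attracted hb hd e0 c0 c1 HC (N := n0.*2)).
  by move=> n; rewrite iter_fising//; exact: bexpi_neq0.
rewrite iter_fising// iter_double; apply: le_lt_trans (expi_lip _ _) _.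
have /andP[h1 h2] := hn0 n0 (leqnn _).
rewrite mulrC -ltr_pdivlMr// ltr_norml; apply/andP; split; lra.
Qed.

Lemma p_not_fatou : ~ fatou_set (F d (expi th)) (Some (expi p)).
Proof.
have [[p0 pa aq qt tp] [[ea ep eq] _]] := D; have pi0 := pi_gt0 R.
apply: (endpoint_not_fatou hb hd D); first by rewrite ep eq.
  by apply: expi_close; rewrite distrC gtr0_norm; lra.
move=> r r0; pose m := Num.min (r / 2) ((q - p) / 2).
have m0 : 0 < m by rewrite lt_min !divr_gt0//; lra.
have [m1 m2] : m <= r / 2 /\ m <= (q - p) / 2 by rewrite !ge_min !lexx orbT.
exists (p + m); first by apply/andP; split; lra.
by rewrite addrAC subrr add0r gtr0_norm//; lra.
Qed.

Lemma q_not_fatou : ~ fatou_set (F d (expi th)) (Some (expi q)).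
Proof.
have [[p0 pa aq qt tp] [[ea ep eq] _]] := D; have pi0 := pi_gt0 R.
apply: (endpoint_not_fatou hb hd D); first by rewrite eq ep.
  by apply: expi_close; rewrite gtr0_norm; lra.
move=> r r0; pose m := Num.min (r / 2) ((q - p) / 2).
have m0 : 0 < m by rewrite lt_min !divr_gt0//; lra.
have [m1 m2] : m <= r / 2 /\ m <= (q - p) / 2 by rewrite !ge_min !lexx orbT.
exists (q - m); first by apply/andP; split; lra.
by rewrite addrAC subrr add0r normrN gtr0_norm//; lra.
Qed.

(** Since f_d exchanges p and q, the image arc in [expK] is [p, q] itself; at a fixed point the
    densities on both sides agree and cancel. *)
Lemma repelling_outside (y : R) (m z : int) : Phi d th y = y + 2 * pi * z%:~R ->
  gap p q m y -> 1 <= d%:R * dGam b y.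
Proof.
move=> ey g; have [[p0 pa aq qt tp] [[ea ep eq] _]] := D; have pi0 := pi_gt0 R.
have pq : p < q by lra.
have gz := gapz g.
have K0 : 0 < K p q y.
  by rewrite -(Kz p q y (- m)); apply: K_gt0 => //; lra.
have := expK hb (k := d) (th := th) (z := m + z) (d1 hd) pq g.
rewrite ep eq ey Kz => H.
rewrite -(ler_pM2r K0) mul1r; apply: H.
move: g => /andP[g1 g2]; rewrite !intrD in g2 *; apply/andP; split; lra.
Qed.

(** An attracting fixed point on the circle must lie in (p, q), by [repelling_outside] and because
    the endpoints are not Fatou points. A connected set of Fatou points on the circle cannot leave
    the arc without passing through an endpoint. *)
Lemma Iset_sub w : Iset d b (expi th) w -> exists2 x : R, p < x < q & w = expi x.
Proof.
have [[p0 pa aq qt tp] [[ea ep eq] _]] := D; have pi0 := pi_gt0 R.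
move=> [al [mu Hmu mu1]]; set A := _ `&` _ => Cw.
have [Aal|nA] := pselect (A al); last by move: Cw; rewrite connected_component_out.
have [Fal Sal] := Aal.
pose m := (p + q) / 2.
have nc1' (z : Cx R) : `|z| = 1 -> nc z = 1 by rewrite /nc => ->.
have [y /andP[y1 y2] ey] := unit_expi m (nc1' _ Sal).
have np v : A v -> v != expi p.
  by move=> [Fv _]; apply/eqP => E; apply: p_not_fatou; rewrite -E.
have nq v : A v -> v != expi q.
  by move=> [Fv _]; apply/eqP => E; apply: q_not_fatou; rewrite -E.
pose h := (q - p) / 2.
have h0 : 0 < h < pi by rewrite /h; apply/andP; split; lra.
have arcP x : m - pi <= x -> x <= m + pi -> cos h < cos (x - m) -> p < x < q.
  move=> x1 x2; rewrite -(cos_norm (x - m)) => c.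
  have : `|x - m| < h.
    rewrite ltNge; apply/negP => hh; move: c; apply/negP; rewrite -leNgt.
    have xm : `|x - m| <= pi by rewrite ler_norml; apply/andP; split; lra.
    by rewrite le_eqVlt; move: hh; rewrite le_eqVlt => /orP[/eqP->|hh];
      [rewrite eqxx|rewrite ltr_cos ?hh ?orbT ?in_itv /= ?normr_ge0//; apply/andP; split; lra].
  by rewrite ltr_norml /m /h => /andP[? ?]; apply/andP; split; lra.
have ypq : p < y < q.
  have yp : y != p by apply/eqP => E; have := np _ Aal; rewrite ey E eqxx.
  have yq : y != q by apply/eqP => E; have := nq _ Aal; rewrite ey E eqxx.
  have far (j : int) : gap p q j y -> False.
    move=> g; have Hmu' := Hmu; rewrite ey in Hmu'; have [fy _] := Hmu'.
    rewrite fising_expi// in fy; have [z ez] := expi_inj fy.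
    have := repelling_outside ez g; rewrite -(multiplier_expi Hmu').
    by move: mu1; rewrite ncE -(rmorph1 (@real_complex R)) ltcR; lra.
  apply/andP; split; rewrite ltNge; apply/negP => hh.
    by apply: (far (-1)); rewrite /gap addNr mulrNz mulr0 /=; rewrite /m in y1; move: yp; rewrite eq_le hh /= -ltNge => ?; apply/andP; split; lra.
  by apply: (far 0); rewrite /gap add0r mulr0 mulr1 /=; rewrite /m in y2; move: yq; rewrite eq_le hh andbT -ltNge => ?; apply/andP; split; lra.
(* Projection onto the direction of the midpoint [m]. On the circle the arc is the set where it
   exceeds cos h, and it equals cos h only at the two endpoints, so leaving the arc becomes an
   intermediate value problem. *)
pose L (z : Cx R) := complex.Re z * cos m + complex.Im z * sin m.
have Lexp x : L (expi x) = cos (x - m) by rewrite cosB.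
set C := connected_component A al in Cw.
have cC : connected C by exact: component_connected.
have CA : C `<=` A by exact: connected_component_sub.
have cL : connected (L @` C).
  apply: connected_continuous_connected => //.
  by apply: continuous_subspaceT; exact: continuous_proj.
move/connected_intervalP in cL.
have Lal : cos h < L al.
  rewrite ey Lexp -(cos_norm (y - m)) ltr_cos ?in_itv /= ?normr_ge0 /=.
  - by rewrite ltr_norml /m /h; move/andP: ypq => [? ?]; apply/andP; split; lra.
  - by rewrite ler_norml; apply/andP; split; lra.
  - by apply/andP; split; lra.
have Aw := CA _ Cw; have [Fw Sw] := Aw.
have [x /andP[x1 x2] ex] := unit_expi m (nc1' _ Sw).
exists x => //; apply: arcP => //; rewrite -Lexp -ex ltNge; apply/negP => Lw.
have [v Cv Lv] : (L @` C) (cos h).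
  have C1 : (L @` C) (L w) by exists w.
  have C2 : (L @` C) (L al).
    by exists al => //; apply: connected_component_refl.
  apply: (cL (L w) (L al)) => //.
  by rewrite Lw ltW.
have Av := CA _ Cv; have [_ Sv] := Av.
have [t /andP[t1 t2] et] := unit_expi m (nc1' _ Sv).
move: Lv; rewrite et Lexp -cos_norm => /cos_inj E.
have {}E : `|t - m| = h.
  by apply: E; rewrite in_itv /= ?normr_ge0 /=; [rewrite ler_norml|]; apply/andP; split; lra.
have [E1|E1] := leP 0 (t - m).
  have := nq _ Av; rewrite et; move: E; rewrite ger0_norm// => E.
  have -> : t = q by move: E; rewrite /m /h; lra.
  by rewrite eqxx.
have := np _ Av; rewrite et; move: E; rewrite ltr0_norm// => E.
have -> : t = p by move: E; rewrite /m /h; lra.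
by rewrite eqxx.
Qed.

Lemma arc_Iset (x : R) : p < x < q -> Iset d b (expi th) (expi x).
Proof.
have [[p0 pa aq qt tp] _] := D.
move=> xpq; exists (expi a).
  have [mu H1 H2] := multiplier_exists; exists mu => //.
  by rewrite ncE -(rmorph1 (@real_complex R)) ltcR.
have apq : p < a < q by rewrite pa aq.
apply: (@connected_component_max _ _ (@expi R @` `]p, q[%classic)).
- by exists a => //=; rewrite in_itv.
- move=> _ [t /= tpq <-]; rewrite in_itv /= in tpq; split; first exact: arc_fatou.
  by rewrite /unit_circle /= ncE nc_expi.
- apply: connected_continuous_connected; first exact/connected_intervalP/interval_is_interval.
  by apply: continuous_subspaceT; exact: continuous_expi.
by exists x => //=; rewrite in_itv.
Qed.

(** The closure in the hypothesis is what reaches the endpoints, as limits of points of the arc. The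
    inclusion holds on the circle; it lifts without a multiple of 2 pi because all angles involved
    lie in (-pi, pi). *)
Lemma invariance_lift (k : nat) (x : R) : (1 <= k < d)%N ->
  closure ((fising b 1 (expi th) \o fising b k (expi th)) @` Iset d b (expi th)) `<=` Iset d b (expi th) ->
  p <= x <= q -> p < Phi 1 th (Phi k th x) < q.
Proof.
move=> /andP[k1 kd] H /andP[px xq].
have [[p0 pa aq qt tp] [[ea ep eq] _]] := D; have pi0 := pi_gt0 R.
have [y /andP[py yq] ey] : exists2 y, p < y < q & expi (Phi 1 th (Phi k th x)) = expi y.
  apply: Iset_sub; apply: H => B /nbhs_nc[r r0 Hr].
  have c1 : continuous (fun t => Phi 1 th (Phi k th t)).
    by move=> t; apply: (@continuous_comp _ _ _ (Phi k th) (Phi 1 th)); exact: continuous_Phi.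
  have /(@nbhs_ballP R R)[e /= e0 He] := c1 x _ (nbhsx_ballx (Phi 1 th (Phi k th x)) (r / 2) ltac:(by rewrite divr_gt0)).
  have [x' /andP[px' xq'] xx'] : exists2 x', p < x' < q & `|x - x'| < e.
    (* Moving [x] towards [a] by this small fraction gives a point inside the arc at distance less
       than [e]. *)
    pose w := Num.min (1 / 2) (e / (4 * (q - p))).
    have w0 : 0 < w by rewrite lt_min !divr_gt0// mulr_gt0//; lra.
    have [w1 w2] : w <= 1 / 2 /\ w <= e / (4 * (q - p)) by rewrite !ge_min !lexx orbT.
    have w3 : w * (q - p) <= e / 4.
      have w4 : w * (4 * (q - p)) <= e by rewrite -ler_pdivlMr// mulr_gt0//; lra.
      lra.
    exists (x + w * (a - x)).
      by apply/andP; split; nra.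
    rewrite opprD addrA subrr sub0r normrN normrM gtr0_norm//.
    apply: le_lt_trans (_ : w * (q - p) < _); last lra.
    by rewrite ler_pM2l// ler_norml; apply/andP; split; lra.
  exists (expi (Phi 1 th (Phi k th x'))); split.
    exists (expi x'); last by rewrite /= !fising_expi.
    by apply: arc_Iset; rewrite px' xq'.
  apply: Hr; apply: le_lt_trans (expi_lip _ _) _.
  have := He x' xx'; rewrite /= /ball /= distrC; lra.
have [z ez] := expi_inj ey.
have x0 : 0 <= x by lra.
have xpi : x < pi by lra.
have G0 : 0 <= Gam b x by rewrite Gam_ge0.
have kd' : k%:R * Gam b x <= d%:R * Gam b x by rewrite ler_wpM2r// ler_nat ltnW.
have pF : p <= Phi d th x by rewrite -eq Phi_le ?(d1 hd).
have P1 : 0 <= Phi k th x by move: pF; rewrite /Phi; lra.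
have P2 : Phi k th x < pi.
  have : 0 <= k%:R * Gam b x by rewrite mulr_ge0.
  rewrite /Phi; lra.
have G1 : 0 <= Gam b (Phi k th x) by rewrite Gam_ge0.
have G2 : Gam b (Phi k th x) < pi by rewrite Gam_ltpi.
have E : Phi 1 th (Phi k th x) = th - Gam b (Phi k th x) by rewrite {1}/Phi mul1r.
suff z0 : z = 0 by move: ez; rewrite z0 mulr0 addr0 => ->; rewrite py yq.
apply: int_eq0.
  rewrite -(ltr_int R) -(ltr_pM2l (x := 2 * pi)); lra.
rewrite -(ltr_int R) -(ltr_pM2l (x := 2 * pi)); lra.
Qed.

End Arc.

(** * The parameters lambda0 and lambda1 *)

Section Angles.
Variables (R : realType) (b : R) (d : nat).
Hypotheses (hb : 1 < b) (hd : (2 <= d)%N).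
Hypothesis hdb : d%:R * (b - 1) < b + 1.
Local Notation Phi := (Phi b).
Local Notation dyn := (dyn b d).
Local Notation bc := (b%:C : Cx R).

Lemma dGam_lt (x y : R) : 0 <= x -> x < y -> y <= pi -> dGam b x < dGam b y.
Proof.
move=> x0 xy yp; have hb1 := hb.
rewrite /dGam ltr_pM2l ?b2_gt1// ltf_pV2 ?posrE ?Nsq_gt0//.
rewrite /Nsq ltrD2l ltr_pM2l; last lra.
by rewrite ltr_cos// in_itv /=; apply/andP; split; lra.
Qed.

(** The upper bound on b enters here: d (b - 1) / (b + 1) < 1 makes the fixed point 1 attracting for
    the parameter 1. *)
Lemma d_dGam0 : d%:R * dGam b 0 < 1.
Proof.
have hb1 := hb; have hd1 := hdb.
rewrite /dGam /Nsq cos0 mulr1 mulrA ltr_pdivrMr ?mul1r; last by nra.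
have -> : b ^+ 2 + 1 + 2 * b = (b + 1) * (b + 1) by ring.
have -> : d%:R * (b ^+ 2 - 1) = (d%:R * (b - 1)) * (b + 1) by ring.
by rewrite ltr_pM2r//; lra.
Qed.

Lemma is_derive_psi (x : R) : is_derive x 1 (fun x => Phi d x x) (1 - d%:R * dGam b x).
Proof.
have H : is_derive x 1 (fun x => Phi d 0 x) (- (d%:R * dGam b x)) by exact: is_derive_Phi.
have -> : (fun x : R => Phi d x x) = (fun x : R => x) + (fun x : R => Phi d 0 x).
  by apply/funext => y; rewrite addrfctE /Phi sub0r.
by apply: is_deriveD.
Qed.

(** The function psi x = Phi d x x lifts the angle of f_d(l) at l = e^(ix). It vanishes at 0,
    increases there and is negative at pi, so its first positive zero lies before pi and is [th0].
    The mean value theorem gives [r] with psi' r = 0; as [dGam] increases on [0, pi], psi decreases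
    beyond [r]. *)
Lemma lambda0_angle l0 : is_lambda0 d b l0 -> exists th0 r : R,
  [/\ l0 = expi th0, 0 < r, r < th0 & th0 < pi] /\
  [/\ Phi d th0 th0 = 0, d%:R * dGam b r = 1 & forall th, th0 < th -> th <= pi -> Phi d th th < 0].
Proof.
move=> [th0 [t0 el0 ef hmin]]; have pi0 := pi_gt0 R.
pose psi (x : R) := Phi d x x.
have cpsi : continuous psi by move=> x; exact: (is_derive_cvg (is_derive_psi x)).
have psi0 : psi 0 = 0 by rewrite /psi /Phi Gam0 mulr0 subr0.
have psipi : psi pi < 0.
  have d2 : 2 <= d%:R :> R by rewrite ler_nat.
  by rewrite /psi /Phi Gampi; nra.
have [e e0 He] := zero_pos (is_derive_psi 0) psi0 ltac:(by rewrite subr_gt0; exact: d_dGam0).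
have nz x : 0 < x -> psi x = 0 -> th0 <= x.
  by move=> x0 hx; apply: hmin => //; rewrite fising_expi// -/(psi x) hx expi0.
have pos y x : 0 < y -> psi x < 0 -> y < x -> 0 < psi y -> exists2 t, y < t < x & psi t = 0.
  move=> y0 xn yx yp.
  have [|t] := @IVT R psi y x 0 (ltW yx) (continuous_subspaceT cpsi).
    by rewrite ge_min le_max (ltW xn) (ltW yp) !orbT.
  rewrite in_itv /= => /andP[t1 t2] ht; exists t => //.
  rewrite !lt_neqAle t1 t2 !andbT; apply/andP; split; apply/eqP => E.
    by rewrite E ht ltxx in yp.
  by rewrite -E ht ltxx in xn.
have near0 x : 0 < x -> exists2 y, 0 < y < x & 0 < psi y.
  move=> x0; exists (Num.min x e / 2).
    have : 0 < Num.min x e by rewrite lt_min x0.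
    have : Num.min x e <= x by rewrite ge_min lexx.
    by move=> *; apply/andP; split; lra.
  have m0 : 0 < Num.min x e by rewrite lt_min x0.
  have me : Num.min x e <= e by rewrite ge_min lexx orbT.
  by have [_ ] := He (Num.min x e / 2) ltac:(apply/andP; split; lra); apply; lra.
have th0pi : th0 < pi.
  have [y /andP[y0 ypi] yp] := near0 pi pi0.
  have [t /andP[t1 t2] ht] := pos _ _ y0 psipi ypi yp.
  by apply: le_lt_trans t2; apply: nz => //; lra.
have psith0 : psi th0 = 0.
  rewrite el0 fising_expi// -expi0 in ef; have [z ez] := expi_inj ef.
  rewrite add0r -/(psi th0) in ez.
  have [h|h|//] := ltgtP (psi th0) 0.
    have [y /andP[y0 ypi] yp] := near0 th0 t0.
    have [t /andP[t1 t2] ht] := pos _ _ y0 h ypi yp.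
    have := nz t ltac:(lra) ht; lra.
  have G : 0 <= d%:R * Gam b th0 by rewrite mulr_ge0// Gam_ge0// ltW.
  have hp : psi th0 < pi by rewrite /psi /Phi; lra.
  have z0 : z = 0.
    apply: int_eq0; rewrite -(ltr_int R) -(ltr_pM2l (x := 2 * pi)); lra.
  by rewrite ez z0 mulr0.
have [r /andP[r0 rt]] := @MVTd R psi (fun x => 1 - d%:R * dGam b x) 0 th0 t0 (fun t _ => is_derive_psi t).
rewrite psith0 psi0 subrr subr0 => /esym/eqP; rewrite mulf_eq0 (gt_eqF t0) orbF subr_eq0 => /eqP hr.
exists th0, r; split => //; split => // th th1 th2.
have [c /andP[c1 c2]] := @MVTd R psi (fun x => 1 - d%:R * dGam b x) th0 th th1 (fun t _ => is_derive_psi t).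
rewrite -/(psi th) psith0 subr0 => ->.
rewrite pmulr_llt0 ?subr_gt0// subr_lt0 {1}hr ltr_pM2l ?ltr0n ?(d1 hd)//.
by apply: dGam_lt; lra.
Qed.

Lemma carg_angle (l : Cx R) : unit_circle l -> 0 < carg l < pi ->
  exists2 y, 0 < y < pi & l = expi y.
Proof.
move=> l1 /andP[c0 c1]; have pi0 := pi_gt0 R.
have n1 : nc l = 1 by rewrite /nc l1.
have [y /andP[y1 y2] E] := unit_expi 0 n1.
exists y => //; move: c0 c1; rewrite /carg -/(nc l) n1 divr1 E /= => c0 c1.
have cy : -1 <= cos y <= 1 by rewrite cos_geN1 cos_le1.
move: c0 c1; case: ifPn => [sy c0 c1|_ c0 _]; last by have := acos_ge0 cy; lra.
have c01 : cos y != 1 by apply/eqP => h; rewrite h acos1 ltxx in c0.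
have c02 : cos y != -1 by apply/eqP => h; rewrite h acosN1 ltxx in c1.
apply/andP; split.
  rewrite ltNge; apply/negP => y0.
  have [h|h] := leP y (- pi).
    have E2 : y = - pi by lra.
    by rewrite E2 cosN cospi eqxx in c02.
  have [h0|h0] := eqVneq y 0; first by rewrite h0 cos0 eqxx in c01.
  have y00 : y < 0 by rewrite lt_neqAle h0.
  have : 0 < sin (- y) by apply: sin_gt0_pi; apply/andP; split; lra.
  by rewrite sinN; lra.
rewrite ltNge; apply/negP => yp.
have E2 : y = pi by lra.
by rewrite E2 cospi eqxx in c02.
Qed.

(** A parabolic point lies on the circle because f_d exchanges the inside and the outside of the
    disc. Its multiplier has modulus d dGam y = 1, so y = r or y = -r; the second would make th1 + r
    + d Gam r, which lies in (0, 2 pi), a multiple of 2 pi. *)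
Lemma lambda1_angle l1 (r : R) : 0 < r -> r < pi -> d%:R * dGam b r = 1 ->
  is_lambda1 d b l1 -> l1 = expi (r + d%:R * Gam b r).
Proof.
move=> r0 rp hr [u1 c1 [z [mu [fz Dz] [m m0 mum]]]]; have pi0 := pi_gt0 R; have hb1 := hb.
have [th1 /andP[t0 tp] el] := carg_angle u1 c1.
have nz : bc * z + 1 != 0.
  apply/eqP => E; move: fz; rewrite /fising E invr0 mulr0 expr0n eqn0Ngt (d1 hd) /= mulr0 => z0.
  by move/eqP: E; rewrite -z0 mulr0 add0r oner_eq0.
have mu1 : nc mu = 1.
  have : nc mu ^+ m = 1 by rewrite -ncX mum nc1.
  by move/eqP; rewrite pexpr_eq1 ?nc_ge0// => /eqP.
have z1 : nc z = 1.
  have E : nc (bc * z + 1) ^+ 2 - nc (z + bc) ^+ 2 = (b ^+ 2 - 1) * (nc z ^+ 2 - 1).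
    rewrite !nc_def !sqr_sqrtr ?addr_ge0 ?sqr_ge0//.
    by case: z {fz Dz nz} => x y /=; ring.
  have n0 : 0 < nc (bc * z + 1) by rewrite lt_def nc_eq0 nz nc_ge0.
  have fn : nc z = (nc (z + bc) / nc (bc * z + 1)) ^+ d.
    by rewrite -{1}fz /fising ncM ncX ncM ncV el nc_expi mul1r.
  have b2 := b2_gt1 hb.
  have g0 := nc_ge0 (z + bc); have gz := nc_ge0 z.
  have [h|h|//] := ltgtP (nc z) 1.
    have : 1 < nc (z + bc) / nc (bc * z + 1).
      rewrite ltr_pdivlMr// mul1r -(ltr_pXn2r (n := 2)) ?nnegrE ?(ltW n0)//.
      rewrite -subr_lt0 E pmulr_rlt0 ?subr_lt0; [by rewrite expr_lt1|lra].
    by move=> h1; have := @exprn_egt1 _ d _ h1; rewrite -fn -lt0n (d1 hd); lra.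
  have h1 : nc (z + bc) / nc (bc * z + 1) < 1.
    rewrite ltr_pdivrMr// mul1r -(ltr_pXn2r (n := 2)) ?nnegrE ?(ltW n0)//.
    rewrite -subr_gt0 E pmulr_rgt0 ?subr_gt0; [by rewrite exprn_egt1|lra].
  have := expr_lt1 (d1 hd) (divr_ge0 g0 (ltW n0)); rewrite h1 -fn => h2; lra.
have [y /andP[y1 y2] ez] := unit_expi 0 z1.
rewrite sub0r add0r in y1 y2.
rewrite ez el in fz Dz; rewrite el.
have hy : d%:R * dGam b y = 1 by rewrite -(multiplier_expi hb (mu := mu) (conj fz Dz)).
have yr : `|y| = r.
  have hy' : d%:R * dGam b `|y| = 1 by rewrite /dGam /Nsq cos_norm.
  have d0 : (0 : R) < d%:R by rewrite ltr0n (d1 hd).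
  have yp : `|y| <= pi by rewrite ler_norml y1.
  have [h|h|//] := ltgtP `|y| r.
    by have := dGam_lt (normr_ge0 y) h (ltW rp); rewrite -(ltr_pM2l d0) hy' hr ltxx.
  by have := dGam_lt (ltW r0) h yp; rewrite -(ltr_pM2l d0) hy' hr ltxx.
have tau := tau_lt_pi hb hd r0 rp hr.
have G0 : 0 < d%:R * Gam b r by rewrite mulr_gt0 ?Gam_gt0// ltr0n (d1 hd).
rewrite fising_expi// in fz; have [k ek] := expi_inj fz.
rewrite /Phi in ek.
have [yp|yn] := leP 0 y.
  rewrite ger0_norm// in yr; rewrite yr in ek.
  have k0 : k = 0 by apply: int_eq0; rewrite -(ltr_int R) -(ltr_pM2l (x := 2 * pi)); lra.
  by congr expi; rewrite k0 mulr0 addr0 in ek; lra.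
rewrite ltr0_norm// in yr; have ey : y = - r by lra.
rewrite ey GamN in ek.
have k1 : 0 < k by rewrite -(ltr_int R) -(ltr_pM2l (x := 2 * pi)); lra.
have k2 : k < 1 by rewrite -(ltr_int R) -(ltr_pM2l (x := 2 * pi)); lra.
by exfalso; clear -k1 k2; lia.
Qed.

Lemma ccw_angle (x y t : R) : 0 <= t -> t < 2 * pi -> 0 <= y - x -> y - x < 2 * pi ->
  expi y = expi x * expi t -> t = y - x.
Proof.
move=> t0 t1 y0 y1; rewrite -expiD => /expi_inj[z E]; have pi0 := pi_gt0 R.
have z0 : z = 0 by apply: int_eq0; rewrite -(ltr_int R) -(ltr_pM2l (x := 2 * pi)); lra.
by rewrite z0 mulr0 addr0 in E; lra.
Qed.

End Angles.

(** * The family of arcs and the conclusion *)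

Section Final.
Variables (R : realType) (b : R) (d : nat).
Hypotheses (hb : 1 < b) (hd : (2 <= d)%N).
Hypothesis hdb : d%:R * (b - 1) < b + 1.
Local Notation Phi := (Phi b).
Local Notation dyn := (dyn b d).

(** Below the angle r + d Gam r the fixed point is smaller than [r], hence attracting. At [th0] the
    point 0 has period 2, which contradicts 0 < p since points below p move strictly; for larger
    parameters p = 0 would give q = th and Phi d th th = 0. *)
Lemma dyn_family (th0 th2 r : R) : 0 < th0 -> 0 < r -> r < pi -> Phi d th0 th0 = 0 ->
  d%:R * dGam b r = 1 -> (forall th, th0 < th -> th <= pi -> Phi d th th < 0) ->
  th2 <= r + d%:R * Gam b r ->
  exists P A Q : R -> R, [/\ forall th, th0 <= th < th2 -> dyn th (P th) (A th) (Q th),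
    th0 < th2 -> P th0 = 0 & forall th, th0 < th < th2 -> 0 < P th].
Proof.
move=> t0 r0 rp psi0 hr psin th2r.
have tau := tau_lt_pi hb hd r0 rp hr.
have d0 : (0 : R) < d%:R by rewrite ltr0n (d1 hd).
have /boolp.choice[f hf] : forall th, exists paq : R * R * R, th0 <= th < th2 ->
   dyn th paq.1.1 paq.1.2 paq.2.
  move=> th; have [/andP[h1 h2]|_] := boolP (th0 <= th < th2); last by exists (0, 0, 0).
  have th_gt0 : 0 < th by lra.
  have [a /andP[a0 ath] ea] := fixpoint_exists hb hd th_gt0.
  have psi_le : Phi d th th <= 0.
    move: h1; rewrite le_eqVlt => /orP[/eqP<-|h]; first by rewrite psi0.
    by apply: ltW; apply: psin => //; lra.
  have ar : a < r.
    rewrite ltNge; apply/negP => ra.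
    have : d%:R * Gam b r <= d%:R * Gam b a by rewrite ler_pM2l// Gam_le.
    by move: ea; rewrite /Phi; lra.
  have da : d%:R * dGam b a < 1.
    by rewrite -[X in _ < X]hr ltr_pM2l//; apply: dGam_lt => //; lra.
  have [p [q D]] := dyn_exists hb hd th_gt0 ltac:(lra) psi_le a0 ea da.
  by exists (p, a, q).
exists (fun th => (f th).1.1), (fun th => (f th).1.2), (fun th => (f th).2); split => //.
  move=> t02; have [[p0 pa aq qt tp] [[ea ep eq] [_ H2 H3 _]]] := hf th0 ltac:(by rewrite lexx t02).
  have F0 : Phi d th0 0 = th0 by rewrite /Phi Gam0 mulr0 subr0.
  apply/eqP; rewrite eq_le p0 andbT leNgt; apply/negP => h.
  have : Phi d th0 ((f th0).1.1) < Phi d th0 0 by rewrite Phi_lt// (d1 hd).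
  rewrite F0 ep => qth.
  have : Phi d th0 th0 < Phi d th0 (f th0).2 by rewrite Phi_lt// (d1 hd).
  rewrite psi0 eq => _.
  have H1 := (hf th0 ltac:(by rewrite lexx t02)).2.2.
  have [H1' _ _ _] := H1.
  by have := H1' 0 h; rewrite F0 psi0 ltxx.
move=> th /andP[h1 h2].
have [[p0 pa aq qt tp] [[ea ep eq] _]] := hf th ltac:(by rewrite (ltW h1) h2).
rewrite lt_neqAle p0 andbT; apply/eqP => E.
have : Phi d th th < 0 by apply: psin => //; lra.
have qth : (f th).2 = th by rewrite -ep -E /Phi Gam0 mulr0 subr0.
by rewrite qth -E in eq; rewrite eq ltxx.
Qed.

End Final.

Theorem theorem6p2 (R : realType) (d : nat) (b : R) (l0 l1 l2 : Cx R)
    (hd : (2 <= d)%N) (hb : 1 < b < (d%:R + 1) / (d%:R - 1))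
    (h0 : is_lambda0 d b l0) (h1 : is_lambda1 d b l1)
    (h2 : is_lambda2 d b l0 l1 l2) :
  Arc_cc l0 l2 `<=` closure (lee_yang_zeros d b).
Proof.
have pi0 := pi_gt0 R.
case/andP: hb => b1 bd.
have d2 : 2 <= d%:R :> R by rewrite ler_nat.
have hdb : d%:R * (b - 1) < b + 1 by move: bd; rewrite ltr_pdivlMr; lra.
have [th0 [r [[el0 r0 rt0 t0p] [psi0 hr psin]]]] := lambda0_angle b1 hd hdb h0.
have rp : r < pi by lra.
have el1 := lambda1_angle b1 hd r0 rp hr h1.
have tau := tau_lt_pi b1 hd r0 rp hr.
pose ta := r + d%:R * Gam b r.
rewrite -/ta in el1 tau.
have d0 : (0 : R) < d%:R by lra.
have t0 : 0 < th0 by lra.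
(* At [th0] the 2-cycle 0, th0 surrounds the fixed point, which is therefore attracting and smaller
   than [r]. *)
have t0ta : th0 < ta.
  have [a /andP[a0 ath] ea] := fixpoint_exists b1 hd t0.
  have F0 : Phi b d th0 0 = th0 by rewrite /Phi Gam0 mulr0 subr0.
  have da := fixed_attracting b1 hd a0 ath ltac:(lra) ea F0 psi0.
  have ar : a < r.
    rewrite ltNge; apply/negP => ra.
    have : d%:R * dGam b r <= d%:R * dGam b a by rewrite ler_pM2l//; apply: dGam_inc => //; lra.
    lra.
  have : d%:R * Gam b a < d%:R * Gam b r by rewrite ltr_pM2l// Gam_lt.
  by move: ea; rewrite /Phi /ta; lra.
case: h2 => -[s [t [/andP[tt0 tt1] et + es]]] hinv _.
rewrite in_itv /= => /andP[s0 st].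
have tE : t = ta - th0.
  by apply: ccw_angle => //; [lra|lra|rewrite -el1 et el0].
pose th2 := th0 + s.
have el2 : l2 = expi th2 by rewrite es el0 -expiD.
have [P [A [Q [hdyn hP0 hPpos]]]] := dyn_family b1 hd t0 r0 rp psi0 hr psin
   (th2 := th2) ltac:(rewrite -/ta /th2; lra).
have t02 : th0 < th2 by rewrite /th2; lra.
have hPQ th : th0 <= th < th2 -> forall k, (1 <= k < d)%N -> forall x, P th <= x <= Q th ->
    P th < Phi b 1 th (Phi b k th x) < Q th.
  move=> hth k hk x hx.
  apply: (invariance_lift b1 hd (hdyn th hth) hk _ hx).
  apply: hinv; last by move: hk; case: (d) hd => // d' _; rewrite ltnS.
  move: hth => /andP[h3 h4].
  exists (th - th0), s; split; [by rewrite (ltW s0); lra|exact: es| |].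
    by rewrite in_itv /= subr_ge0 h3 ltrBlDl.
  by rewrite el0 -expiD subrKC.
move=> z [s' [t' [/andP[t'0 t'1] et' + ez]]].
rewrite in_itv /= => /andP[s'0 s't'].
have t'E : t' = s.
  have -> : s = th2 - th0 by rewrite /th2 addrAC subrr add0r.
  by apply: ccw_angle => //; [rewrite /th2; lra|rewrite /th2; lra|rewrite -el2 et' el0].
rewrite {}t'E in s't' et'.
move=> B; rewrite ez el0 -expiD => /nbhs_nc[e e0 He].
(* An open interval of parameters near the target angle: to its right in general, to its left when
   the target is the end [th2]. *)
have [c1 [c2 [c01 c12 c22 ce]]] : exists c1 c2 : R, [/\ th0 <= c1, c1 < c2, c2 <= th2 &
   forall th, c1 < th < c2 -> `|th - (th0 + s')| < e / 2].
  have [h|h] := ltP (th0 + s') th2.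
    have m1 : Num.min th2 (th0 + s' + e / 2) <= th2 by rewrite ge_min lexx.
    have m2 : Num.min th2 (th0 + s' + e / 2) <= th0 + s' + e / 2 by rewrite ge_min lexx orbT.
    exists (th0 + s'), (Num.min th2 (th0 + s' + e / 2)); split => //; first lra.
      by rewrite lt_min h ltrDl divr_gt0.
    by move=> th /andP[u1 u2]; rewrite gtr0_norm; lra.
  have m1 : th0 <= Num.max th0 (th2 - e / 2) by rewrite le_max lexx.
  have m2 : th2 - e / 2 <= Num.max th0 (th2 - e / 2) by rewrite le_max lexx orbT.
  exists (Num.max th0 (th2 - e / 2)), th2; split => //.
    by rewrite gt_max t02 ltrBlDr ltrDl divr_gt0.
  have E : th0 + s' = th2 by move: h; rewrite /th2; lra.
  by move=> th /andP[u1 u2]; rewrite E ltr_norml; apply/andP; split; lra.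
have [w [n [th [k [hw hth hX]]]]] := zeros_dense b1 hd hdyn (hP0 t02) hPpos hPQ c01 c12 c22.
exists (expi th); split; last first.
  apply: He; apply: le_lt_trans (expi_lip _ _) _.
  by have := ce th hth; lra.
(* Index 0 corresponds to no tree, but X_0 = 0 is never an odd multiple of pi. *)
case: n hX => [/= hX|n hX]; last first.
  exists (sphtree w n); last exact: Zpart_zero hX.
  by exists w; [move=> i _; exact: hw|exists n].
exfalso; have k0 : (1 + 2 * k)%:~R = 0 :> R.
  have E : pi * (1 + 2 * k)%:~R = 0 :> R by rewrite hX intrD intrM; ring.
  by move/eqP: E; rewrite mulf_eq0 gt_eqF//= => /eqP.
move/eqP: k0; rewrite intr_eq0 => /eqP; clear; lia.
Qed.
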